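(* Assume (A1)–(A3). Fix $\eta\in(0,\lambda_* )$, $\lambda\in(\eta,\lambda_* )$ and $q\in(0,1)$. There exist constants $C>0$ and $\sigma_0>0$, independent of $\sigma,\nu,R,\xi,\omega$, such that the following holds. Let $0<\sigma<\sigma_0$, $|\nu|<\sigma$, let $0<R\le1$ be such that $$L_R\Big[\frac{C_\alpha}{\eta+\nu}+M_{\alpha,\lambda}\frac{\Gamma(1-\alpha)}{(\lambda-\eta-\nu)^{1-\alpha}}\Big]\le q,\qquad 0<\eta+\nu<\lambda,$$ and let $h(\omega,\xi)=P_sv^*(0,\omega,\xi)$, where $v^*(\cdot,\omega,\xi)$ is the unique fixed point of $\mathcal T(\cdot,\xi)$ in $C_\eta^-$. Then, with probability larger than $1-C\exp\{-1/\sqrt\sigma\}$, $$\big\|e^{z(\omega)}h(\omega,e^{-z(\omega)}\xi)-L_s^{-1}B_s(\xi,\xi)\big\|\le C\big(\|\xi\|+R^2+\sqrt\sigma\big)\,\|\xi\|^2$$ for all $\xi\in H_c$ with $\|\xi\|\le\tfrac12R$.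
   Context: Setting. $H$ is a real separable Hilbert space with norm $\|\cdot\|$ and scalar product $\langle\cdot,\cdot\rangle$; $\nu,\sigma\in\mathbb R$. (A1) $L$ is a non-negative self-adjoint unbounded operator on $H$ with compact resolvent, with an orthonormal basis of eigenfunctions $\{e_k\}_{k\ge1}$ and ordered eigenvalues $\lambda_{k+1}\ge\lambda_k$. (A2) The kernel of $L$, $H_c:=\mathrm{span}\{e_1,\dots,e_N\}$, is finite dimensional, i.e. $\lambda_1=\dots=\lambda_N=0$ and $\lambda_*:=\lambda_{N+1}>0$. $P_c$ is the orthogonal projection onto $H_c$, $P_s=I-P_c$, $H_s=P_sH$, $L_s=P_sL$. For $\alpha>0$, $H^\alpha$ is the domain of $L^{\alpha/2}$ with scalar product $\langle u,(1+L)^\alpha v\rangle$ and norm $\|\cdot\|_\alpha$; $H^{-\alpha}$ is its dual with respect to $\langle\cdot,\cdot\rangle$, with norm $\|\cdot\|_{-\alpha}$. Projections and the semigroup $e^{-tL}$ extend to $H^{-\alpha}$, and $L_s^{-1}$ maps $P_sH^{-\alpha}$ into $H_s$. (A3) For some $\alpha\in(0,1)$, $B:H\times H\to H^{-\alpha}$ is bilinear, symmetric and bounded, $\|B(u,\bar u)\|_{-\alpha}\le C_B\|u\|\|\bar u\|$; and $\langle B(u,u),u\rangle=0$ for all $u\in H^\alpha$. Write $B_c=P_cB$, $B_s=P_sB$. Probability space. Canonical two-sided Wiener space of paths $\omega\in C(\mathbb R,\mathbb R)$, $\omega(0)=0$, with Wiener measure and shift $\theta_t\omega(\cdot)=\omega(\cdot+t)-\omega(t)$;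 $z(\omega)=-\sigma\int_{-\infty}^0e^s\omega(s)ds$ and $z(t)=z(\theta_t\omega)$, the stationary solution of $dz+z\,dt=\sigma\,d\omega$; $\omega$ is restricted to a $\theta_t$-invariant full-probability set where $z(t)/t\to0$ and $\frac1t\int_0^tz\to0$ as $t\to\pm\infty$. Cut-off. $\chi:H\to\mathbb R$ is a fixed bounded smooth function with $\chi(u)=1$ for $\|u\|\le1$, $\chi(u)=0$ for $\|u\|\ge2$; $\chi_R(u)=\chi(u/R)$ and $B^{(R)}(u)=\chi_R(u)B(u,u)$, $B_c^{(R)}=P_cB^{(R)}$, $B_s^{(R)}=P_sB^{(R)}$. It is the convention that $C_B$ is such that $B^{(R)}:H\to H^{-\alpha}$ is globally Lipschitz with constant $L_R:=2RC_B$. Constants. $M_{\alpha,\lambda}$ (for $\lambda<\lambda_*$) is such that $\|e^{-Lt}u\|\le M_{\alpha,\lambda}e^{-\lambda t}t^{-\alpha}\|u\|_{-\alpha}$ for $t>0$, $u\in P_sH^{-\alpha}$; $C_\alpha$ is such that $\|P_cv\|\le C_\alpha\|P_cv\|_{-\alpha}$. Lyapunov–Perron operator. $C_\eta^-$ is the Banach space of $v\in C((-\infty,0],H)$ with $\|v\|_{C_\eta^-}=\sup_{t\le0}e^{\eta t-\int_0^tz(s)ds}\|v(t)\|<\infty$. For $\xi\in H_c$ and $t\le0$, $$\mathcal T(v,\xi)(t)=e^{\nu t+\int_0^tz(s)ds}\xi+\int_0^te^{\nu(t-\tau)+\int_\tau^tz(r)dr}e^{-z(\tau)}B_c^{(R)}(v(\tau)e^{z(\tau)})d\tau+\int_{-\infty}^te^{(-L_s+\nu)(t-\tau)+\int_\tau^tz(r)dr}e^{-z(\tau)}B_s^{(R)}(v(\tau)e^{z(\tau)})d\tau.$$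 Under the displayed smallness condition on $R$, $\mathcal T(\cdot,\xi)$ is a contraction on $C_\eta^-$ and so has a unique fixed point. *)

(* Defs.v *)
From HB Require Import structures.
From mathcomp Require Import all_boot all_order all_algebra.
From mathcomp Require Import all_classical all_reals all_analysis.

Set Implicit Arguments.
Unset Strict Implicit.
Unset Printing Implicit Defensive.
Import Order.TTheory GRing.Theory Num.Theory.
Import numFieldNormedType.Exports.

Local Open Scope classical_set_scope.
Local Open Scope ring_scope.

(* Raw data; the assumptions on them are the predicates below.
   Indices start at 0: [eb k] and [ev k] are e_{k+1} and lambda_{k+1}, so that
   lambda_* = lambda_{N+1} is [ev N].  [op] is only meaningful on [dom].
   An element f of the dual H^{-alpha} is given by its pairing v |-> <f, v>; it
   is a total function on H of which only the values on H^alpha matter. *)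
Record model (R : realType) (H : completeNormedModType R) := Model {
  ip : H -> H -> R;
  dom : set H;
  op : H -> H;
  eb : nat -> H;
  ev : nat -> R;
  dimc : nat;
  alpha : R;
  bil : H -> H -> (H -> R);
  CB : R;
  chi : H -> R
}.

Section Spaces.
Context {R : realType} {H : completeNormedModType R} (S : model H).

Local Notation "<< u , v >>" := (ip S u v) (format "<< u ,  v >>").
Local Notation N := (dimc S).

Definition inner_product : Prop :=
  [/\ forall u v, <<u, v>> = <<v, u>>,
      forall a u u' v, <<a *: u + u', v>> = a * <<u, v>> + <<u', v>> &
      forall u, <<u, u>> = `|u| ^+ 2].

(* The last clause says that [op] on [dom] coincides, as a graph, with its
   adjoint. *)
Definition self_adjoint : Prop :=
  [/\ dom S 0 /\ forall a u v, dom S u -> dom S v -> dom S (a *: u + v),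
      forall a u v, dom S u -> dom S v ->
        op S (a *: u + v) = a *: op S u + op S v,
      closure (dom S) = setT &
      forall u w, (forall v, dom S v -> <<u, op S v>> = <<w, v>>) <->
                  dom S u /\ w = op S u].

Definition nonnegative : Prop := forall u, dom S u -> 0 <= <<op S u, u>>.

Definition unbounded : Prop :=
  ~ exists C, forall u, dom S u -> `|op S u| <= C * `|u|.

Definition compact_resolvent : Prop :=
  exists (m : R) (K : H -> H),
    [/\ forall u, dom S (K u) /\ op S (K u) - m *: K u = u,
        forall u, dom S u -> K (op S u - m *: u) = u &
        compact (closure [set K u | u in [set u | `|u| <= 1]])].

Definition orthonormal_basis : Prop :=
  (forall i j, <<eb S i, eb S j>> = (i == j)%:R) /\
  (forall u, series (fun k => <<u, eb S k>> *: eb S k) @ \oo --> u).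

Definition A1 : Prop :=
  [/\ [/\ inner_product, self_adjoint, nonnegative & unbounded],
      compact_resolvent,
      orthonormal_basis,
      forall k, dom S (eb S k) /\ op S (eb S k) = ev S k *: eb S k &
      forall k, ev S k <= ev S k.+1].

Definition Hc : set H :=
  [set u | exists c : 'I_N -> R, u = \sum_(k < N) c k *: eb S k].

Definition A2 : Prop :=
  [/\ (0 < N)%N,
      [set u | dom S u /\ op S u = 0] = Hc,
      forall k, (k < N)%N -> ev S k = 0 &
      0 < ev S N].

(* H^alpha = D(L^{alpha/2}), through the spectral decomposition of L. *)
Definition Hpos : set H :=
  [set u | cvgn (series (fun k => ev S k `^ alpha S * <<u, eb S k>> ^+ 2))].

Definition pos_norm (u : H) : R :=
  Num.sqrt (limn (series (fun k =>
    (1 + ev S k) `^ alpha S * <<u, eb S k>> ^+ 2))).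

Definition Hneg : set (H -> R) :=
  [set f | (forall a u v, Hpos u -> Hpos v ->
              f (a *: u + v) = a * f u + f v) /\
           exists C, forall v, Hpos v -> `|f v| <= C * pos_norm v].

Definition neg_norm (f : H -> R) : R :=
  sup [set `|f v| | v in [set v | Hpos v /\ pos_norm v <= 1]].

Definition A3 : Prop :=
  [/\ 0 < alpha S < 1,
      forall u v, Hneg (bil S u v) /\
        neg_norm (bil S u v) <= CB S * `|u| * `|v|,
      forall a u u' v w, Hpos w ->
        bil S (a *: u + u') v w = a * bil S u v w + bil S u' v w,
      forall u v w, Hpos w -> bil S u v w = bil S v u w &
      forall u, Hpos u -> bil S u u u = 0].

(* Operations on H^{-alpha}.  H embeds into it by u |-> <u, .> = [ip S u]. *)

Definition Pc (f : H -> R) : H := \sum_(k < N) f (eb S k) *: eb S k.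

Definition Ps (f : H -> R) : H -> R := fun v => f v - f (Pc (ip S v)).

Definition PsH (u : H) : H := u - Pc (ip S u).

(* e^{-tL} f as an element of H, for t > 0. *)
Definition semigroup (t : R) (f : H -> R) : H :=
  limn (series (fun k => (expR (- ev S k * t) * f (eb S k)) *: eb S k)).

Definition Ls_inv (f : H -> R) : H :=
  limn (series (fun k =>
    if (k < N)%N then 0 else ((ev S k)^-1 * f (eb S k)) *: eb S k)).

Definition BR (r : R) (u : H) : H -> R :=
  fun w => chi S (r^-1 *: u) * bil S u u w.

Definition L_R (r : R) : R := 2 * r * CB S.

End Spaces.

(* f is C^{n+1} when it is Frechet differentiable and (x, v) |-> df_x(v) is C^n
   on V * V.  For a fixed n this is slightly weaker than asking for derivatives
   continuous in operator norm (which C^{n+1} in this sense implies up to order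
   n), so the resulting notion of C^oo map between normed spaces is the usual
   one. *)
Fixpoint Cn {R : realType} (n : nat) (V W : normedModType R) (f : V -> W)
    {struct n} : Prop :=
  match n with
  | 0 => continuous f
  | m.+1 => (forall x, differentiable f x) /\
            Cn m (fun p : (V * V)%type => 'd f (p.1) (p.2) : W)
  end.

Definition smooth {R : realType} (V W : normedModType R) (f : V -> W) : Prop :=
  forall n, Cn n f.

Section CutOff.
Context {R : realType} {H : completeNormedModType R} (S : model H).

Definition cutoff : Prop :=
  [/\ smooth (chi S : H -> R^o),
      exists K, forall u, `|chi S u| <= K,
      forall u, `|u| <= 1 -> chi S u = 1,
      forall u, 2 <= `|u| -> chi S u = 0 &
      forall (r : R) u v, 0 < r ->
        neg_norm S (BR S r u \- BR S r v) <= L_R S r * `|u - v| ].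

End CutOff.

Section Integrals.
Context {R : realType} {H : completeNormedModType R} (S : model H).
Local Notation mu := (@lebesgue_measure R).

(* Bochner integral: for separable H, weak measurability together with
   integrability of the norm is Bochner integrability (Pettis), and the value is
   determined by its scalar products. *)
Definition is_bochner (D : set R) (f : R -> H) (x : H) : Prop :=
  [/\ forall w, measurable_fun D (fun s => ip S (f s) w),
      mu.-integrable D (fun s => `|f s|%:E) &
      forall w, ip S x w = \int[mu]_(s in D) ip S (f s) w].

Definition bochner (D : set R) (f : R -> H) : H := get (is_bochner D f).

(* int_a^b with the usual sign convention when b < a. *)
Definition bochner_ab (a b : R) (f : R -> H) : H :=
  if a <= b then bochner `[a, b] f else - bochner `[b, a] f.

Definition int_ab (a b : R) (f : R -> R) : R :=
  if a <= b then \int[mu]_(s in `[a, b]) f s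
  else - \int[mu]_(s in `[b, a]) f s.

Definition Gamma (x : R) : R :=
  \int[mu]_(t in `]0, +oo[) (t `^ (x - 1) * expR (- t)).

End Integrals.

Record wpath (R : realType) := WPath {
  wfun :> R -> R;
  wfun_continuous : continuous wfun;
  wfun0 : wfun 0 = 0
}.

HB.instance Definition _ (R : realType) := gen_eqMixin (wpath R).
HB.instance Definition _ (R : realType) := gen_choiceMixin (wpath R).
HB.instance Definition _ (R : realType) := isPointed.Build (wpath R)
  (@WPath R (fun=> 0) (@cst_continuous _ _ 0) erefl).

Section Wiener.
Context {R : realType}.
Local Notation mu := (@lebesgue_measure R).

(* The coordinate sigma-algebra, which is the Borel sigma-algebra of locally
   uniform convergence. *)
Definition cylinders : set (set (wpath R)) :=
  [set A | exists (t : R) (B : set R),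
             measurable B /\ A = [set w : wpath R | B (w t)]].

Definition wiener_space := g_sigma_algebraType cylinders.

(* Increments over successive intervals are independent and N(0, length); since
   w(0) = 0 this determines all finite-dimensional laws, hence P. *)
Definition wiener_measure (P : set wiener_space -> \bar R) : Prop :=
  forall (n : nat) (t : nat -> R) (B : nat -> set R),
    (forall i, (i < n)%N -> t i < t i.+1) ->
    (forall i, (i < n)%N -> measurable (B i)) ->
    P [set w : wpath R | forall i, (i < n)%N -> B i (w (t i.+1) - w (t i))] =
    (\prod_(i < n) normal_prob 0 (Num.sqrt (t i.+1 - t i)) (B i))%E.

Lemma wshift_continuous (t : R) (w : wpath R) :
  continuous (fun s => w (s + t) - w t).
Proof.
move=> s; apply: (@cvgB _ R^o); last exact: cvg_cst.
apply: (@continuous_comp _ _ _ (fun s => s + t) w).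
  by apply: (@cvgD _ R^o); [exact: cvg_id|exact: cvg_cst].
exact: wfun_continuous.
Qed.

Lemma wshift0 (t : R) (w : wpath R) : w (0 + t) - w t = 0.
Proof. by rewrite add0r subrr. Qed.

Definition wshift (t : R) (w : wpath R) : wpath R :=
  WPath (@wshift_continuous t w) (wshift0 t w).

Definition z0 (sigma : R) (w : wpath R) : R :=
  - sigma * \int[mu]_(s in `]-oo, 0]) (expR s * w s).

Definition z (sigma : R) (w : wpath R) (t : R) : R := z0 sigma (wshift t w).

(* The integrability clause makes the integral defining z meaningful; it holds
   almost surely and is shift invariant. *)
Definition good_paths (P : set wiener_space -> \bar R) (Om : set wiener_space)
    : Prop :=
  [/\ measurable Om, P Om = 1%E,
      forall t w, Om w -> Om (wshift t w),
      forall w : wpath R, Om w ->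
        mu.-integrable `]-oo, 0] (fun s => (expR s * w s)%:E) &
      forall (sigma : R) (w : wpath R), Om w ->
        [/\ z sigma w t / t @[t --> +oo] --> 0,
            z sigma w t / t @[t --> -oo] --> 0,
            t^-1 * int_ab 0 t (z sigma w) @[t --> +oo] --> 0 &
            t^-1 * int_ab 0 t (z sigma w) @[t --> -oo] --> 0]].

End Wiener.

Section LyapunovPerron.
Context {R : realType} {H : completeNormedModType R} (S : model H).
Context (eta nu sigma r : R) (w : wpath R).
Local Notation zw := (z sigma w).

(* Elements of C_eta^- are functions on R of which only the restriction to
   ]-oo, 0] matters. *)
Definition Ceta : set (R -> H) :=
  [set v : R -> H | {within `]-oo, (0 : R)], continuous v} /\
           exists C, forall t, t <= 0 ->
             expR (eta * t - int_ab 0 t zw) * `|v t| <= C].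

(* On the range of P_s, e^{(-L_s+nu)s} = e^{nu s} e^{-sL}. *)
Definition LP (v : R -> H) (xi : H) (t : R) : H :=
  expR (nu * t + int_ab 0 t zw) *: xi
  + bochner_ab S 0 t (fun tau =>
      (expR (nu * (t - tau) + int_ab tau t zw) * expR (- zw tau)) *:
        Pc S (BR S r (expR (zw tau) *: v tau)))
  + bochner S `]-oo, t[ (fun tau =>
      (expR (nu * (t - tau) + int_ab tau t zw) * expR (- zw tau)) *:
        semigroup S (t - tau) (Ps S (BR S r (expR (zw tau) *: v tau)))).

Definition LP_fixpoint (v : R -> H) (xi : H) : Prop :=
  Ceta v /\ forall t, t <= 0 -> LP v xi t = v t.

Definition vstar (xi : H) : R -> H := get (fun v => LP_fixpoint v xi).

Definition h (xi : H) : H := PsH S (vstar xi 0).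

End LyapunovPerron.

(* Main.v *)
(* Since [z(t) = sigma w(t) - y(t)] with [y' = z], the substitution [v = e^{-z} p Y] with
   [p(t) = exp(nu t + sigma w(t))] turns the random Lyapunov-Perron equation into the deterministic
   one [Y(t) = xi + Duhamel terms of p^{-1} B^(R)(p Y)], and [e^z h(e^{-z} xi)] into its stable
   Duhamel term at time 0.  For [p = 1] and [Y = xi] this term is exactly [L_s^{-1} B_s(xi, xi)].
   On an event of probability at least [1 - 9 exp(-1 / sqrt sigma)], obtained by chaining, a path
   satisfies [|w(t)| <= C sigma^{-1/4} (1 + |t|)] for [t <= 0], so [|p - 1| <= C sqrt sigma e^{-mu t}].
   The quadratic bound on [B] cannot be used for all times, because [Y] may grow exponentially as
   [t -> -oo]; but [|Y(t)| <= 2 (|xi| e^{-rho t} + A |xi|^3 e^{-kappa t})] holds, because the set it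
   defines is invariant under the contraction: the quadratic bound serves where [|xi| e^{-rho t}] is
   small, the Lipschitz bound with constant [L_R] elsewhere.  Inserting this twice into the equation
   gives an error [C (|xi| + sqrt sigma) |xi|^2]. *)
From HB Require Import structures.
Require Import Defs.
From mathcomp Require Import all_boot all_order all_algebra.
From mathcomp Require Import all_classical all_reals all_analysis.
From mathcomp Require Import measurable_realfun ring lra.
Set Implicit Arguments.
Unset Strict Implicit.
Unset Printing Implicit Defensive.
Import Order.TTheory GRing.Theory Num.Theory.
Import numFieldNormedType.Exports.
Local Open Scope classical_set_scope.
Local Open Scope ring_scope.

(** * Expansions in the eigenbasis *)

(** The smallness condition makes the map a contraction at the single exponent kappa = eta + nu; at
    every other exponent the constant [lp_const] is merely bounded. A majorant of the fixed point
    must therefore find its smallness elsewhere: its linear part, of rate rho, takes it from the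
    quadratic bound below a threshold delta, its cubic part from q. The cubic weight e^{-3 rho t}
    times the noise loss e^{-2 mu t} then has to be exactly e^{-kappa t}, whence kappa = 3 rho + 2
    mu. The final error carries two more factors e^{-mu t}, and kappa + 2 mu < lambda is the room
    needed for it in the stable integral. Conjugation by p and 1/p leaves the Lipschitz constant of
    the cut-off nonlinearity unchanged, so one smallness condition serves every path, and the path
    enters the estimates only through p - 1 and 1/p - 1. The auxiliary constants are fixed before
    sigma, nu, the radius, xi and the path; mu is a fraction of eta and of lambda - eta so that the
    exponents stay in a fixed compact range. *)

Section Hilbert.
Context {R : realType} {H : completeNormedModType R} (S : model H).
Hypothesis hip : inner_product S.
Local Notation "<< u , v >>" := (ip S u v) (format "<< u ,  v >>").

Lemma ipC u v : <<u, v>> = <<v, u>>. Proof. by case: hip. Qed.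

Lemma ip_lin a u u' v : <<a *: u + u', v>> = a * <<u, v>> + <<u', v>>.
Proof. by case: hip. Qed.

Lemma ip_sq u : <<u, u>> = `|u| ^+ 2. Proof. by case: hip. Qed.

Lemma ipDl u u' v : <<u + u', v>> = <<u, v>> + <<u', v>>.
Proof. by rewrite -{1}[u]scale1r ip_lin mul1r. Qed.

Lemma ip0l v : <<0, v>> = 0.
Proof. by have := ipDl 0 0 v; rewrite addr0 => /eqP; rewrite -subr_eq0 opprD addNKr oppr_eq0 => /eqP. Qed.

Lemma ipZl a u v : <<a *: u, v>> = a * <<u, v>>.
Proof. by rewrite -[a *: u]addr0 ip_lin ip0l addr0. Qed.

Lemma ipNl u v : <<- u, v>> = - <<u, v>>.
Proof. by rewrite -scaleN1r ipZl mulN1r. Qed.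

Lemma ipBl u u' v : <<u - u', v>> = <<u, v>> - <<u', v>>.
Proof. by rewrite ipDl ipNl. Qed.

Lemma ipDr u v v' : <<u, v + v'>> = <<u, v>> + <<u, v'>>.
Proof. by rewrite ipC ipDl !(ipC u). Qed.

Lemma ipZr a u v : <<u, a *: v>> = a * <<u, v>>.
Proof. by rewrite ipC ipZl ipC. Qed.

Lemma ipBr u v v' : <<u, v - v'>> = <<u, v>> - <<u, v'>>.
Proof. by rewrite ipC ipBl !(ipC u). Qed.

Lemma ip0r v : <<v, 0>> = 0. Proof. by rewrite ipC ip0l. Qed.

Lemma ip_suml (I : Type) (r : seq I) (Q : pred I) (F : I -> H) v :
  <<\sum_(i <- r | Q i) F i, v>> = \sum_(i <- r | Q i) <<F i, v>>.
Proof.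
by elim/big_rec2: _ => [|i y x _ <-]; [rewrite ip0l|rewrite ipDl].
Qed.

Lemma ip_sumr (I : Type) (r : seq I) (Q : pred I) (F : I -> H) v :
  <<v, \sum_(i <- r | Q i) F i>> = \sum_(i <- r | Q i) <<v, F i>>.
Proof. by rewrite ipC ip_suml; apply: eq_bigr => i _; rewrite ipC. Qed.

Lemma cauchy_schwarz u v : `|<<u, v>>| <= `|u| * `|v|.
Proof.
have [->|v0] := eqVneq v 0; first by rewrite ip0r !normr0 mulr0.
have vp : 0 < `|v| ^+ 2 by rewrite exprn_gt0 // normr_gt0.
have : 0 <= <<u - (<<u, v>> / `|v| ^+ 2) *: v, u - (<<u, v>> / `|v| ^+ 2) *: v>>.
  by rewrite ip_sq sqr_ge0.
rewrite ipBl !ipBr !ipZl !ipZr (ipC v u) !ip_sq.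
have -> : `|u| ^+ 2 - <<u, v>> / `|v| ^+ 2 * <<u, v>> -
  (<<u, v>> / `|v| ^+ 2 * <<u, v>> -
   <<u, v>> / `|v| ^+ 2 * (<<u, v>> / `|v| ^+ 2 * `|v| ^+ 2)) =
  (`|u| ^+ 2 * `|v| ^+ 2 - <<u, v>> ^+ 2) / `|v| ^+ 2.
  by field; rewrite normr_eq0.
rewrite pmulr_lge0 ?invr_gt0 // subr_ge0 -exprMn -(real_normK (num_real <<u, v>>)).
by rewrite ler_sqr // nnegrE // mulr_ge0.
Qed.

Lemma ip_cvg (u : nat -> H) x w :
  u n @[n --> \oo] --> x -> <<u n, w>> @[n --> \oo] --> <<x, w>>.
Proof.
move=> ux; apply/cvgrPdist_le => e e0.
have d0 : 0 < e / (`|w| + 1) by rewrite divr_gt0 // ltr_wpDl.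
near=> n; rewrite -ipBl (le_trans (cauchy_schwarz _ _)) //.
have : `|x - u n| <= e / (`|w| + 1).
  by near: n; move/cvgrPdist_le : ux; apply.
move=> h; apply: (@le_trans _ _ (e / (`|w| + 1) * (`|w| + 1))).
  by apply: ler_pM => //; rewrite lerDl.
by rewrite divfK // gt_eqF // ltr_wpDl.
Unshelve. all: by end_near. Qed.

Hypothesis hb : orthonormal_basis S.
Local Notation e := (eb S).

Lemma ebE i j : <<e i, e j>> = (i == j)%:R. Proof. by case: hb. Qed.

Lemma norm_eb i : `|e i| = 1.
Proof.
by apply/eqP; rewrite -[_ == _](@eqrXn2 _ 2) // -ip_sq ebE eqxx expr1n.
Qed.

Lemma basis_cvg u : series (fun k => <<u, e k>> *: e k) @ \oo --> u.
Proof. by case: hb. Qed.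

Lemma ip_comb (c : nat -> R) m n k :
  <<\sum_(m <= i < n) c i *: e i, e k>> = if (m <= k < n)%N then c k else 0.
Proof.
rewrite ip_suml; under eq_bigr do rewrite ipZl ebE.
case: ifPn => [mkn|nk].
  rewrite (bigD1_seq k) ?iota_uniq ?mem_index_iota //= eqxx mulr1.
  by rewrite big1 ?addr0 // => i /negPf ->; rewrite mulr0.
rewrite big_seq big1 // => i; rewrite mem_index_iota => mi.
by case: eqP mi => [->|_ _]; [rewrite (negPf nk)|rewrite mulr0].
Qed.

Lemma normsq_comb (c : nat -> R) m n :
  `|\sum_(m <= i < n) c i *: e i| ^+ 2 = \sum_(m <= i < n) c i ^+ 2.
Proof.
rewrite -ip_sq ip_sumr big_seq [RHS]big_seq; apply: eq_bigr => k.
by rewrite mem_index_iota => mk; rewrite ipZr ip_comb mk expr2.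
Qed.

Lemma ip_ext u v : (forall k, <<u, e k>> = <<v, e k>>) -> u = v.
Proof.
move=> uv; have := @basis_cvg u; under [X in series X]funext do rewrite uv.
by move=> /cvg_lim <- //; apply/cvg_lim => //; exact: basis_cvg.
Qed.

Lemma parseval u w :
  series (fun k => <<u, e k>> * <<e k, w>>) @ \oo --> <<u, w>>.
Proof.
have := ip_cvg (w := w) (@basis_cvg u).
by under [X in X @ _]funext do (rewrite /series /= ip_suml; under eq_bigr do rewrite ipZl).
Qed.

Lemma parseval_sq u : series (fun k => <<u, e k>> ^+ 2) @ \oo --> `|u| ^+ 2.
Proof.
rewrite -ip_sq; have := @parseval u u.
by under [X in series X]funext do rewrite (ipC (e _)) -expr2.
Qed.

Lemma bessel u n : \sum_(0 <= k < n) <<u, e k>> ^+ 2 <= `|u| ^+ 2.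
Proof.
have := @parseval_sq u => /cvgP/nondecreasing_cvgn_le h.
rewrite -(cvg_lim _ (@parseval_sq u)) //; apply: h.
by apply/nondecreasing_seqP => k; rewrite /series /= big_nat_recr //= lerDl sqr_ge0.
Qed.

(** By [normsq_comb] the squared norm of a block of this series is a block of the scalar series of
    squares, so the Cauchy criterion transfers. *)
Lemma basis_series_cvg (c : nat -> R) B :
  (forall n, \sum_(0 <= k < n) c k ^+ 2 <= B) ->
  cvgn (series (fun k => c k *: e k)).
Proof.
move=> cB; apply: cauchy_cvg; apply/cauchy_seriesP => d d0.
have : cvgn (series (fun k => c k ^+ 2)).
  apply: nondecreasing_is_cvgn.
    by apply/nondecreasing_seqP => k; rewrite /series /= big_nat_recr //= lerDl sqr_ge0.
  by exists B => _ [n _ <-]; exact: cB.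
move/cvg_cauchy/cauchy_seriesP => /(_ (d ^+ 2)); rewrite exprn_gt0 // => /(_ isT).
apply: filterS => -[m n] /=; rewrite -normsq_comb normrX normr_id.
by rewrite ltr_pXn2r // nnegrE // ltW.
Qed.

Lemma ip_basis_series (c : nat -> R) k : cvgn (series (fun k => c k *: e k)) ->
  <<limn (series (fun k => c k *: e k)), e k>> = c k.
Proof.
move=> /(ip_cvg (w := e k)) => h.
rewrite -(cvg_lim _ h) //; apply/cvg_lim => //.
apply: cvg_near_cst; exists k.+1 => // n /= kn.
by rewrite /series /= ip_comb /= kn.
Qed.

Lemma normsq_coords_le u B :
  (forall n, \sum_(0 <= k < n) <<u, e k>> ^+ 2 <= B) -> `|u| ^+ 2 <= B.
Proof.
move=> h; have := @parseval_sq u => cu; rewrite -(cvg_lim _ cu) //.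
by apply: limr_le; [exact: cvgP cu|apply: nearW => n; exact: h].
Qed.

End Hilbert.

(** * Dual spaces and the smoothing semigroup *)

Section Dual.
Context {R : realType} {H : completeNormedModType R} (S : model H).
Hypotheses (hip : inner_product S) (hb : orthonormal_basis S).
Hypotheses (hev : forall k, 0 <= ev S k) (hal : 0 < alpha S < 1).
Local Notation "<< u , v >>" := (ip S u v) (format "<< u ,  v >>").
Local Notation e := (eb S).
Local Notation N := (dimc S).
Local Notation nn := (neg_norm S).
Local Notation wt k := ((1 + ev S k) `^ alpha S).

Lemma wt_ge1 k : 1 <= wt k.
Proof.
have /andP[a0 _] := hal.
have h : 1 `^ alpha S = 1 :> R by rewrite powR1.
by rewrite -[leLHS]h ge0_ler_powR ?nnegrE ?(ltW a0) ?addr_ge0 ?lerDl ?hev.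
Qed.

Lemma wt_ge0 k : 0 <= wt k. Proof. exact: powR_ge0. Qed.

Lemma wt_le k : wt k <= 1 + ev S k.
Proof.
have /andP[a0 a1] := hal.
by rewrite -[leRHS]powRr1 ?addr_ge0 ?hev // ler_powR ?lerDl ?hev // ltW.
Qed.

(** [Hpos] is defined with the weight lambda^alpha and [pos_norm] with (1 + lambda)^alpha. This
    comparison makes the two interchangeable, the extra 1 being paid for by Bessel's inequality. *)
Lemma wt_le_pow k : wt k <= 2 * (1 + ev S k `^ alpha S).
Proof.
have /andP[a0 a1] := hal.
have p2 : 2 `^ alpha S <= 2 :> R.
  by rewrite -[leRHS]powRr1 // ler_powR ?ler1n // ltW.
have pe := powR_ge0 (ev S k) (alpha S).
have [e1|e1] := lerP (ev S k) 1.
  apply: (@le_trans _ _ (2 `^ alpha S)).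
    by rewrite ge0_ler_powR ?nnegrE ?(ltW a0) ?addr_ge0 ?hev //; lra.
  by rewrite (le_trans p2) // ler_peMr // lerDl.
apply: (@le_trans _ _ ((2 * ev S k) `^ alpha S)).
  by rewrite ge0_ler_powR ?nnegrE ?(ltW a0) ?addr_ge0 ?mulr_ge0 ?hev //; lra.
rewrite powRM ?hev //; apply: (@le_trans _ _ (2 * ev S k `^ alpha S)).
  by rewrite ler_wpM2r.
by rewrite ler_pM2l // lerDr.
Qed.

Let psum u n := \sum_(0 <= k < n) wt k * <<u, e k>> ^+ 2.

Let psum_nd u : nondecreasing_seq (psum u).
Proof.
by apply/nondecreasing_seqP => k; rewrite /psum big_nat_recr //= lerDl mulr_ge0 ?wt_ge0 ?sqr_ge0.
Qed.

Lemma HposP u : Hpos S u <->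
  exists B, forall n, \sum_(0 <= k < n) wt k * <<u, e k>> ^+ 2 <= B.
Proof.
split=> [cu|[B hB]].
  exists (2 * (`|u| ^+ 2 + limn (series (fun k => ev S k `^ alpha S * <<u, e k>> ^+ 2)))) => n.
  apply: (@le_trans _ _ (\sum_(0 <= k < n) 2 * (<<u, e k>> ^+ 2 + ev S k `^ alpha S * <<u, e k>> ^+ 2))).
    apply: ler_sum => k _; rewrite -{2}[<<u, e k>> ^+ 2]mul1r -mulrDl mulrA.
    by rewrite ler_wpM2r ?sqr_ge0 // wt_le_pow.
  rewrite -big_distrr big_split /= ler_pM2l // lerD ?bessel //.
  have := nondecreasing_cvgn_le _ cu n; apply.
  by apply/nondecreasing_seqP => k; rewrite /series /= big_nat_recr //= lerDl mulr_ge0 ?powR_ge0 ?sqr_ge0.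
apply: nondecreasing_is_cvgn.
  by apply/nondecreasing_seqP => k; rewrite /series /= big_nat_recr //= lerDl mulr_ge0 ?powR_ge0 ?sqr_ge0.
exists B => _ [n _ <-]; apply: le_trans (hB n); apply: ler_sum => k _.
have /andP[a0 _] := hal.
by rewrite ler_wpM2r ?sqr_ge0 // ge0_ler_powR ?nnegrE ?(ltW a0) ?addr_ge0 ?hev // lerDr.
Qed.

Lemma cvg_psum u : Hpos S u -> cvgn (psum u).
Proof.
move=> /HposP[B hB]; apply: nondecreasing_is_cvgn => //.
by exists B => _ [n _ <-]; exact: hB.
Qed.

Lemma pos_norm_ge0 u : 0 <= pos_norm S u. Proof. exact: sqrtr_ge0. Qed.

Lemma le_pos_norm u n : Hpos S u ->
  \sum_(0 <= k < n) wt k * <<u, e k>> ^+ 2 <= pos_norm S u ^+ 2.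
Proof.
move=> hu; have := nondecreasing_cvgn_le (@psum_nd u) (cvg_psum hu) => h.
rewrite /pos_norm sqr_sqrtr; first exact: h.
by apply: le_trans (h 0%N); rewrite /psum big_geq.
Qed.

Lemma pos_norm_le u c : 0 <= c ->
  (forall n, \sum_(0 <= k < n) wt k * <<u, e k>> ^+ 2 <= c ^+ 2) ->
  Hpos S u /\ pos_norm S u <= c.
Proof.
move=> c0 hc; have hu : Hpos S u by apply/HposP; exists (c ^+ 2).
split=> //; rewrite -(ger0_norm c0) -sqrtr_sqr ler_wsqrtr //.
by apply: limr_le; [exact: (cvg_psum hu)|apply: nearW => n; exact: hc].
Qed.

(** The norm sees only the moduli of the coordinates; scalings and both spectral projections are
    instances. *)
Lemma Hpos_dominated (a : R) u v : Hpos S u ->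
  (forall k, `|<<v, e k>>| <= `|a| * `|<<u, e k>>|) ->
  Hpos S v /\ pos_norm S v <= `|a| * pos_norm S u.
Proof.
move=> hu vu; apply: pos_norm_le => [|n]; first by rewrite mulr_ge0 ?pos_norm_ge0.
rewrite exprMn; apply: le_trans (ler_wpM2l (sqr_ge0 _) (le_pos_norm n hu)).
rewrite mulr_sumr; apply: ler_sum => k _; rewrite [leRHS]mulrCA ler_wpM2l ?wt_ge0 //.
rewrite -[<<v, _>> ^+ 2]real_normK ?num_real // -[<<u, _>> ^+ 2]real_normK ?num_real //.
by rewrite -exprMn ler_sqr // nnegrE // mulr_ge0.
Qed.

Lemma Hpos_lin a u v : Hpos S u -> Hpos S v -> Hpos S (a *: u + v).
Proof.
move=> /HposP[B hB] /HposP[B' hB']; apply/HposP.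
exists (2 * (a ^+ 2 * B + B')) => n.
apply: (@le_trans _ _ (\sum_(0 <= k < n)
   2 * (a ^+ 2 * (wt k * <<u, e k>> ^+ 2) + wt k * <<v, e k>> ^+ 2))).
  apply: ler_sum => k _; rewrite ip_lin //.
  have -> : 2 * (a ^+ 2 * (wt k * <<u, e k>> ^+ 2) + wt k * <<v, e k>> ^+ 2) =
    wt k * (2 * ((a * <<u, e k>>) ^+ 2 + <<v, e k>> ^+ 2)) by ring.
  rewrite ler_wpM2l ?wt_ge0 //.
  by have := sqr_ge0 (a * <<u, e k>> - <<v, e k>>); nra.
rewrite -big_distrr big_split /= -big_distrr /= ler_pM2l // lerD //.
by rewrite ler_wpM2l ?sqr_ge0.
Qed.

Lemma Hpos0 : Hpos S 0.
Proof.
by apply/HposP; exists 0 => n; rewrite big1 // => k _; rewrite ip0l // expr0n mulr0.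
Qed.

Lemma HposZ a u : Hpos S u -> Hpos S (a *: u).
Proof. by move=> hu; rewrite -[_ *: _]addr0; apply: Hpos_lin => //; exact: Hpos0. Qed.

Lemma pos_normZ a u : Hpos S u -> pos_norm S (a *: u) <= `|a| * pos_norm S u.
Proof.
by move=> hu; have [] := @Hpos_dominated a u (a *: u) hu _ => // k; rewrite ipZl // normrM.
Qed.

Lemma pos_norm0 : pos_norm S 0 = 0.
Proof.
apply/eqP; rewrite eq_le pos_norm_ge0 andbT.
by have := pos_normZ 0 Hpos0; rewrite scaler0 normr0 mul0r.
Qed.

Lemma norm_le_pos_norm u : Hpos S u -> `|u| <= pos_norm S u.
Proof.
move=> hu; rewrite -ler_sqr ?nnegrE ?pos_norm_ge0 //.
apply: (normsq_coords_le hip hb) => n; apply: le_trans (le_pos_norm n hu).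
by apply: ler_sum => k _; rewrite ler_peMl ?sqr_ge0 // wt_ge1.
Qed.

Lemma Hpos_eb k : Hpos S (e k).
Proof.
apply/HposP; exists (wt k) => n; case: (ltnP k n) => kn.
  rewrite (bigD1_seq k) ?iota_uniq ?mem_index_iota //= ebE // eqxx expr1n mulr1.
  by rewrite big1 ?addr0 // => i /negPf; rewrite ebE // eq_sym => ->; rewrite expr0n mulr0.
rewrite big_seq big1 ?wt_ge0 // => i; rewrite mem_index_iota => /andP[_ ik].
by rewrite ebE // gtn_eqF ?expr0n ?mulr0 // (leq_trans ik kn).
Qed.

Lemma Hpos_comb (c : nat -> R) m n : Hpos S (\sum_(m <= i < n) c i *: e i).
Proof.
elim/big_rec: _ => [|i x _ hx]; first exact: Hpos0.
by apply: Hpos_lin => //; exact: Hpos_eb.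
Qed.

Lemma Hneg_lin f a u v : Hneg S f -> Hpos S u -> Hpos S v ->
  f (a *: u + v) = a * f u + f v.
Proof. by move=> [h _]; exact: h. Qed.

Lemma Hneg0 f : Hneg S f -> f 0 = 0.
Proof.
move=> hf; have := Hneg_lin 1 hf Hpos0 Hpos0.
by rewrite scaler0 addr0 mul1r => /eqP; rewrite -subr_eq subrr eq_sym => /eqP.
Qed.

Lemma HnegZ f a u : Hneg S f -> Hpos S u -> f (a *: u) = a * f u.
Proof.
by move=> hf hu; rewrite -[_ *: _]addr0 Hneg_lin ?Hneg0 ?addr0 //; exact: Hpos0.
Qed.

Lemma Hneg_comb f (c : nat -> R) m n : Hneg S f ->
  f (\sum_(m <= i < n) c i *: e i) = \sum_(m <= i < n) c i * f (e i).
Proof.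
move=> hf; rewrite unlock /=; elim: (index_iota m n) => [|i s ih] /=; first exact: Hneg0.
rewrite Hneg_lin ?ih //; first exact: Hpos_eb.
elim: s {ih} => [|j s ih]; first exact: Hpos0.
by apply: Hpos_lin => //; exact: Hpos_eb.
Qed.

Lemma le_neg_norm f v : Hneg S f -> Hpos S v -> `|f v| <= nn f * pos_norm S v.
Proof.
move=> hf hv; have [_ [C hC]] := hf.
have hs : has_sup [set `|f v| | v in [set v | Hpos S v /\ pos_norm S v <= 1]].
  split; first by exists `|f 0|, 0 => //; split; [exact: Hpos0|rewrite pos_norm0].
  exists `|C| => _ [u [hu u1] <-]; rewrite (le_trans (hC _ hu)) //.
  rewrite (le_trans (ler_wpM2r (pos_norm_ge0 u) (ler_norm C))) //.
  by rewrite ler_piMr.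
(* A vector of norm 0 cannot be normalised; there the boundedness clause of [Hneg] gives
   [f v = 0]. *)
have [v0|v0] := eqVneq (pos_norm S v) 0.
  by have := hC _ hv; rewrite v0 !mulr0.
have vp : 0 < pos_norm S v by rewrite lt_neqAle eq_sym v0 pos_norm_ge0.
rewrite -ler_pdivrMr //; apply: ub_le_sup; first by case: hs.
exists ((pos_norm S v)^-1 *: v).
  split; first exact: HposZ.
  by rewrite (le_trans (pos_normZ _ hv)) // ger0_norm ?invr_ge0 ?pos_norm_ge0 // mulVf.
by rewrite HnegZ // normrM mulrC [`|_^-1|]ger0_norm ?invr_ge0 ?pos_norm_ge0.
Qed.

Lemma neg_norm_le f c : 0 <= c ->
  (forall v, Hpos S v -> `|f v| <= c * pos_norm S v) -> nn f <= c.
Proof.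
move=> c0 hc; apply: ge_sup.
  by exists `|f 0|, 0 => //; split; [exact: Hpos0|rewrite pos_norm0].
move=> _ [u [hu u1] <-]; rewrite (le_trans (hc _ hu)) //.
by rewrite ler_piMr.
Qed.

(** Valid for every function [f], in the dual or not, because [sup] takes the value 0 on a set
    without supremum. *)
Lemma neg_norm_ge0 f : 0 <= nn f.
Proof.
rewrite /neg_norm; set E := (X in sup X).
have [hs|/sup_out->//] := pselect (has_sup E).
have E0 : E `|f 0| by exists 0 => //; split; [exact: Hpos0|rewrite pos_norm0].
by apply: (@le_trans _ _ `|f 0|) => //; apply: ub_le_sup => //; case: hs.
Qed.

Lemma eq_neg_norm f g : (forall v, Hpos S v -> f v = g v) -> nn f = nn g.
Proof.
move=> fg; congr sup; apply/seteqP; split => _ [u [hu u1] <-]; exists u => //;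
by rewrite fg.
Qed.

Lemma eq_Hneg f g : (forall v, Hpos S v -> f v = g v) -> Hneg S f -> Hneg S g.
Proof.
move=> fg [hl [C hC]]; split.
  by move=> a u v hu hv; rewrite -!fg //; [exact: hl|exact: Hpos_lin].
by exists C => v hv; rewrite -fg //; exact: hC.
Qed.

Lemma Hneg_comb2 f g a : Hneg S f -> Hneg S g -> Hneg S (fun v => a * f v + g v).
Proof.
move=> hf hg; split.
  by move=> b u v hu hv; rewrite !Hneg_lin //; ring.
exists (`|a| * nn f + nn g) => v hv; rewrite mulrDl -mulrA.
rewrite (le_trans (ler_normD _ _)) // normrM lerD //; last exact: le_neg_norm.
by rewrite ler_wpM2l // le_neg_norm.
Qed.

Lemma neg_norm_comb2 f g a : Hneg S f -> Hneg S g ->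
  nn (fun v => a * f v + g v) <= `|a| * nn f + nn g.
Proof.
move=> hf hg; apply: neg_norm_le.
  by rewrite addr_ge0 ?mulr_ge0 ?neg_norm_ge0.
move=> v hv; rewrite mulrDl -mulrA.
rewrite (le_trans (ler_normD _ _)) // normrM lerD //; last exact: le_neg_norm.
by rewrite ler_wpM2l // le_neg_norm.
Qed.

Lemma Hneg_cst0 : Hneg S (fun=> 0).
Proof.
by split=> [*|]; [rewrite mulr0 addr0|exists 0 => v _; rewrite normr0 mul0r].
Qed.

Lemma neg_norm_cst0 : nn (fun=> 0) = 0.
Proof.
apply/eqP; rewrite eq_le neg_norm_ge0 andbT.
by apply: neg_norm_le => // v _; rewrite normr0 mul0r.
Qed.

Lemma HnegZl f a : Hneg S f -> Hneg S (fun v => a * f v).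
Proof.
move=> hf; apply: eq_Hneg (Hneg_comb2 a hf Hneg_cst0) => v _; by rewrite addr0.
Qed.

Lemma neg_normZl f a : Hneg S f -> nn (fun v => a * f v) <= `|a| * nn f.
Proof.
move=> hf; have := neg_norm_comb2 a hf Hneg_cst0; rewrite neg_norm_cst0 addr0.
by congr (_ <= _); apply: eq_neg_norm => v _; rewrite addr0.
Qed.

Lemma HnegB f g : Hneg S f -> Hneg S g -> Hneg S (f \- g).
Proof.
move=> hf hg; apply: eq_Hneg (Hneg_comb2 (-1) hg hf) => v _ /=.
by rewrite mulN1r addrC.
Qed.

Lemma PcE f : Pc S f = \sum_(0 <= k < N) f (e k) *: e k.
Proof. by rewrite /Pc big_mkord. Qed.

Lemma ip_Pc f k : <<Pc S f, e k>> = if (k < N)%N then f (e k) else 0.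
Proof. by rewrite PcE (ip_comb hip hb (fun k => f (e k))) leq0n. Qed.

(** The projection that [Ps] defines by duality agrees with the element [Pc S f] of H. *)
Lemma Hneg_Pcv f v : Hneg S f -> Hpos S v -> f (Pc S (ip S v)) = <<Pc S f, v>>.
Proof.
move=> hf hv; rewrite !PcE (Hneg_comb (fun k => <<v, e k>>)) // ip_suml //.
by apply: eq_bigr => k _; rewrite ipZl // (ipC hip v) mulrC.
Qed.

Lemma Hpos_Pcv v : Hpos S (Pc S (ip S v)).
Proof. by rewrite PcE; exact: Hpos_comb. Qed.

Lemma pos_norm_Pcv v : Hpos S v -> pos_norm S (Pc S (ip S v)) <= pos_norm S v.
Proof.
move=> hv; have [k|_] := @Hpos_dominated 1 v (Pc S (ip S v)) hv.
  by rewrite ip_Pc normr1 mul1r; case: ifP; rewrite ?normr0.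
by rewrite normr1 mul1r.
Qed.

Lemma Hneg_ipPc f : Hneg S f -> Hneg S (ip S (Pc S f)).
Proof.
move=> hf; split.
  by move=> a u v _ _; rewrite ipDr // ipZr.
exists `|Pc S f| => v hv; rewrite (le_trans (cauchy_schwarz hip _ _)) //.
by rewrite ler_wpM2l // norm_le_pos_norm.
Qed.

Lemma neg_norm_ipPc f : Hneg S f -> nn (ip S (Pc S f)) <= nn f.
Proof.
move=> hf; apply: neg_norm_le; first exact: neg_norm_ge0.
move=> v hv; rewrite -Hneg_Pcv // (le_trans (le_neg_norm hf (@Hpos_Pcv v))) //.
by rewrite ler_wpM2l ?neg_norm_ge0 // pos_norm_Pcv.
Qed.

Lemma PsE f v : Hneg S f -> Hpos S v -> Ps S f v = f (v - Pc S (ip S v)).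
Proof.
move=> hf hv; rewrite -[v - _]addrC -scaleN1r Hneg_lin //; last exact: Hpos_Pcv.
by rewrite mulN1r addrC.
Qed.

Lemma HnegPs f : Hneg S f -> Hneg S (Ps S f).
Proof.
move=> hf; apply: eq_Hneg (HnegB hf (Hneg_ipPc hf)) => v hv.
by rewrite /= /Ps Hneg_Pcv.
Qed.

Lemma neg_norm_Ps f : Hneg S f -> nn (Ps S f) <= nn f.
Proof.
move=> hf; apply: neg_norm_le; first exact: neg_norm_ge0.
move=> v hv; rewrite PsE //.
have [k|hp np] := @Hpos_dominated 1 v (v - Pc S (ip S v)) hv.
  by rewrite ipBl // ip_Pc normr1 mul1r; case: ifP; rewrite ?subrr ?normr0 ?subr0.
rewrite (le_trans (le_neg_norm hf hp)) // ler_wpM2l ?neg_norm_ge0 //.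
by rewrite (le_trans np) // normr1 mul1r.
Qed.

Lemma Ps_eb f k : Hneg S f -> Ps S f (e k) = if (k < N)%N then 0 else f (e k).
Proof.
move=> hf; rewrite /Ps (Hneg_Pcv hf (@Hpos_eb k)) ip_Pc.
by case: ifP; rewrite ?subrr ?subr0.
Qed.

Lemma sum_truncE (F : nat -> R) m n :
  \sum_(0 <= k < m) (if (k < n)%N then F k else 0) = \sum_(0 <= k < minn m n) F k.
Proof.
elim: m => [|m ih]; first by rewrite min0n !big_geq.
rewrite big_nat_recr //= ih; case: ltnP => mn.
  by rewrite (minn_idPl mn) big_nat_recr.
by rewrite addr0 (minn_idPr (leqW mn)).
Qed.

Lemma sum_trunc_le (F : nat -> R) m n : (forall k, 0 <= F k) ->
  \sum_(0 <= k < m) (if (k < n)%N then F k else 0) <= \sum_(0 <= k < n) F k.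
Proof.
move=> F0; rewrite sum_truncE [leRHS](@big_cat_nat _ _ _ (minn m n)) ?geq_minr //=.
by rewrite lerDl sumr_ge0.
Qed.

(** With lambda = [ev S k], the product (1 + 1/(2t))(1 + 2t lambda) already contains 1 + lambda, and
    1 + 2t lambda is at most e^{2t lambda}. *)
Lemma wt_exp_le (t : R) k : 0 < t ->
  wt k * expR (- ev S k * t) ^+ 2 <= 1 + (2 * t)^-1.
Proof.
move=> t0; have x0 := expR_ge0 (- ev S k * t).
have -> : expR (- ev S k * t) ^+ 2 = (expR (2 * t * ev S k))^-1.
  by rewrite -expRN -expRM_natl; congr expR; ring.
rewrite ler_pdivrMr ?expR_gt0 // (le_trans (wt_le k)) //.
apply: (@le_trans _ _ ((1 + (2 * t)^-1) * (1 + 2 * t * ev S k))).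
  have -> : (1 + (2 * t)^-1) * (1 + 2 * t * ev S k) =
    1 + ev S k + ((2 * t)^-1 + 2 * t * ev S k) by field; rewrite gt_eqF.
  by rewrite lerDl addr_ge0 ?invr_ge0 ?mulr_ge0 ?hev // ltW.
by rewrite ler_wpM2l ?expR_ge1Dx // addr_ge0 // invr_ge0 mulr_ge0 // ltW.
Qed.

(** Without convergence the [limn] in [semigroup] would be a default value. Test [f] on the vector
    with coefficients e^{-2 lambda_k t} f(e_k): the pairing is the partial sum [Q] itself, and the
    H^alpha norm of the vector is at most sqrt(K Q). Hence Q^2 <= |f|^2 K Q, which bounds [Q]
    uniformly in [n]. *)
Lemma semigroup_cvg (t : R) f : 0 < t -> Hneg S f ->
  cvgn (series (fun k => (expR (- ev S k * t) * f (e k)) *: e k)).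
Proof.
move=> t0 hf; set K := 1 + (2 * t)^-1.
have K0 : 0 < K by rewrite ltr_wpDr ?invr_ge0 ?mulr_ge0 // ltW.
apply: (basis_series_cvg hip hb (B := nn f ^+ 2 * K)) => n.
set Q := \sum_(0 <= k < n) _.
pose c k := expR (- ev S k * t) ^+ 2 * f (e k).
have fQ : f (\sum_(0 <= k < n) c k *: e k) = Q.
  by rewrite Hneg_comb //; apply: eq_bigr => k _; rewrite /c; ring.
have Q0 : 0 <= Q by apply: sumr_ge0 => k _; exact: sqr_ge0.
have hv := @Hpos_comb c 0 n.
have [_ pv] : Hpos S (\sum_(0 <= k < n) c k *: e k) /\
    pos_norm S (\sum_(0 <= k < n) c k *: e k) <= Num.sqrt (K * Q).
  apply: pos_norm_le; first exact: sqrtr_ge0.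
  move=> m; rewrite sqr_sqrtr ?mulr_ge0 ?(ltW K0) //.
  apply: (@le_trans _ _ (\sum_(0 <= k < n) wt k * c k ^+ 2)).
    under eq_bigr do rewrite ip_comb // leq0n /=.
    rewrite (eq_bigr (fun k => if (k < n)%N then wt k * c k ^+ 2 else 0)); last first.
      by move=> k _; case: ifP; rewrite // expr0n mulr0.
    by apply: sum_trunc_le => k; rewrite mulr_ge0 ?wt_ge0 ?sqr_ge0.
  rewrite /Q mulr_sumr; apply: ler_sum => k _.
  have -> : wt k * c k ^+ 2 = (wt k * expR (- ev S k * t) ^+ 2) *
    (expR (- ev S k * t) * f (e k)) ^+ 2 by rewrite /c; ring.
  by rewrite ler_wpM2r ?sqr_ge0 // wt_exp_le.
have QQ : Q ^+ 2 <= nn f ^+ 2 * K * Q.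
  rewrite -mulrA -[K * Q]sqr_sqrtr ?mulr_ge0 ?(ltW K0) // -exprMn.
  rewrite ler_sqr ?nnegrE ?mulr_ge0 ?neg_norm_ge0 ?sqrtr_ge0 //.
  rewrite -fQ; apply: le_trans (ler_norm _) (le_trans (le_neg_norm hf hv) _).
  by rewrite fQ ler_wpM2l ?neg_norm_ge0.
have [->|Qn] := eqVneq Q 0; first by rewrite mulr_ge0 ?sqr_ge0 // ltW.
by rewrite -(@ler_pM2r _ Q) ?lt_neqAle 1?eq_sym ?Qn // -expr2.
Qed.

Lemma ip_semigroup (t : R) f k : 0 < t -> Hneg S f ->
  <<semigroup S t f, e k>> = expR (- ev S k * t) * f (e k).
Proof.
move=> t0 hf.
exact: (ip_basis_series hip hb (c := fun k => expR (- ev S k * t) * f (e k)) _ (semigroup_cvg t0 hf)).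
Qed.

Lemma ip_semigroup_Ps (t : R) f k : 0 < t -> Hneg S f ->
  <<semigroup S t (Ps S f), e k>> =
  if (k < N)%N then 0 else expR (- ev S k * t) * f (e k).
Proof.
move=> t0 hf; rewrite ip_semigroup //; last exact: HnegPs.
by rewrite Ps_eb //; case: ifP; rewrite ?mulr0.
Qed.

Lemma semigroup_PsB (t : R) f g : 0 < t -> Hneg S f -> Hneg S g ->
  semigroup S t (Ps S f) - semigroup S t (Ps S g) = semigroup S t (Ps S (f \- g)).
Proof.
move=> t0 hf hg; apply: (ip_ext hb) => k.
rewrite ipBl // !ip_semigroup_Ps //; last exact: HnegB.
by case: ifP; rewrite ?subrr // mulrBr.
Qed.

Lemma semigroup_PsZ (t : R) f (a : R) : 0 < t -> Hneg S f ->
  semigroup S t (Ps S (fun v => a * f v)) = a *: semigroup S t (Ps S f).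
Proof.
move=> t0 hf; apply: (ip_ext hb) => k.
rewrite ipZl // !ip_semigroup_Ps //; last exact: HnegZl.
by case: ifP; rewrite ?mulr0 // mulrCA.
Qed.

Lemma PcB f g : Pc S f - Pc S g = Pc S (f \- g).
Proof.
rewrite !PcE -sumrB; apply: eq_bigr => k _; by rewrite scalerBl.
Qed.

Lemma PcZ f a : Pc S (fun v => a * f v) = a *: Pc S f.
Proof.
by rewrite !PcE scaler_sumr; apply: eq_bigr => k _; rewrite scalerA.
Qed.

End Dual.

(** * Integrals on the line *)

Section Affine.
Context {R : realType} (a b : R) (a0 : a != 0).
Local Notation mu := (@lebesgue_measure R).

Definition affine (x : R) : R := a * x + b.

Lemma measurable_affine : measurable_fun setT affine.
Proof. by apply: measurable_funD => //; exact: measurable_funM. Qed.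

Let affine_mixin := isMeasurableFun.Build _ _
  (measurableTypeR R) (measurableTypeR R) affine measurable_affine.
Let affine_pack : {mfun measurableTypeR R >-> measurableTypeR R} := HB.pack affine affine_mixin.

Lemma affine_preimage_oc x y : (x < y)%R ->
  affine @^-1` `]x, y] = if 0 < a then `](x - b) / a, (y - b) / a]%classic
                         else `[(y - b) / a, (x - b) / a[%classic.
Proof.
move=> xy; case: ltP => a1; apply/seteqP; split=> z /=; rewrite !in_itv /= /affine.
- by rewrite ltr_pdivrMr // ler_pdivlMr // ltrBlDr lerBrDr mulrC.
- by rewrite ltr_pdivrMr // ler_pdivlMr // ltrBlDr lerBrDr mulrC.
- have {}a1 : a < 0 by rewrite lt_neqAle a0.
  by rewrite ltr_ndivlMr // ler_ndivrMr // ltrBlDr lerBrDr mulrC andbC.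
- have {}a1 : a < 0 by rewrite lt_neqAle a0.
  by rewrite ltr_ndivlMr // ler_ndivrMr // ltrBlDr lerBrDr mulrC andbC.
Qed.

(** The scaled push-forward has the right value on half-open intervals, and this determines Lebesgue
    measure. *)
Lemma lebesgue_affine (A : set R) : measurable A ->
  mu A = (`|a|%:E * mu (affine @^-1` A))%E.
Proof.
move=> mA; have h : 0 <= `|a| by [].
apply: (@lebesgue_measure_unique R (mscale (NngNum h) (pushforward mu affine_pack))) => // _ [[x y]] _ <- /=.
rewrite /mscale /= /pushforward /=.
have [xy|yx] := ltP x y; last first.
  by rewrite set_itv_ge ?bnd_simp -?leNgt // preimage_set0 !measure0 mule0.
rewrite affine_preimage_oc // lebesgue_measure_itv /= lte_fin xy.
case: ltP => a1.
  rewrite lebesgue_measure_itv /= lte_fin ltr_pM2r ?invr_gt0 // ltrD2r xy.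
  rewrite -!EFinD -EFinM; congr EFin; rewrite gtr0_norm //; field; by rewrite a0.
have {}a1 : a < 0 by rewrite lt_neqAle a0.
rewrite lebesgue_measure_itv /= lte_fin ltr_nM2r ?invr_lt0 // ltrD2r xy.
by rewrite -!EFinD -EFinM; congr EFin; rewrite ltr0_norm //; field; rewrite a0.
Qed.

Lemma ge0_integral_affine (D : set R) (f : R -> \bar R) :
  measurable D -> measurable_fun D f -> (forall x, D x -> 0 <= f x)%E ->
  (\int[mu]_(x in D) f x = `|a|%:E * \int[mu]_(x in affine @^-1` D) f (affine x))%E.
Proof.
move=> mD mf f0; have h : 0 <= `|a| by [].
rewrite -(@ge0_integral_pushforward _ _ (measurableTypeR R) (measurableTypeR R) R affine
  measurable_affine mu D f) //; last first.
  by move=> x; rewrite inE; exact: f0.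
rewrite -(@ge0_integral_mscale _ _ _ (pushforward mu affine_pack) D mD (NngNum h) f) //.
by apply: eq_measure_integral => A mA _; move: (lebesgue_affine mA).
Qed.

End Affine.

(** * Translations and reflections of time *)

Section Isometry.
Context {R : realType} (a b : R) (a1 : `|a| = 1).
Local Notation mu := (@lebesgue_measure R).
Local Notation phi := (affine a b).

Let a0 : a != 0. Proof. by rewrite -normr_eq0 a1 oner_neq0. Qed.

Lemma measurable_affine_preimage D : measurable D -> measurable (phi @^-1` D).
Proof. by move=> mD; rewrite -[X in measurable X]setTI; exact: measurable_affine. Qed.

Lemma measurable_fun_affine d (T : measurableType d) D (f : R -> T) :
  measurable D -> measurable_fun D f ->
  measurable_fun (phi @^-1` D) (f \o phi).
Proof.
move=> mD mf; apply: (measurable_comp mD) => //.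
  by move=> _ [x Dx <-].
exact: measurable_funTS (measurable_affine _ _).
Qed.

Lemma ge0_integral_isometry (D : set R) (f : R -> \bar R) :
  measurable D -> measurable_fun D f -> (forall x, D x -> 0 <= f x)%E ->
  (\int[mu]_(x in D) f x = \int[mu]_(x in phi @^-1` D) f (phi x))%E.
Proof. by move=> *; rewrite (@ge0_integral_affine R a b) // a1 mul1e. Qed.

Lemma integral_isometry (D : set R) (f : R -> \bar R) :
  measurable D -> measurable_fun D f ->
  (\int[mu]_(x in D) f x = \int[mu]_(x in phi @^-1` D) f (phi x))%E.
Proof.
move=> mD mf; rewrite integralE [RHS]integralE.
congr (_ - _)%E.
  rewrite ge0_integral_isometry //; last exact: measurable_funepos.
  by apply: eq_integral => x _; rewrite -[RHS]/(((f \o phi)^\+)%E x) [in RHS]funepos_comp.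
rewrite ge0_integral_isometry //; last exact: measurable_funeneg.
by apply: eq_integral => x _; rewrite -[RHS]/(((f \o phi)^\-)%E x) [in RHS]funeneg_comp.
Qed.

Lemma Rintegral_isometry (D : set R) (f : R -> R) :
  measurable D -> measurable_fun D f ->
  \int[mu]_(x in D) f x = \int[mu]_(x in phi @^-1` D) f (phi x).
Proof.
by move=> mD mf; rewrite /Rintegral integral_isometry //; exact/measurable_EFinP.
Qed.

Lemma integrable_isometry (D : set R) (f : R -> \bar R) :
  measurable D -> mu.-integrable D f -> mu.-integrable (phi @^-1` D) (f \o phi).
Proof.
move=> mD /integrableP[mf fi]; apply/integrableP; split.
  exact: measurable_fun_affine.
rewrite -(@ge0_integral_isometry _ (fun x => `|f x|%E)) //.
exact: measurableT_comp.
Qed.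

End Isometry.

(** * The singular kernel s^{-alpha} e^{-cs} and its Gamma integral *)

Section GammaKernel.
Context {R : realType}.
Local Notation mu := (@lebesgue_measure R).

Lemma continuous_powR (a x : R) : 0 < x -> {for x, continuous (fun s : R => s `^ a)}.
Proof.
move=> x0; apply: differentiable_continuous; apply/derivable1_diffP.
by apply: derivable_powR; rewrite in_itv /= x0.
Qed.

Lemma measurable_powR_expR (al c : R) (D : set R) :
  measurable_fun D (fun s => s `^ (- al) * expR (- c * s)).
Proof.
apply: measurable_funM; first exact: measurable_funTS (@measurable_powR R _).
by apply: measurableT_comp => //; exact: measurable_funM.
Qed.

(** The bound does not depend on [x], so the lower end can tend to 0 by monotone convergence in
    [integrable_powR01]. *)
Lemma integral_powR_segment (al x : R) : al < 1 -> 0 < x < 1 ->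
  (\int[mu]_(s in `[x, 1%R]) (s `^ (- al))%:E <= ((1 - al)^-1)%:E)%E.
Proof.
move=> al1 /andP[x0 x1].
have b0 : 0 < 1 - al by rewrite subr_gt0.
pose F (s : R) := (1 - al)^-1 * s `^ (1 - al).
have cF (s : R) : 0 < s -> {for s, continuous F}.
  by move=> s0; apply: cvgM; [exact: cvg_cst|exact: continuous_powR].
rewrite (@continuous_FTC2 R (fun s => s `^ (- al)) F x 1) //.
- rewrite /F powR1 mulr1 -EFinB lee_fin gerBl mulr_ge0 ?powR_ge0 //.
  by rewrite invr_ge0 ltW.
- apply: continuous_in_subspaceT => s; rewrite inE /= in_itv /= => /andP[xs _].
  by apply: continuous_powR; exact: lt_le_trans xs.
- split.
  + move=> s; rewrite in_itv /= => /andP[xs _].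
    apply: derivableM; first exact: derivable_cst.
    by apply: derivable_powR; rewrite in_itv /= (lt_trans x0 xs).
  + by apply: cvg_at_right_filter; exact: cF.
  + by apply: cvg_at_left_filter; exact: cF.
- move=> s; rewrite in_itv /= => /andP[xs _].
  have s0 := lt_trans x0 xs.
  rewrite /F derive1E deriveM //; last first.
    by apply: derivable_powR; rewrite in_itv /= s0.
  rewrite derive_cst scaler0 addr0 -derive1E powR_derive1 ?in_itv /= ?s0 //.
  rewrite /GRing.scale /= mulrA mulVf ?gt_eqF // mul1r; congr (_ `^ _); ring.
Qed.

(** The offset in [n.+2] keeps each left end strictly below 1, as [integral_powR_segment]
    requires. *)
Lemma itv_oc_bigcup : `]0, 1]%classic = \bigcup_n `[(n.+2%:R : R)^-1, 1]%classic.
Proof.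
apply/seteqP; split=> x /=; rewrite in_itv /=.
  move=> /andP[x0 x1]; exists (Num.truncn x^-1) => //=; rewrite in_itv /= x1 andbT.
  rewrite invf_ple ?posrE // (le_trans (ltW (truncnS_gt _))) //.
  by rewrite ler_nat.
by move=> [n _ /=]; rewrite in_itv /= => /andP[nx ->]; rewrite (lt_le_trans _ nx).
Qed.

Lemma integrable_powR01 (al : R) : al < 1 ->
  mu.-integrable `]0, 1] (fun s => (s `^ (- al))%:E).
Proof.
move=> al1; apply/integrableP; split.
  by apply/measurable_EFinP; exact: measurable_funTS (@measurable_powR R _).
under eq_integral do rewrite abse_EFin ger0_norm ?powR_ge0 //.
apply: (@le_lt_trans _ _ ((1 - al)^-1)%:E); last exact: ltry.
rewrite itv_oc_bigcup.
have h := @ge0_nondecreasing_set_cvg_integral _ (measurableTypeR R) R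
  (fun n => `[(n.+2%:R : R)^-1, 1]%classic)
  (fun s : R => (s `^ (- al))%:E) mu.
rewrite -(cvg_lim _ (h _ _ _ _)) //.
- apply: lime_le.
    apply: ereal_nondecreasing_is_cvgn.
    apply: ge0_nondecreasing_set_nondecreasing_integral => //.
    + apply/nondecreasing_seqP => n; rewrite subsetEset; apply: subset_itvr.
      by rewrite bnd_simp lef_pV2 ?posrE // ler_nat.
    + by move=> n; apply/measurable_EFinP; exact: measurable_funTS (@measurable_powR R _).
    + by move=> n x _; rewrite lee_fin powR_ge0.
  apply: nearW => n; apply: integral_powR_segment => //.
  by rewrite invr_gt0 ltr0n /= invf_lt1 // ltr1n.
- apply/nondecreasing_seqP => n; rewrite subsetEset; apply: subset_itvr.
  by rewrite bnd_simp lef_pV2 ?posrE // ler_nat.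
- by move=> n; apply/measurable_EFinP; exact: measurable_funTS (@measurable_powR R _).
- by move=> n x _; rewrite lee_fin powR_ge0.
Qed.

Lemma integrable_expRN : mu.-integrable `[0, +oo[ (fun s : R => (expR (- s))%:E).
Proof.
have := @integrable_exponential_pdf R 1 ltr01.
rewrite (_ : (EFin \o exponential_pdf (1 : R)) =
   ((fun s : R => (expR (- s))%:E) \_ `[0, +oo[)); last first.
  apply/funext => x; rewrite /= /exponential_pdf !patchE.
  by case: ifP => // _; rewrite mul1r mulN1r.
by rewrite -integrable_mkcond.
Qed.

Lemma integrable_gamma (al : R) : 0 < al < 1 ->
  mu.-integrable `]0, +oo[ (fun s : R => (s `^ (- al) * expR (- s))%:E).
Proof.
move=> /andP[al0 al1].
apply: (@le_integrable _ _ _ mu _ _ _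
  (fun s => ((s `^ (- al)) * \1_(`]0, 1]) s + expR (- s) * \1_(`[0, +oo[) s)%:E)) => //.
- apply/measurable_EFinP.
  rewrite (_ : (fun s : R => _) = (fun s => s `^ (- al) * expR (- 1 * s))).
    exact: measurable_powR_expR.
  by apply/funext => s; rewrite mulN1r.
- move=> s /=; rewrite in_itv /= andbT => s0.
  rewrite lee_fin [leRHS]ger0_norm ?addr_ge0 ?mulr_ge0 ?powR_ge0 ?expR_ge0 //.
  rewrite ger0_norm ?mulr_ge0 ?powR_ge0 ?expR_ge0 //.
  have h1 : s \in `[0, +oo[%classic by rewrite inE /= in_itv /= andbT ltW.
  rewrite !indicE h1 mulr1; have [s1|s1] := lerP s 1.
    have -> : s \in `]0, 1]%classic by rewrite inE /= in_itv /= s0.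
    apply: (@le_trans _ _ (s `^ (- al))).
      by rewrite ler_piMr ?powR_ge0 // -expR0 ler_expR oppr_le0 ltW.
    by rewrite mulr1 lerDl expR_ge0.
  apply: (@le_trans _ _ (expR (- s))); last by rewrite lerDr mulr_ge0 ?powR_ge0.
  rewrite ler_piMl ?expR_ge0 // -[leRHS](@powRr0 R s).
  by rewrite ler_powR ?(ltW s1) // oppr_le0 ltW.
- have -> : (fun s : R => (s `^ (- al) * \1_(`]0, 1]) s + expR (- s) * \1_(`[0, +oo[) s)%:E)
    = (fun s : R => (s `^ (- al))%:E) \_ `]0, 1] \+ (fun s : R => (expR (- s))%:E) \_ `[0, +oo[.
    apply/funext => s /=; rewrite !patchE EFinD !indicE.
    by congr (_ + _)%E; case: ifP => _; rewrite ?mulr1 ?mulr0.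
  apply: (@integrableS _ _ _ mu setT) => //.
  apply: integrableD => //; rewrite -integrable_mkcond //.
    exact: integrable_powR01.
  exact: integrable_expRN.
Qed.

(** Scaling time by [c] turns the kernel into the Gamma integrand. The same identity, read
    backwards, gives finiteness: a positive multiple of the integral is finite. *)
Lemma integral_kernel (al c : R) : 0 < al < 1 -> 0 < c ->
  mu.-integrable `]0, +oo[ (fun s : R => (s `^ (- al) * expR (- c * s))%:E) /\
  \int[mu]_(s in `]0%R, +oo[) (s `^ (- al) * expR (- c * s)) =
    Gamma (1 - al) / c `^ (1 - al).
Proof.
move=> hal c0; have ig := integrable_gamma hal.
have c0' : c != 0 by rewrite gt_eqF.
have pc : 0 < c `^ (1 - al) by rewrite powR_gt0.
have mJ : measurable_fun `](0 : R), +oo[ (fun s : R => (s `^ (- al) * expR (- c * s))%:E).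
  by apply/measurable_EFinP; exact: measurable_powR_expR.
have E : (\int[mu]_(s in `]0%R, +oo[) (s `^ (- al) * expR (- s))%:E =
  (c `^ (1 - al))%:E * \int[mu]_(s in `]0%R, +oo[) (s `^ (- al) * expR (- c * s))%:E)%E.
  rewrite (ge0_integral_affine 0 c0') //; last 2 first.
    by case/integrableP : ig.
    by move=> x _; rewrite lee_fin mulr_ge0 ?powR_ge0 ?expR_ge0.
  have -> : affine c 0 @^-1` `]0, +oo[%classic = `]0, +oo[%classic.
    by apply/seteqP; split=> x /=; rewrite !in_itv /= !andbT /affine addr0 pmulr_rgt0.
  rewrite (_ : (\int[mu]_(x in `]0%R, +oo[) _)%E =
    ((c `^ (- al))%:E * \int[mu]_(s in `]0%R, +oo[) (s `^ (- al) * expR (- c * s))%:E)%E).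
    rewrite muleA -EFinM gtr0_norm // -{1}(powRr1 (ltW c0)) -powRD //.
    by rewrite c0' implybT.
  rewrite -ge0_integralZl //; last 2 first.
    by move=> x _; rewrite lee_fin mulr_ge0 ?powR_ge0 ?expR_ge0.
    by rewrite lee_fin powR_ge0.
  apply: eq_integral => x; rewrite inE /= in_itv /= andbT => x0.
  by rewrite /affine addr0 -EFinM powRM ?ltW // mulNr mulrA.
have J0 : (0 <= \int[mu]_(s in `]0%R, +oo[) (s `^ (- al) * expR (- c * s))%:E)%E.
  by apply: integral_ge0 => x _; rewrite lee_fin mulr_ge0 ?powR_ge0 ?expR_ge0.
have Jfin : (\int[mu]_(s in `]0%R, +oo[) (s `^ (- al) * expR (- c * s))%:E < +oo)%E.
  have : (\int[mu]_(s in `]0%R, +oo[) (s `^ (- al) * expR (- s))%:E \is a fin_num)%E.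
    by apply: integrable_fin_num ig; exact: measurable_itv.
  rewrite E.
  case: (\int[mu]_(s in `]0%R, +oo[) (s `^ (- al) * expR (- c * s))%:E)%E J0 => [r _ _|_|//].
    by rewrite ltry.
  by rewrite gt0_muley ?lte_fin.
split.
  apply/integrableP; split=> //.
  by under eq_integral do rewrite abse_EFin ger0_norm ?mulr_ge0 ?powR_ge0 ?expR_ge0 //.
rewrite /Gamma.
have -> : \int[mu]_(t in `]0%R, +oo[) (t `^ (1 - al - 1) * expR (- t)) =
   \int[mu]_(t in `]0%R, +oo[) (t `^ (- al) * expR (- t)).
  by congr fine; apply: eq_integral => x _; congr ((_ `^ _ * _)%:E); ring.
rewrite {2}/Rintegral E fineM //; last by rewrite ge0_fin_numE.
by rewrite /= mulrC mulKf // gt_eqF.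
Qed.

Lemma Gamma_ge0 (x : R) : 0 <= Gamma x.
Proof. by apply: Rintegral_ge0 => s _; rewrite mulr_ge0 ?powR_ge0 ?expR_ge0. Qed.

End GammaKernel.

(** * Weak integrals *)

Section IntegrableEFin.
Context {R : realType} (D : set R) (mD : measurable D).
Local Notation mu := (@lebesgue_measure R).

Lemma integrableZl_EFin (k : R) (b : R -> R) :
  mu.-integrable D (fun s => (b s)%:E) -> mu.-integrable D (fun s => (k * b s)%:E).
Proof. by move=> ib; under eq_fun do rewrite EFinM; exact: integrableZl. Qed.

Lemma integrableZr_EFin (k : R) (b : R -> R) :
  mu.-integrable D (fun s => (b s)%:E) -> mu.-integrable D (fun s => (b s * k)%:E).
Proof. by move=> ib; under eq_fun do rewrite mulrC; exact: integrableZl_EFin. Qed.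

Lemma integrableD_EFin (b c : R -> R) :
  mu.-integrable D (fun s => (b s)%:E) -> mu.-integrable D (fun s => (c s)%:E) ->
  mu.-integrable D (fun s => (b s + c s)%:E).
Proof. by move=> ib ic; under eq_fun do rewrite EFinD; exact: integrableD. Qed.

Lemma norm_Rintegral_le (f b : R -> R) :
  mu.-integrable D (fun s => (f s)%:E) -> mu.-integrable D (fun s => (b s)%:E) ->
  (forall s, D s -> `|f s| <= b s) ->
  `|\int[mu]_(s in D) f s| <= \int[mu]_(s in D) b s.
Proof.
move=> intf intb fb; apply: (@le_trans _ _ (\int[mu]_(s in D) `|f s|)).
  exact: le_normr_Rintegral.
by apply: le_Rintegral => //; exact: integrable_norm.
Qed.

End IntegrableEFin.

Section Bochner.
Context {R : realType} {H : completeNormedModType R} (S : model H).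
Hypotheses (hip : inner_product S) (hb : orthonormal_basis S).
Local Notation "<< u , v >>" := (ip S u v) (format "<< u ,  v >>").
Local Notation e := (eb S).
Local Notation mu := (@lebesgue_measure R).

(** Pairings and norm are limits of Parseval sums, so measurability needs to be checked on the
    eigenbasis only. *)
Lemma measurable_coords (D : set R) (f : R -> H) :
  (forall k, measurable_fun D (fun s => <<f s, e k>>)) ->
  (forall w, measurable_fun D (fun s => <<f s, w>>)) /\
  measurable_fun D (fun s => `|f s|).
Proof.
move=> mf; split=> [w|].
  apply: (@measurable_fun_cvg _ _ R D
    (fun n s => series (fun k => <<f s, e k>> * <<e k, w>>) n)).
    move=> n; rewrite /series /=; apply: measurable_sum => k.
    by apply: measurable_funM; [exact: mf|exact: measurable_cst].
  by move=> s _; exact: parseval.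
have -> : (fun s => `|f s|) = Num.sqrt \o (fun s => `|f s| ^+ 2).
  by apply/funext => s /=; rewrite sqrtr_sqr ger0_norm.
apply: measurableT_comp.
  by apply: continuous_measurable_fun; exact: sqrt_continuous.
apply: (@measurable_fun_cvg _ _ R D (fun n s => series (fun k => <<f s, e k>> ^+ 2) n)).
  move=> n; rewrite /series /=; apply: measurable_sum => k.
  by apply: measurable_funX.
by move=> s _; exact: parseval_sq.
Qed.

Section OnDomain.
Context (D : set R) (mD : measurable D).

Lemma is_bochner_integrable f x w : is_bochner S D f x ->
  mu.-integrable D (fun s => <<f s, w>>%:E).
Proof.
move=> [mf intf _].
apply: (@le_integrable _ _ _ mu _ _ _ (fun s => (`|w| * `|f s|)%:E)) => //.
- by apply/measurable_EFinP; exact: mf.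
- move=> s _; rewrite lee_fin [leRHS]ger0_norm ?mulr_ge0 // mulrC.
  exact: cauchy_schwarz.
- exact: integrableZl_EFin.
Qed.

Lemma is_bochner_unique f x y : is_bochner S D f x -> is_bochner S D f y -> x = y.
Proof.
move=> [_ _ hx] [_ _ hy]; apply: (ip_ext hb) => k.
by rewrite hx hy.
Qed.

Lemma bochnerE f x : is_bochner S D f x -> bochner S D f = x.
Proof.
move=> hx; apply: is_bochner_unique (hx); rewrite /bochner.
by case: xgetP => [y _ //|/(_ x)].
Qed.

Lemma eq_is_bochner f g x : (forall s, D s -> f s = g s) ->
  is_bochner S D f x -> is_bochner S D g x.
Proof.
move=> fg [mf intf hx]; split.
- move=> w; apply: eq_measurable_fun (mf w) => s /set_mem Ds.
  by rewrite fg.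
- by apply: eq_integrable intf => // s /set_mem Ds; rewrite fg.
- by move=> w; rewrite hx; apply: eq_Rintegral => s /set_mem Ds; rewrite fg.
Qed.

Lemma is_bochner_norm f x : is_bochner S D f x -> `|x| <= \int[mu]_(s in D) `|f s|.
Proof.
move=> hf; have [mf intf hx] := hf.
have [->|x0] := eqVneq x 0; first by rewrite normr0; exact: Rintegral_ge0.
have xp : 0 < `|x| by rewrite normr_gt0.
rewrite -(ler_pM2r xp) -expr2 -(ip_sq hip) hx -RintegralZr //.
apply: le_Rintegral => //.
- exact: is_bochner_integrable hf.
- exact: integrableZr_EFin.
- by move=> s _; rewrite (le_trans (ler_norm _)) // cauchy_schwarz.
Qed.

Lemma is_bochner_comb a f g x y : is_bochner S D f x -> is_bochner S D g y ->
  is_bochner S D (fun s => a *: f s + g s) (a *: x + y).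
Proof.
move=> hf hg; have [mf intf hx] := hf; have [mg intg hy] := hg.
have mh w : measurable_fun D (fun s => <<a *: f s + g s, w>>).
  under eq_fun do rewrite (ip_lin hip).
  by apply: measurable_funD => //; apply: measurable_funM.
split=> // [|w].
  apply: (@le_integrable _ _ _ mu _ _ _ (fun s => (`|a| * `|f s| + `|g s|)%:E)) => //.
  - by apply/measurable_EFinP; have [] := @measurable_coords D (fun s => a *: f s + g s).
  - move=> s _; rewrite lee_fin normr_id [leRHS]ger0_norm ?addr_ge0 ?mulr_ge0 //.
    by rewrite (le_trans (ler_normD _ _)) // normrZ.
  - by apply: integrableD_EFin => //; exact: integrableZl_EFin.
rewrite (ip_lin hip) hx hy -RintegralZl //; last exact: is_bochner_integrable hf.
rewrite -RintegralD //; last 2 first.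
  by apply: integrableZl_EFin => //; exact: is_bochner_integrable hf.
  exact: is_bochner_integrable hg.
by apply: eq_Rintegral => s _; rewrite ip_lin.
Qed.

Lemma is_bochnerB f g x y : is_bochner S D f x -> is_bochner S D g y ->
  is_bochner S D (fun s => f s - g s) (x - y).
Proof.
move=> hf hg; have := is_bochner_comb (-1) hg hf.
rewrite scaleN1r addrC; apply: eq_is_bochner => s _.
by rewrite scaleN1r addrC.
Qed.

Lemma is_bochner0 : is_bochner S D (fun=> 0) 0.
Proof.
split.
- by move=> w; under eq_fun do rewrite (ip0l hip); exact: measurable_cst.
- by under eq_fun do rewrite normr0; exact: integrable0.
- move=> w; rewrite ip0l // (@eq_Rintegral _ _ _ _ _ (fun=> 0)) ?Rintegral_cst ?mul0r //.
Qed.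

Lemma is_bochnerZ a f x : is_bochner S D f x ->
  is_bochner S D (fun s => a *: f s) (a *: x).
Proof.
move=> hf; have := is_bochner_comb a hf is_bochner0; rewrite addr0.
by apply: eq_is_bochner => s _; rewrite addr0.
Qed.

(** A Riesz representation in the eigenbasis: [I] is a linear functional bounded by the integral of
    [b], and the vector with coordinates [I (e k)] represents it. Every integral of the
    Lyapunov-Perron equation is shown to exist in this way, with its norm bound. *)
Lemma bochner_exists f (b : R -> R) :
  (forall k, measurable_fun D (fun s => <<f s, e k>>)) ->
  mu.-integrable D (fun s => (b s)%:E) ->
  (forall s, D s -> `|f s| <= b s) ->
  exists2 x, is_bochner S D f x & `|x| <= \int[mu]_(s in D) b s.
Proof.
move=> mf intb fb; have [mw mn] := measurable_coords mf.
have intn : mu.-integrable D (fun s => `|f s|%:E).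
  apply: (@le_integrable _ _ _ mu _ _ _ (fun s => (b s)%:E)) => //.
    exact/measurable_EFinP.
  by move=> s Ds; rewrite lee_fin normr_id (le_trans (fb _ Ds)) // ler_norm.
have intw w : mu.-integrable D (fun s => <<f s, w>>%:E).
  apply: (@le_integrable _ _ _ mu _ _ _ (fun s => (`|w| * `|f s|)%:E)) => //.
  - by apply/measurable_EFinP; exact: mw.
  - move=> s _; rewrite lee_fin [leRHS]ger0_norm ?mulr_ge0 // mulrC.
    exact: cauchy_schwarz.
  - exact: integrableZl_EFin.
pose I w := \int[mu]_(s in D) <<f s, w>>.
have I0 : I 0 = 0.
  by rewrite /I (@eq_Rintegral _ _ _ _ _ (fun=> 0)) ?Rintegral_cst ?mul0r // => s _; rewrite ip0r.
have Ilin a w w' : I (a *: w + w') = a * I w + I w'.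
  rewrite /I -RintegralZl //; last exact: intw.
  rewrite -RintegralD //; last 2 first.
    by apply: integrableZl_EFin => //; exact: intw.
    exact: intw.
  by apply: eq_Rintegral => s _; rewrite ipDr // ipZr.
set B := \int[mu]_(s in D) b s.
have B0 : 0 <= B.
  by apply: Rintegral_ge0 => s Ds; rewrite (le_trans _ (fb _ Ds)).
have Ib w : `|I w| <= `|w| * B.
  rewrite /I /B -RintegralZl //; apply: norm_Rintegral_le => //.
    exact: integrableZl_EFin.
  move=> s Ds; rewrite (le_trans (cauchy_schwarz hip _ _)) // mulrC.
  by rewrite ler_wpM2l // fb.
pose c k := I (e k).
have Icomb (d : nat -> R) n : I (\sum_(0 <= k < n) d k *: e k) = \sum_(0 <= k < n) d k * c k.
  elim: n => [|n ih]; first by rewrite !big_geq.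
  by rewrite !big_nat_recr //= addrC Ilin ih addrC.
(* Testing [I] on the combination with coefficients [c] itself gives Q <= sqrt(Q) B. *)
have cB n : \sum_(0 <= k < n) c k ^+ 2 <= B ^+ 2.
  set Q := \sum_(0 <= k < n) _.
  have Q0 : 0 <= Q by apply: sumr_ge0 => k _; exact: sqr_ge0.
  have : Q <= Num.sqrt Q * B.
    have -> : Num.sqrt Q = `|\sum_(0 <= k < n) c k *: e k|.
      by rewrite /Q -(normsq_comb hip hb) sqrtr_sqr normr_id.
    apply: le_trans (Ib _); rewrite Icomb; apply: le_trans (ler_norm _).
    by rewrite /Q; under eq_bigr do rewrite expr2.
  have [->|Qn] := eqVneq Q 0; first by rewrite sqr_ge0.
  have sp : 0 < Num.sqrt Q by rewrite sqrtr_gt0 lt_neqAle eq_sym Qn.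
  rewrite -{1}[Q]sqr_sqrtr // expr2 ler_pM2l // => h.
  by rewrite -[Q]sqr_sqrtr // ler_sqr ?nnegrE // ltW.
have cvx := basis_series_cvg hip hb cB.
pose x := limn (series (fun k => c k *: e k)).
have xk k : <<x, e k>> = c k by exact: ip_basis_series.
have xB : `|x| <= B.
  rewrite -ler_sqr ?nnegrE //; apply: (normsq_coords_le hip hb) => n.
  by under eq_bigr do rewrite xk.
exists x => //; split=> // w.
(* Both sides agree on finite combinations and are bounded by multiples of |w|, so density extends
   the identity to all [w]. *)
apply/eqP; rewrite -subr_eq0 -normr_le0; apply/ler_addgt0Pl => d d0.
rewrite addr0; pose wn n := series (fun k => <<w, e k>> *: e k) n.
have xwn n : <<x, wn n>> = I (wn n).
  rewrite /wn /series /= Icomb ip_sumr //; apply: eq_bigr => k _.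
  by rewrite ipZr // xk.
have d1 : 0 < d / (2 * B + 1) by rewrite divr_gt0 // ltr_wpDl ?mulr_ge0.
have /cvgrPdist_le/(_ _ d1)[n _ /(_ n (leqnn n)) hn] := @basis_cvg _ _ _ hb w.
have -> : <<x, w>> - I w = <<x, w - wn n>> - I (w - wn n).
  have -> : I (w - wn n) = I w - I (wn n).
    by rewrite [in LHS]addrC -scaleN1r Ilin mulN1r addrC.
  by rewrite ipBr // xwn; ring.
rewrite (le_trans (ler_normB _ _)) //.
rewrite (le_trans (lerD (cauchy_schwarz hip _ _) (Ib _))) //.
rewrite mulrC -mulrDr.
apply: (@le_trans _ _ (d / (2 * B + 1) * (2 * B + 1))); last by rewrite divfK // gt_eqF // ltr_wpDl ?mulr_ge0.
by rewrite ler_pM ?addr_ge0 //; lra.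
Qed.

End OnDomain.

(** This orientation, from the pulled-back integrand to the original one, recognises an integral
    over the past from one over elapsed time. *)
Lemma is_bochner_isometry (a b : R) (D : set R) f x : `|a| = 1 -> measurable D ->
  is_bochner S (affine a b @^-1` D) (f \o affine a b) x -> is_bochner S D f x.
Proof.
move=> a1 mD hx.
have a0 : a != 0 by rewrite -normr_eq0 a1 oner_neq0.
have a1' : `|a^-1| = 1 by rewrite normfV a1 invr1.
have mD' := measurable_affine_preimage a b mD.
have D'' : affine a^-1 (- (a^-1 * b)) @^-1` (affine a b @^-1` D) = D.
  apply/seteqP; split=> s /=; rewrite /affine; rewrite (_ : a * _ + b = s) //;
  by field.
have E s : affine a b (affine a^-1 (- (a^-1 * b)) s) = s by rewrite /affine; field.
have [mf intf hxw] := hx; split.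
- move=> w; have := @measurable_fun_affine _ a^-1 (- (a^-1 * b)) _ _ _ _ mD' (mf w).
  by rewrite D''; apply: eq_measurable_fun => s _ /=; rewrite E.
- have := integrable_isometry (- (a^-1 * b)) a1' mD' intf.
  by rewrite D''; apply: eq_integrable => // s _ /=; rewrite E.
- move=> w; rewrite hxw; have -> := Rintegral_isometry (- (a^-1 * b)) a1' mD' (mf w).
  by rewrite D''; apply: eq_Rintegral => s _ /=; rewrite E.
Qed.

End Bochner.

(** * Duhamel terms *)

Lemma integral_expN_le {R : realType} (b t : R) : 0 < b -> t <= 0 ->
  (@lebesgue_measure R).-integrable `[t, 0] (fun s => (expR (- b * s))%:E) /\
  \int[@lebesgue_measure R]_(s in `[t, 0]) expR (- b * s) <= expR (- b * t) / b.
Proof.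
move=> b0 t0.
have cE : continuous (fun s : R => expR (- b * s)).
  move=> s; apply: continuous_comp; last exact: continuous_expR.
  by apply: cvgM; [exact: cvg_cst|exact: cvg_id].
split.
  apply: continuous_compact_integrable; first exact: segment_compact.
  exact: continuous_subspaceT.
move: t0; rewrite le_eqVlt => /predU1P[->|t0].
  by rewrite set_itv1 Rintegral_set1 divr_ge0 ?expR_ge0 // ltW.
pose F (s : R) := - b^-1 * expR (- b * s).
have dF (s : R) : is_derive s 1 F (expR (- b * s)).
  apply: is_derive_eq; rewrite /GRing.scale /=; field.
  by rewrite gt_eqF.
rewrite /Rintegral (@continuous_FTC2 R _ F) //=.
- rewrite /F mulr0 expR0 mulr1 mulNr opprK.
  by rewrite addrC mulrC gerDl oppr_le0 invr_ge0 ltW.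
- exact: continuous_subspaceT.
- split.
  + by move=> s _; have [] := dF s.
  + apply: cvg_at_right_filter; apply: differentiable_continuous.
    by apply/derivable1_diffP; have [] := dF t.
  + apply: cvg_at_left_filter; apply: differentiable_continuous.
    by apply/derivable1_diffP; have [] := dF 0.
- by move=> s _; rewrite derive1E; have [_ ->] := dF s.
Qed.

Section Fields.
Context {R : realType} {H : completeNormedModType R} (S : model H).
Hypotheses (hip : inner_product S) (hb : orthonormal_basis S).
Hypotheses (hev : forall k, 0 <= ev S k) (hal : 0 < alpha S < 1).
Local Notation "<< u , v >>" := (ip S u v) (format "<< u ,  v >>").
Local Notation e := (eb S).
Local Notation N := (dimc S).
Local Notation nn := (neg_norm S).
Local Notation mu := (@lebesgue_measure R).
Context (lambda M Ca : R).
Hypotheses (M0 : 0 <= M) (Ca0 : 0 <= Ca).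
Hypothesis hM : forall (t : R) (f : H -> R), 0 < t -> Hneg S f ->
     `|semigroup S t (Ps S f)| <=
       M * expR (- lambda * t) * t `^ (- alpha S) * nn (Ps S f).
Hypothesis hCa : forall f : H -> R, Hneg S f ->
     `|Pc S f| <= Ca * nn (ip S (Pc S f)).

Lemma norm_Pc_le f : Hneg S f -> `|Pc S f| <= Ca * nn f.
Proof.
move=> hf; apply: le_trans (hCa hf) _; rewrite ler_wpM2l //.
exact: neg_norm_ipPc.
Qed.

Lemma norm_semigroup_le (t : R) f : 0 < t -> Hneg S f ->
  `|semigroup S t (Ps S f)| <= M * (t `^ (- alpha S) * expR (- lambda * t)) * nn f.
Proof.
move=> t0 hf; apply: le_trans (hM t0 hf) _.
rewrite -[_ * _ * t `^ _]mulrA [expR _ * _]mulrC ler_wpM2l //; last exact: neg_norm_Ps.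
by rewrite !mulr_ge0 ?powR_ge0 ?expR_ge0.
Qed.

(** A continuous path in H^{-alpha}. The dual is only a predicate on functions, hence continuity is
    expressed by the dual norm of increments. *)
Definition cvg_field (f : R -> H -> R) := (forall t, Hneg S (f t)) /\
  (forall t, nn (f t' \- f t) @[t' --> t] --> (0 : R)).

Lemma nn_triangle f g : Hneg S f -> Hneg S g -> nn f <= nn (f \- g) + nn g.
Proof.
move=> hf hg; have hfg := HnegB hip hb hev hal hf hg.
have := neg_norm_comb2 hip hb hev hal 1 hfg hg.
rewrite normr1 mul1r; congr (_ <= _); apply: eq_neg_norm => v _ /=.
by rewrite mul1r subrK.
Qed.

Lemma nnC f g : Hneg S f -> Hneg S g -> nn (f \- g) = nn (g \- f).
Proof.
suff h f' g' : Hneg S f' -> Hneg S g' -> nn (f' \- g') <= nn (g' \- f').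
  by move=> hf hg; apply/eqP; rewrite eq_le !h.
move=> hf hg; have := neg_normZl hip hb hev hal (-1) (HnegB hip hb hev hal hg hf).
rewrite normrN1 mul1r; congr (_ <= _); apply: eq_neg_norm => v _ /=.
by rewrite mulN1r opprB.
Qed.

Lemma nn_dist f g : Hneg S f -> Hneg S g -> `|nn f - nn g| <= nn (f \- g).
Proof.
move=> hf hg; apply/ler_normlP; split.
  by rewrite opprB lerBlDr nnC // nn_triangle.
by rewrite lerBlDr nn_triangle.
Qed.

Lemma cvg_fieldB f g : cvg_field f -> cvg_field g -> cvg_field (fun t => f t \- g t).
Proof.
move=> [hf cf] [hg cg]; split=> [t|t]; first exact: HnegB.
have h0 : nn (f t' \- f t) + nn (g t' \- g t) @[t' --> t] --> (0 : R).
  by rewrite -[0]addr0; apply: cvgD.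
apply: (squeeze_cvgr _ (cvg_cst (0 : R)) h0); near=> t'.
rewrite neg_norm_ge0 //=.
have -> : nn ((f t' \- g t') \- (f t \- g t)) = nn ((f t' \- f t) \- (g t' \- g t)).
  by apply: eq_neg_norm => v _ /=; ring.
have h1 := HnegB hip hb hev hal (hf t') (hf t).
have h2 := HnegB hip hb hev hal (hg t') (hg t).
have := neg_norm_comb2 hip hb hev hal (-1) h2 h1.
rewrite normrN1 mul1r addrC; congr (_ <= _); apply: eq_neg_norm => v _ /=.
by rewrite mulN1r addrC.
Unshelve. all: by end_near. Qed.

Lemma cvg_field_nn f : cvg_field f -> continuous (fun t => nn (f t)).
Proof.
move=> [hf cf] t; apply/cvgrPdist_le => d d0.
have := cf t => /cvgrPdist_le/(_ _ d0); apply: filterS => t'.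
rewrite sub0r normrN ger0_norm ?neg_norm_ge0 // => h.
by rewrite distrC (le_trans (nn_dist _ _)).
Qed.

Lemma cvg_field_eval f v : cvg_field f -> Hpos S v -> continuous (fun t => f t v).
Proof.
move=> [hf cf] hv t; apply/cvgrPdist_le => d d0.
have d1 : 0 < d / (pos_norm S v + 1) by rewrite divr_gt0 // ltr_wpDl // pos_norm_ge0.
have := cf t => /cvgrPdist_le/(_ _ d1); apply: filterS => t'.
rewrite sub0r normrN ger0_norm ?neg_norm_ge0 // => h.
rewrite distrC; have := le_neg_norm hip hb hev hal (HnegB hip hb hev hal (hf t') (hf t)) hv.
move=> /= /le_trans; apply.
apply: (@le_trans _ _ (d / (pos_norm S v + 1) * (pos_norm S v + 1))).
  by rewrite ler_pM ?neg_norm_ge0 ?pos_norm_ge0 // lerDl.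
by rewrite divfK // gt_eqF // ltr_wpDl // pos_norm_ge0.
Qed.

Lemma cvg_field_reflect f t : cvg_field f -> cvg_field (fun s => f (t - s)).
Proof.
move=> [hf cf]; split=> // s.
apply: (@cvg_comp _ _ _ (fun s' => t - s') (fun t' => nn (f t' \- f (t - s))) _ _ _ _ (cf (t - s))).
by apply: (@cvgB _ R^o); [exact: cvg_cst|exact: cvg_id].
Qed.

Local Notation K b s := (s `^ (- alpha S) * expR (- b * s)).

Lemma measurable_stable f (t : R) k : cvg_field f ->
  measurable_fun `](0 : R), +oo[ (fun s => <<semigroup S s (Ps S (f (t - s))), e k>>).
Proof.
move=> hf; apply: (@eq_measurable_fun _ _ _ _ _ (fun s =>
   if (k < N)%N then 0 else expR (- ev S k * s) * f (t - s) (e k))).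
  move=> s; rewrite inE /= in_itv /= andbT => s0.
  by rewrite ip_semigroup_Ps //; case: hf.
case: (k < N)%N; first exact: measurable_cst.
apply: measurable_funM.
  by apply: measurableT_comp => //; apply: measurable_funM.
apply: measurable_funTS; apply: continuous_measurable_fun.
apply: (cvg_field_eval (cvg_field_reflect t hf)); exact: Hpos_eb.
Qed.

Lemma measurable_center f k (D : set R) : cvg_field f ->
  measurable_fun D (fun s => <<Pc S (f s), e k>>).
Proof.
move=> hf; apply: (@eq_measurable_fun _ _ _ _ _ (fun s =>
   if (k < N)%N then f s (e k) else 0)).
  by move=> s _; rewrite ip_Pc.
case: (k < N)%N; last exact: measurable_cst.
apply: measurable_funTS; apply: continuous_measurable_fun.
by apply: cvg_field_eval => //; exact: Hpos_eb.
Qed.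

(** Written in the elapsed time s = t - tau, so that the domain and the singularity of the kernel do
    not move with [t]. *)
Definition stable_int (f : R -> H -> R) (t : R) : H :=
  bochner S `]0, +oo[ (fun s => semigroup S s (Ps S (f (t - s)))).

Definition center_int (f : R -> H -> R) (t : R) : H :=
  bochner S `[t, 0] (fun s => Pc S (f s)).

(** The mass of M s^{-alpha} e^{-(lambda - b) s}, that is, the gain of the stable integral on a
    forcing of size e^{-bt}. With the centre part added, [lp_const] at b = eta + nu is the bracket
    of the smallness condition. *)
Definition stable_const (b : R) := M * (Gamma (1 - alpha S) / (lambda - b) `^ (1 - alpha S)).
Definition lp_const (b : R) := Ca / b + stable_const b.

(** Two exponentials are allowed because the a priori majorant has a linear and a cubic term of
    different growth; a single one is the case [c2 = 0]. *)
Lemma stable_exists f t c1 b1 c2 b2 : cvg_field f -> b1 < lambda -> b2 < lambda ->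
  (forall s, s < t -> nn (f s) <= c1 * expR (- b1 * s) + c2 * expR (- b2 * s)) ->
  is_bochner S `]0, +oo[ (fun s => semigroup S s (Ps S (f (t - s)))) (stable_int f t) /\
  `|stable_int f t| <= c1 * (expR (- b1 * t) * stable_const b1) + c2 * (expR (- b2 * t) * stable_const b2).
Proof.
move=> cf b1l b2l hf.
have [i1 e1] := @integral_kernel R (alpha S) (lambda - b1) hal (etrans (subr_gt0 _ _) b1l).
have [i2 e2] := @integral_kernel R (alpha S) (lambda - b2) hal (etrans (subr_gt0 _ _) b2l).
pose b s := M * (c1 * expR (- b1 * t)) * K (lambda - b1) s +
  M * (c2 * expR (- b2 * t)) * K (lambda - b2) s.
have [|||x hx xb] := @bochner_exists _ _ _ hip hb `](0 : R), +oo[ (measurable_itv _)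
   (fun s => semigroup S s (Ps S (f (t - s)))) b.
- by move=> k; exact: measurable_stable.
- by apply: integrableD_EFin => //; apply: integrableZl_EFin.
- move=> s /=; rewrite in_itv /= andbT => s0; have [hft _] := cf.
  apply: le_trans (norm_semigroup_le s0 (hft _)) _.
  apply: le_trans (ler_wpM2l _ (hf _ _)) _.
  + by rewrite !mulr_ge0 ?powR_ge0 ?expR_ge0.
  + by rewrite ltrBlDr ltrDl.
  + rewrite /b le_eqVlt; apply/orP; left; apply/eqP.
    have E (d : R) : expR (- (lambda - d) * s) * expR (- d * t) =
        expR (- lambda * s) * expR (- d * (t - s)).
      by rewrite -!expRD; congr expR; ring.
    move: (E b1) (E b2); move: (s `^ _) (expR (- lambda * s)) => x y.
    move: (expR (- (lambda - b1) * s)) (expR (- b1 * t)) (expR (- b1 * (t - s))) => x1 y1 z1.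
    move: (expR (- (lambda - b2) * s)) (expR (- b2 * t)) (expR (- b2 * (t - s))) => x2 y2 z2.
    move=> E1 E2; transitivity (M * c1 * x * (y * z1) + M * c2 * x * (y * z2)); first by ring.
    by rewrite -E1 -E2; ring.
rewrite /stable_int (bochnerE hb hx); split=> //; apply: le_trans xb _.
rewrite RintegralD //; last 2 first.
  by apply: integrableZl_EFin.
  by apply: integrableZl_EFin.
rewrite RintegralZl // RintegralZl // e1 e2 /stable_const le_eqVlt; apply/orP; left; apply/eqP.
ring.
Qed.

Lemma center_exists f t c1 b1 c2 b2 : cvg_field f -> t <= 0 ->
  0 < b1 -> 0 < b2 -> 0 <= c1 -> 0 <= c2 ->
  (forall s, t <= s <= 0 -> nn (f s) <= c1 * expR (- b1 * s) + c2 * expR (- b2 * s)) ->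
  is_bochner S `[t, 0] (fun s => Pc S (f s)) (center_int f t) /\
  `|center_int f t| <= c1 * (expR (- b1 * t) * (Ca / b1)) + c2 * (expR (- b2 * t) * (Ca / b2)).
Proof.
move=> cf t0 b1p b2p c1p c2p hf.
have [i1 e1] := integral_expN_le b1p t0.
have [i2 e2] := integral_expN_le b2p t0.
pose b s := Ca * c1 * expR (- b1 * s) + Ca * c2 * expR (- b2 * s).
have [|||x hx xb] := @bochner_exists _ _ _ hip hb `[t, 0] (measurable_itv _)
   (fun s => Pc S (f s)) b.
- by move=> k; exact: measurable_center.
- by apply: integrableD_EFin => //; apply: integrableZl_EFin.
- move=> s /=; rewrite in_itv /= => ts; have [hft _] := cf.
  apply: le_trans (norm_Pc_le (hft _)) _.
  apply: le_trans (ler_wpM2l Ca0 (hf _ ts)) _.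
  by rewrite /b mulrDr !mulrA.
rewrite /center_int (bochnerE hb hx); split=> //; apply: le_trans xb _.
rewrite RintegralD //; last 2 first.
  by apply: integrableZl_EFin.
  by apply: integrableZl_EFin.
rewrite RintegralZl // RintegralZl //.
apply: le_trans (lerD (ler_wpM2l _ e1) (ler_wpM2l _ e2)) _; rewrite ?mulr_ge0 //.
by rewrite le_eqVlt; apply/orP; left; apply/eqP; ring.
Qed.

End Fields.

(** Freezing a path at positive times turns continuity on the half-line into continuity on R. *)
Lemma continuous_min0 {R : realType} : continuous (fun t : R => Num.min t 0).
Proof. by move=> t; apply: continuous_min; [exact: cvg_id|exact: cvg_cst]. Qed.

Lemma continuous_integral_to0 {R : realType} (phi : R -> R) : continuous phi ->
  continuous (fun t : R => \int[@lebesgue_measure R]_(s in `[Num.min t 0, 0]) phi s).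
Proof.
(* The base point [a] lies strictly below [m], which makes [m] interior to the segment from [a] to
   1. *)
move=> cphi t; set m := Num.min t 0; set a := m - 1.
have m0 : m <= 0 by rewrite ge_min lexx orbT.
have iphi (x y : R) : (@lebesgue_measure R).-integrable `[x, y] (fun s => (phi s)%:E).
  apply: continuous_compact_integrable; first exact: segment_compact.
  exact: continuous_subspaceT.
pose G x := \int[@lebesgue_measure R]_(s in `[a, 0]) phi s - \int[@lebesgue_measure R]_(s in `[a, x]) phi s.
have GE x : a < x -> x <= 0 -> \int[@lebesgue_measure R]_(s in `[x, 0]) phi s = G x.
  move=> ax x0; rewrite /G Rintegral_itvB ?bnd_simp //; last exact: ltW.
  rewrite Rintegral_itv_obnd_cbnd //.
  by apply: integrableS (iphi x 0) => //; exact: subset_itv_oc_cc.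
have cG : {for m, continuous G}.
  apply: (@cvgB _ R^o); first exact: cvg_cst.
  have a1 : a <= 1 by rewrite /a; lra.
  have /continuous_within_itvP := @parameterized_integral_continuous R a 1 phi a1 (iphi a 1).
  case; first by rewrite /a; lra.
  by move=> h _ _; apply: h; rewrite in_itv /= /a; apply/andP; split; lra.
have cGm : {for t, continuous (G \o (fun t => Num.min t 0))}.
  by apply: continuous_comp; [exact: continuous_min0|exact: cG].
rewrite /continuous_at -/m (GE m) //; last by rewrite /a; lra.
apply: cvg_trans cGm; apply: near_eq_cvg.
have : \forall t' \near t, a < Num.min t' 0.
  have := @continuous_min0 R t; move/cvgr_gt; apply; rewrite /a -/m; lra.
by apply: filterS => t' h; rewrite /= GE // ge_min lexx orbT.
Qed.

(** * The right-hand side of the integral equation and its continuity in time *)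

Section Phi.
Context {R : realType} {H : completeNormedModType R} (S : model H).
Hypotheses (hip : inner_product S) (hb : orthonormal_basis S).
Hypotheses (hev : forall k, 0 <= ev S k) (hal : 0 < alpha S < 1).
Local Notation "<< u , v >>" := (ip S u v) (format "<< u ,  v >>").
Local Notation e := (eb S).
Local Notation N := (dimc S).
Local Notation nn := (neg_norm S).
Local Notation mu := (@lebesgue_measure R).
Context (lambda M Ca : R).
Hypotheses (M0 : 0 <= M) (Ca0 : 0 <= Ca).
Hypothesis hM : forall (t : R) (f : H -> R), 0 < t -> Hneg S f ->
     `|semigroup S t (Ps S f)| <=
       M * expR (- lambda * t) * t `^ (- alpha S) * nn (Ps S f).
Hypothesis hCa : forall f : H -> R, Hneg S f ->
     `|Pc S f| <= Ca * nn (ip S (Pc S f)).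
Local Notation J := (lp_const S lambda M Ca).
Local Notation kern := (stable_const S lambda M).

(** The growth is measured in |t| because the forcing is defined on all of R and continuity at a
    time is tested from both sides. *)
Definition field f c b := [/\ cvg_field S f, 0 < b < lambda, 0 <= c &
  forall t, nn (f t) <= c * expR (b * `|t|)].

(** The minus sign comes from the orientation: for t <= 0 the centre integral from 0 to t is minus
    the one over [[t, 0]]. *)
Definition Phi xi f t := xi - center_int S f t + stable_int S f t.

Lemma field_stable f c b t : field f c b ->
  is_bochner S `]0, +oo[ (fun s => semigroup S s (Ps S (f (t - s)))) (stable_int S f t).
Proof.
move=> [cf /andP[b0 bl] c0 fb].
have [] // := @stable_exists _ _ S hip hb hev hal lambda M M0 hM f t
  (c * expR (2 * b * `|t|)) b 0 b cf bl bl.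
move=> s st; apply: le_trans (fb s) _; rewrite mul0r addr0 -[leRHS]mulrA -expRD.
rewrite ler_wpM2l // ler_expR.
have [t0|t0] := lerP 0 t; have [s0|s0] := lerP 0 s;
  rewrite ?(ger0_norm t0) ?(ger0_norm s0) ?(ltr0_norm s0) ?(ltr0_norm t0); nra.
Qed.

Lemma field_center f c b t : field f c b -> t <= 0 ->
  is_bochner S `[t, 0] (fun s => Pc S (f s)) (center_int S f t).
Proof.
move=> [cf /andP[b0 bl] c0 fb] t0.
have [] // := @center_exists _ _ S hip hb hev hal Ca Ca0 hCa f t c b 0 b cf t0 b0 b0 c0 (lexx 0).
move=> s /andP[ts s0]; apply: le_trans (fb s) _; rewrite mul0r addr0.
by rewrite ler0_norm // mulrN mulNr.
Qed.

Lemma Phi_diff xi f g cf bf cg bg t c1 b1 c2 b2 :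
  field f cf bf -> field g cg bg ->
  0 < b1 < lambda -> 0 < b2 < lambda -> 0 <= c1 -> 0 <= c2 -> t <= 0 ->
  (forall s, s <= 0 -> nn (f s \- g s) <= c1 * expR (- b1 * s) + c2 * expR (- b2 * s)) ->
  `|Phi xi f t - Phi xi g t| <= c1 * (expR (- b1 * t) * J b1) + c2 * (expR (- b2 * t) * J b2).
Proof.
move=> hf hg /andP[b1p b1l] /andP[b2p b2l] c1p c2p t0 hfg.
have [cvf _ _ _] := hf; have [cvg _ _ _] := hg.
have cfg := cvg_fieldB hip hb hev hal cvf cvg.
have [sfg sb] := @stable_exists _ _ S hip hb hev hal lambda M M0 hM _ t
   c1 b1 c2 b2 cfg b1l b2l (fun s st => hfg s (le_trans (ltW st) t0)).
have [cfg' cb] := @center_exists _ _ S hip hb hev hal Ca Ca0 hCa _ t c1 b1 c2 b2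
  cfg t0 b1p b2p c1p c2p (fun s h => hfg s (proj2 (andP h))).
have sE : stable_int S f t - stable_int S g t = stable_int S (fun s => f s \- g s) t.
  apply: (is_bochner_unique hb) sfg; last first.
  have := is_bochnerB hip hb (measurable_itv _) (field_stable t hf) (field_stable t hg).
  apply: eq_is_bochner; first exact: measurable_itv.
  move=> s /=; rewrite in_itv /= andbT => s0.
  by rewrite semigroup_PsB //; [case: cvf|case: cvg].
have cE : center_int S f t - center_int S g t = center_int S (fun s => f s \- g s) t.
  apply: (is_bochner_unique hb) cfg'; last first.
  have := is_bochnerB hip hb (measurable_itv _) (field_center hf t0) (field_center hg t0).
  apply: eq_is_bochner; first exact: measurable_itv.
  by move=> s _; rewrite PcB.
have -> : Phi xi f t - Phi xi g t =
  stable_int S (fun s => f s \- g s) t - center_int S (fun s => f s \- g s) t.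
  rewrite -sE -cE /Phi; set A := center_int _ _ _; set A' := center_int _ _ _.
  rewrite opprD opprB addrACA [LHS]addrC; congr (_ + _).
  by rewrite opprB addrC addrA subrK.
apply: le_trans (ler_normB _ _) _; apply: le_trans (lerD sb cb) _.
by rewrite /lp_const le_eqVlt; apply/orP; left; apply/eqP; ring.
Qed.

(** The increment from [t] to [x] is bounded by the integral of [F x], which vanishes at [x = t].
    That integral is continuous by dominated convergence; the factor e^{b(|t| + 1)} in [g] dominates
    uniformly for |x - t| < 1. *)
Lemma continuous_stable f c b : field f c b -> continuous (stable_int S f).
Proof.
move=> hf t; have [cf /andP[b0 bl] c0 fb] := hf; have [hfn hfc] := cf.
pose K (s : R) := s `^ (- alpha S) * expR (- lambda * s).
pose F (x s : R) := M * K s * nn (f (x - s) \- f (t - s)).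
have [iK _] := @integral_kernel R (alpha S) (lambda - b) hal (etrans (subr_gt0 _ _) bl).
pose g s := M * (2 * c * expR (b * (`|t| + 1))) * (s `^ (- alpha S) * expR (- (lambda - b) * s)).
have ig : mu.-integrable `]0, +oo[ (fun s => (g s)%:E) by exact: integrableZl_EFin.
have K0 s : 0 <= M * K s by rewrite !mulr_ge0 ?powR_ge0 ?expR_ge0.
have F0 x s : 0 <= F x s by rewrite mulr_ge0 // neg_norm_ge0.
have fB x s : nn (f (x - s) \- f (t - s)) <= nn (f (x - s)) + nn (f (t - s)).
  have := neg_norm_comb2 hip hb hev hal (-1) (hfn (t - s)) (hfn (x - s)).
  rewrite normrN1 mul1r [leRHS]addrC; congr (_ <= _); apply: eq_neg_norm => v _ /=.
  by rewrite mulN1r addrC.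
have Fg x s : `]t - 1, t + 1[%classic x -> `]0, +oo[%classic s -> F x s <= g s.
  rewrite /= !in_itv /= andbT => /andP[tx xt] s0.
  have h y : `|y| <= `|t| + 1 -> nn (f (y - s)) <= c * (expR (b * (`|t| + 1)) * expR (b * s)).
    move=> yt; apply: le_trans (fb _) _; rewrite -expRD ler_wpM2l // ler_expR -mulrDr ler_pM2l //.
    by rewrite (le_trans (ler_normB _ _)) // lerD // ger0_norm // ltW.
  have E : expR (- (lambda - b) * s) = expR (- lambda * s) * expR (b * s).
    by rewrite -expRD; congr expR; ring.
  have -> : g s = M * K s * (c * (expR (b * (`|t| + 1)) * expR (b * s)) +
      c * (expR (b * (`|t| + 1)) * expR (b * s))) by rewrite /g /K E; ring.
  rewrite /F ler_wpM2l //; apply: le_trans (fB _ _) _; rewrite lerD ?h //; last by rewrite lerDl.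
  rewrite -lerBlDl; apply: le_trans (lerB_dist _ _) _.
  by rewrite ltW // ltr_norml; apply/andP; split; lra.
have mF x : measurable_fun `](0:R), +oo[%classic (F x).
  apply: measurable_funM.
    by apply: measurable_funM => //; exact: measurable_powR_expR.
  apply: measurable_funTS; apply: continuous_measurable_fun.
  apply: (cvg_field_nn hip hb hev hal).
  by apply: cvg_fieldB => //; exact: cvg_field_reflect.
have iF x : `]t - 1, t + 1[%classic x -> mu.-integrable `]0, +oo[ (fun s => (F x s)%:E).
  move=> tx; apply: le_integrable ig => //; first by apply/measurable_EFinP; exact: mF.
  move=> s s0; rewrite lee_fin ger0_norm //.
  by rewrite (le_trans (Fg _ _ tx s0)) // ler_norm.
have tI : `]t - 1, t + 1[%classic t by rewrite /= in_itv /=; apply/andP; split; lra.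
have cF : {in `]t - 1, t + 1[%classic : set R, continuous (fun x => \int[mu]_(s in `]0, +oo[) F x s)}.
  apply: (@continuity_under_integral _ _ _ mu F `]0, +oo[ (measurable_itv _) (t - 1) (t + 1) _ _ g) => //.
  - apply: aeW => s _ x _.
    apply: cvgM; first exact: cvg_cst.
    apply: (@cvg_comp _ _ _ (fun x => x - s) (fun y => nn (f y \- f (t - s))) _ (nbhs (x - s))).
      by apply: (@cvgB _ R^o); [exact: cvg_id|exact: cvg_cst].
    have /(cvg_field_nn hip hb hev hal) : cvg_field S (fun y => f y \- f (t - s)).
      apply: cvg_fieldB => //; split=> // y.
      rewrite (_ : (fun _ => _) = (fun=> 0 : R)); first exact: cvg_cst.
      apply/funext => y'; apply/eqP; rewrite eq_le neg_norm_ge0 // andbT.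
      by apply: neg_norm_le => // v _; rewrite /= subrr normr0 mul0r.
    exact.
  - move=> x tx; apply: aeW => s s0; rewrite ger0_norm //; exact: Fg.
have Ft : \int[mu]_(s in `]0, +oo[) F t s = 0.
  rewrite (@eq_Rintegral _ _ _ _ _ (fun=> 0)) ?Rintegral_cst ?mul0r //.
  move=> s _; rewrite /F (_ : nn _ = 0) ?mulr0 //.
  apply/eqP; rewrite eq_le neg_norm_ge0 // andbT.
  by apply: neg_norm_le => // v _; rewrite /= subrr normr0 mul0r.
have bnd x : `]t - 1, t + 1[%classic x ->
  `|stable_int S f t - stable_int S f x| <= \int[mu]_(s in `]0, +oo[) F x s.
  move=> tx; rewrite distrC.
  have hB := is_bochnerB hip hb (measurable_itv _) (field_stable x hf) (field_stable t hf).
  have [|||y hy yb] := @bochner_exists _ _ S hip hb `](0:R), +oo[ (measurable_itv _)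
    (fun s => semigroup S s (Ps S (f (x - s))) - semigroup S s (Ps S (f (t - s)))) (F x).
  - move=> k; apply: (@eq_measurable_fun _ _ _ _ _ (fun s =>
      <<semigroup S s (Ps S (f (x - s))), e k>> - <<semigroup S s (Ps S (f (t - s))), e k>>)).
      by move=> s _; rewrite ipBl.
    by apply: measurable_funB; apply: measurable_stable.
  - exact: iF.
  - move=> s /=; rewrite in_itv /= andbT => s0; rewrite semigroup_PsB //.
    by rewrite /F; apply: (norm_semigroup_le hip hb hev hal M0 hM) => //; exact: HnegB.
  - by rewrite (is_bochner_unique hb hB hy).
apply/cvgrPdist_le => d d0.
have := cF t (mem_set tI) => /cvgrPdist_le/(_ _ d0).
rewrite Ft.
have nI : \forall x \near t, `]t - 1, t + 1[%classic x.
  by apply: near_in_itvoo; exact: tI.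
move=> nF; near=> x.
apply: le_trans (bnd x _) _; first by near: x.
have : `|0 - \int[mu]_(s in `]0, +oo[) F x s| <= d by near: x.
by rewrite sub0r normrN; apply: le_trans; rewrite ler_norm.
Unshelve. all: by end_near. Qed.

(** The kernel of L is finite dimensional, so continuity of this term reduces to that of finitely
    many scalar integrals. *)
Lemma center_intE f c b t : field f c b -> t <= 0 ->
  center_int S f t = \sum_(0 <= k < N) (\int[mu]_(s in `[t, 0]) f s (e k)) *: e k.
Proof.
move=> hf t0; have [_ _ hx] := field_center hf t0.
apply: (ip_ext hb) => k.
rewrite (ip_comb hip hb (fun k => \int[mu]_(s in `[t, 0]) f s (e k))) leq0n /= hx.
case: ifPn => kN.
  by apply: eq_Rintegral => s _; rewrite ip_Pc // kN.
rewrite (@eq_Rintegral _ _ _ _ _ (fun=> 0)) ?Rintegral_cst ?mul0r //.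
by move=> s _; rewrite ip_Pc // (negPf kN).
Qed.

Lemma continuous_center f c b : field f c b ->
  continuous (fun t : R => center_int S f (Num.min t 0)).
Proof.
move=> hf; have [cf _ _ _] := hf.
rewrite (_ : (fun t : R => _) = fun t => \sum_(0 <= k < N)
   (\int[mu]_(s in `[Num.min t 0, 0]) f s (e k)) *: e k); last first.
  by apply/funext => t; rewrite (center_intE hf) // ge_min lexx orbT.
elim: N => [|n ih] t.
  by under eq_fun do rewrite big_geq //; exact: cvg_cst.
under eq_fun do rewrite big_nat_recr //=.
apply: cvgD; first exact: ih.
apply: cvgZr_tmp; apply: (@continuous_integral_to0 _ (fun s => f s (e n))).
by apply: (cvg_field_eval hip hb hev hal cf); exact: Hpos_eb.
Qed.

Lemma continuous_Phi xi f c b : field f c b ->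
  continuous (fun t : R => Phi xi f (Num.min t 0)).
Proof.
move=> hf t; apply: cvgD.
  by apply: cvgB; [exact: cvg_cst|exact: (continuous_center hf)].
by apply: (continuous_comp (@continuous_min0 R t)); exact: (continuous_stable hf).
Qed.

End Phi.

(** * The Lyapunov-Perron map without noise *)

Lemma cvg_geometric_dist {R : realType} {V : normedModType R} (q C : R) (u : nat -> V) x :
  0 < q < 1 -> (forall n, `|x - u n| <= q ^+ n * C) -> u n @[n --> \oo] --> x.
Proof.
move=> /andP[q0 q1] h; apply/cvgrPdist_le => d d0.
have : q ^+ n * C @[n --> \oo] --> (0 : R).
  rewrite -[0](mul0r C); apply: cvgM; last exact: cvg_cst.
  apply: cvg_expr.
  by rewrite ger0_norm // ltW.
move=> /cvgrPdist_le/(_ _ d0); apply: filterS => n; rewrite sub0r normrN => hn.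
by rewrite (le_trans (h n)) // (le_trans (ler_norm _)).
Qed.

Section ZeroLimits.
Context {R : realType} {X : Type} {F : set_system X} {FF : Filter F}.

Lemma cvg_mul0 (f g : X -> R) (a : R) : f @ F --> a -> g @ F --> (0 : R) ->
  f x * g x @[x --> F] --> (0 : R).
Proof. by move=> fa g0; rewrite -(mulr0 a); exact: cvgM. Qed.

Lemma cvg_dist0 {V : normedModType R} (f : X -> V) (a : V) : f @ F --> a ->
  `|f x - a| @[x --> F] --> (0 : R).
Proof.
move=> fa; rewrite -(normr0 V) -(subrr a); apply: cvg_norm.
by apply: cvgB; [exact: fa|exact: cvg_cst].
Qed.

Lemma cvg_add0 (f g : X -> R) : f @ F --> (0 : R) -> g @ F --> (0 : R) ->
  f x + g x @[x --> F] --> (0 : R).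
Proof. by move=> f0 g0; rewrite -[X in _ --> X]addr0; exact: cvgD. Qed.

End ZeroLimits.

Section Operator.
Context {R : realType} {H : completeNormedModType R} (S : model H).
Hypotheses (hip : inner_product S) (hb : orthonormal_basis S).
Hypotheses (hev : forall k, 0 <= ev S k) (hal : 0 < alpha S < 1).
Local Notation nn := (neg_norm S).
Context (lambda M Ca : R).
Hypotheses (M0 : 0 <= M) (Ca0 : 0 <= Ca).
Hypothesis hM : forall (t : R) (f : H -> R), 0 < t -> Hneg S f ->
     `|semigroup S t (Ps S f)| <=
       M * expR (- lambda * t) * t `^ (- alpha S) * nn (Ps S f).
Hypothesis hCa : forall f : H -> R, Hneg S f ->
     `|Pc S f| <= Ca * nn (ip S (Pc S f)).
Local Notation J := (lp_const S lambda M Ca).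
Local Notation kern := (stable_const S lambda M).

Lemma stable_const_ge0 b : 0 <= kern b.
Proof. by rewrite mulr_ge0 // divr_ge0 ?Gamma_ge0 ?powR_ge0. Qed.

Lemma Phi_bound xi f cf bf t c1 b1 c2 b2 :
  field S lambda f cf bf -> 0 < b1 < lambda -> 0 < b2 < lambda -> 0 <= c1 -> 0 <= c2 -> t <= 0 ->
  (forall s, s <= 0 -> nn (f s) <= c1 * expR (- b1 * s) + c2 * expR (- b2 * s)) ->
  `|Phi S xi f t - xi| <= c1 * (expR (- b1 * t) * J b1) + c2 * (expR (- b2 * t) * J b2).
Proof.
move=> [cvf _ _ _] /andP[b1p b1l] /andP[b2p b2l] c1p c2p t0 hf.
have [_ sb] := @stable_exists _ _ S hip hb hev hal lambda M M0 hM _ t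
   c1 b1 c2 b2 cvf b1l b2l (fun s st => hf s (le_trans (ltW st) t0)).
have [_ cb] := @center_exists _ _ S hip hb hev hal Ca Ca0 hCa _ t c1 b1 c2 b2
  cvf t0 b1p b2p c1p c2p (fun s h => hf s (proj2 (andP h))).
have -> : Phi S xi f t - xi = stable_int S f t - center_int S f t.
  by rewrite /Phi -(addrA xi) addrC addrK addrC.
apply: le_trans (ler_normB _ _) _; apply: le_trans (lerD sb cb) _.
by rewrite /lp_const le_eqVlt; apply/orP; left; apply/eqP; ring.
Qed.

Context (r L : R) (L0 : 0 <= L).
Hypothesis BRneg : forall u, Hneg S (BR S r u).
Hypothesis BR0 : forall w, Hpos S w -> BR S r 0 w = 0.
Hypothesis BRlip : forall u v, nn (BR S r u \- BR S r v) <= L * `|u - v|.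
Context (p : R -> R) (cp : continuous p) (p0 : forall t, 0 < p t).

Definition drift (Y : R -> H) (t : R) : H -> R :=
  fun w => (p t)^-1 * BR S r (p t *: Y t) w.

Lemma Hneg_drift Y t : Hneg S (drift Y t).
Proof. exact: HnegZl. Qed.

(** The factors p and 1/p cancel: the Lipschitz constant does not see the path. *)
Lemma nn_driftB Y Z t : nn (drift Y t \- drift Z t) <= L * `|Y t - Z t|.
Proof.
have h := HnegB hip hb hev hal (BRneg (p t *: Y t)) (BRneg (p t *: Z t)).
have -> : nn (drift Y t \- drift Z t) =
  nn (fun w => (p t)^-1 * (BR S r (p t *: Y t) \- BR S r (p t *: Z t)) w).
  by apply: eq_neg_norm => v _; rewrite /= /drift mulrBr.
apply: le_trans (neg_normZl hip hb hev hal _ h) _.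
have pi : 0 < (p t)^-1 by rewrite invr_gt0.
rewrite gtr0_norm //; apply: le_trans (ler_wpM2l (ltW pi) (BRlip _ _)) _.
by rewrite -scalerBr normrZ gtr0_norm // mulrCA mulKf // gt_eqF.
Qed.

Lemma nn_drift Y t : nn (drift Y t) <= L * `|Y t|.
Proof.
have := nn_driftB Y (fun=> 0) t; rewrite subr0; congr (_ <= _).
by apply: eq_neg_norm => v hv; rewrite /= /drift scaler0 BR0 // mulr0 subr0.
Qed.

Lemma cvg_drift Y : continuous Y -> cvg_field S (drift Y).
Proof.
move=> cY; split=> [t|t]; first exact: Hneg_drift.
have cu : {for t, continuous (fun t => p t *: Y t)} by apply: cvgZ; [exact: cp|exact: cY].
have ci : {for t, continuous (fun t => (p t)^-1)}.
  by apply: cvgV; [rewrite gt_eqF|exact: cp].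
have h0 : (p t')^-1 * (L * `|p t' *: Y t' - p t *: Y t|) +
   `|(p t')^-1 - (p t)^-1| * nn (BR S r (p t *: Y t)) @[t' --> t] --> (0 : R).
  apply: cvg_add0.
    apply: (cvg_mul0 ci); apply: (cvg_mul0 (cvg_cst L)); exact: cvg_dist0.
  under eq_fun do rewrite mulrC.
  by apply: (cvg_mul0 (cvg_cst _)); exact: cvg_dist0.
apply: (squeeze_cvgr _ (cvg_cst (0 : R)) h0); near=> t'.
rewrite neg_norm_ge0 //=.
have hB := HnegB hip hb hev hal (BRneg (p t' *: Y t')) (BRneg (p t *: Y t)).
have -> : nn (drift Y t' \- drift Y t) = nn (fun w => (p t')^-1 *
   (BR S r (p t' *: Y t') \- BR S r (p t *: Y t)) w +
   ((p t')^-1 - (p t)^-1) * BR S r (p t *: Y t) w).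
  by apply: eq_neg_norm => v _; rewrite /= /drift; ring.
have hC := HnegZl hip hb hev hal ((p t')^-1 - (p t)^-1) (BRneg (p t *: Y t)).
apply: le_trans (neg_norm_comb2 hip hb hev hal (p t')^-1 hB hC) _.
rewrite lerD //; last exact: neg_normZl.
by rewrite gtr0_norm ?invr_gt0 // ler_wpM2l // invr_ge0 ltW.
Unshelve. all: by end_near. Qed.

Context (xi : H) (kappa q : R).
Hypotheses (hk : 0 < kappa < lambda) (hq : 0 < q < 1) (hJ : L * J kappa <= q).

(** The counterpart of [Ceta] once the noise is removed: growth at most e^{kappa |t|}. *)
Definition adm (Y : R -> H) := continuous Y /\
  exists2 c, 0 <= c & forall t, `|Y t| <= c * expR (kappa * `|t|).

Definition lp_map (Y : R -> H) (t : R) : H := Phi S xi (drift Y) (Num.min t 0).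

Lemma field_drift Y : adm Y -> exists c, field S lambda (drift Y) c kappa.
Proof.
move=> [cY [c c0 hc]]; exists (L * c); split=> //; [exact: cvg_drift|by rewrite mulr_ge0|].
move=> t; apply: le_trans (nn_drift _ _) _; rewrite -mulrA ler_wpM2l //.
Qed.

Lemma lp_map_lip Y Z c : adm Y -> adm Z -> 0 <= c ->
  (forall t, t <= 0 -> `|Y t - Z t| <= c * expR (- kappa * t)) ->
  forall t, t <= 0 -> `|lp_map Y t - lp_map Z t| <= q * c * expR (- kappa * t).
Proof.
move=> aY aZ c0 h t t0; have [cY fY] := field_drift aY; have [cZ fZ] := field_drift aZ.
rewrite /lp_map (min_idPl t0).
have := @Phi_diff _ _ S hip hb hev hal lambda M Ca M0 Ca0 hM hCa xi _ _ _ _ _ _ t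
  (L * c) kappa 0 kappa fY fZ hk hk (mulr_ge0 L0 c0) (lexx 0) t0.
rewrite mul0r addr0 => /(_ _)/le_trans; apply.
  move=> s s0; rewrite mul0r addr0; apply: le_trans (nn_driftB _ _ _) _.
  by rewrite -mulrA ler_wpM2l // h.
have -> : L * c * (expR (- kappa * t) * J kappa) = L * J kappa * (c * expR (- kappa * t)) by ring.
by rewrite -[leRHS]mulrA ler_wpM2r // mulr_ge0 ?expR_ge0.
Qed.

Lemma lp_map_bound Y c1 b1 c2 b2 : adm Y ->
  0 < b1 < lambda -> 0 < b2 < lambda -> 0 <= c1 -> 0 <= c2 ->
  (forall s, s <= 0 -> nn (drift Y s) <= c1 * expR (- b1 * s) + c2 * expR (- b2 * s)) ->
  forall t, t <= 0 ->
  `|lp_map Y t - xi| <= c1 * (expR (- b1 * t) * J b1) + c2 * (expR (- b2 * t) * J b2).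
Proof.
move=> aY h1 h2 c10 c20 hY t t0; have [c fY] := field_drift aY.
by rewrite /lp_map (min_idPl t0); apply: Phi_bound fY _ _ _ _ _ _.
Qed.

Lemma lp_map_growth Y c : adm Y -> 0 <= c ->
  (forall t, t <= 0 -> `|Y t| <= c * expR (- kappa * t)) ->
  forall t, t <= 0 -> `|lp_map Y t - xi| <= q * c * expR (- kappa * t).
Proof.
move=> aY c0 h t t0.
have := @lp_map_bound Y (L * c) kappa 0 kappa aY hk hk (mulr_ge0 L0 c0) (lexx 0) _ t t0.
rewrite mul0r addr0 => /(_ _)/le_trans; apply.
  move=> s s0; rewrite mul0r addr0; apply: le_trans (nn_drift _ _) _.
  by rewrite -mulrA ler_wpM2l // h.
have -> : L * c * (expR (- kappa * t) * J kappa) = L * J kappa * (c * expR (- kappa * t)) by ring.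
by rewrite -[leRHS]mulrA ler_wpM2r // mulr_ge0 ?expR_ge0.
Qed.

Lemma lp_map_min Y t : lp_map Y (Num.min t 0) = lp_map Y t.
Proof. by rewrite /lp_map; congr (Phi _ _ _ _); rewrite (min_idPl _) // ge_min lexx orbT. Qed.

Lemma expR_kappa_ge1 t : t <= 0 -> 1 <= expR (- kappa * t).
Proof. by case/andP: hk => k0 _ t0; rewrite -expR0 ler_expR mulNr oppr_ge0 pmulr_rle0. Qed.

Lemma expR_min_le t : expR (- kappa * Num.min t 0) <= expR (kappa * `|t|).
Proof.
case/andP: hk => k0 _; rewrite ler_expR mulNr -mulrN ler_pM2l //.
by case: (lerP t 0) => [t0|t0]; [rewrite ler0_norm|rewrite oppr0].
Qed.

Lemma adm_lp_map Y : adm Y -> adm (lp_map Y).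
Proof.
move=> aY; have [c fY] := field_drift aY; split.
  exact: (@continuous_Phi _ _ S hip hb hev hal lambda M Ca M0 Ca0 hM hCa xi _ c kappa fY).
have [_ [d d0 hd]] := aY; have [q0 q1] := andP hq.
exists (`|xi| + q * d); first by rewrite addr_ge0 // mulr_ge0 // ltW.
move=> t; rewrite -lp_map_min; set m := Num.min t 0.
have m0 : m <= 0 by rewrite ge_min lexx orbT.
have := @lp_map_growth Y d aY d0 _ m m0 => /(_ _) h.
apply: (@le_trans _ _ ((`|xi| + q * d) * expR (- kappa * m))); last first.
  by rewrite ler_wpM2l ?expR_min_le // addr_ge0 // mulr_ge0 // ltW.
rewrite mulrDl -[lp_map Y m](subrK xi) addrC; apply: le_trans (ler_normD _ _) _.
rewrite lerD ?ler_peMr ?expR_kappa_ge1 // h // => s s0.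
by apply: le_trans (hd s) _; rewrite ler0_norm // mulrN mulNr.
Qed.

(** The iteration starts from 0, which lies in every ball |Y| <= W; invariance of such a ball then
    passes to all iterates and to their limit. *)
Fixpoint picard (n : nat) : R -> H :=
  if n is m.+1 then lp_map (picard m) else fun=> 0.

Lemma adm0 : adm (fun=> 0).
Proof.
split; first by move=> t; exact: cvg_cst.
by exists 0 => // t; rewrite normr0 mul0r.
Qed.

Lemma adm_picard n : adm (picard n).
Proof. by elim: n => [|n ih]; [exact: adm0|exact: adm_lp_map]. Qed.

Lemma picard_bound n t : t <= 0 -> `|picard n t| <= `|xi| / (1 - q) * expR (- kappa * t).
Proof.
have [q0 q1] := andP hq; have q1' : 0 < 1 - q by rewrite subr_gt0.
have c0 : 0 <= `|xi| / (1 - q) by rewrite divr_ge0 // ltW.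
elim: n t => [|n ih] t t0 /=; first by rewrite normr0 mulr_ge0 ?expR_ge0.
have h := @lp_map_growth _ _ (adm_picard n) c0 ih t t0.
rewrite -[lp_map _ t](subrK xi) addrC; apply: le_trans (ler_normD _ _) _.
apply: (@le_trans _ _ (`|xi| * expR (- kappa * t) + q * (`|xi| / (1 - q)) * expR (- kappa * t))).
  by rewrite lerD // ler_peMr // expR_kappa_ge1.
by rewrite -mulrDl le_eqVlt; apply/orP; left; apply/eqP; field; rewrite gt_eqF.
Qed.

Lemma picard_diff n k t : t <= 0 ->
  `|picard (k + n) t - picard n t| <= q ^+ n * (`|xi| / (1 - q)) * expR (- kappa * t).
Proof.
have [q0 q1] := andP hq; have q1' : 0 < 1 - q by rewrite subr_gt0.
have c0 : 0 <= `|xi| / (1 - q) by rewrite divr_ge0 // ltW.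
elim: n t => [|n ih] t t0.
  by rewrite addn0 subr0 expr0 mul1r; exact: picard_bound.
rewrite addnS /= exprS -(mulrA q).
apply: lp_map_lip => //; try exact: adm_picard.
by rewrite mulr_ge0 // exprn_ge0 // ltW.
Qed.

Lemma picard_min n t : picard n (Num.min t 0) = picard n t.
Proof. by case: n => [//|n] /=; exact: lp_map_min. Qed.

(** The limit is taken pointwise in time; the geometric rate is uniform on bounded intervals, and
    this makes the limit continuous. *)
Lemma fixed_exists : exists2 Y, adm Y & forall t, lp_map Y t = Y t.
Proof.
have [q0 q1] := andP hq; have q1' : 0 < 1 - q by rewrite subr_gt0.
have [k0 _] := andP hk.
set a := `|xi| / (1 - q); have a0 : 0 <= a by rewrite divr_ge0 // ltW.
have pd n k t : `|picard (k + n) t - picard n t| <= q ^+ n * (a * expR (kappa * `|t|)).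
  rewrite -picard_min -[in X in _ - X]picard_min.
  apply: le_trans (picard_diff _ _ _) _; first by rewrite ge_min lexx orbT.
  by rewrite -mulrA ler_wpM2l ?exprn_ge0 ?(ltW q0) // ler_wpM2l // expR_min_le.
have cvp t : cvgn (picard ^~ t).
  apply: cauchy_cvg; apply: cauchy_exP => d d0.
  have : q ^+ n * (a * expR (kappa * `|t|)) @[n --> \oo] --> (0 : R).
    rewrite -[0](mul0r (a * expR (kappa * `|t|))); apply: cvgM; last exact: cvg_cst.
  apply: cvg_expr.
    by rewrite ger0_norm // ltW.
  move=> /cvgrPdist_lt/(_ _ d0)[n _ /(_ n (leqnn n))]; rewrite /= sub0r normrN => hn.
  exists (picard n t); exists n => // m /= nm.
  rewrite -ball_normE /= distrC -(subnK nm); apply: le_lt_trans (pd _ _ _) _.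
  by rewrite (le_lt_trans (ler_norm _)).
pose Y t := limn (picard ^~ t).
have Yp n t : `|Y t - picard n t| <= q ^+ n * (a * expR (kappa * `|t|)).
  have h : `|picard (k + n)%N t - picard n t| @[k --> \oo] --> `|Y t - picard n t|.
    apply: cvg_norm; apply: cvgB; last exact: cvg_cst.
    by rewrite (cvg_shiftn n (picard ^~ t)); exact: cvp.
  rewrite -(cvg_lim _ h) //; apply: limr_le; first exact: cvgP h.
  by apply: nearW => k; exact: pd.
have cY : continuous Y.
  move=> t; apply/cvgrPdist_le => d d0.
  have d3 : 0 < d / 3 by rewrite divr_gt0.
  have : q ^+ n * (a * expR (kappa * (`|t| + 1))) @[n --> \oo] --> (0 : R).
    rewrite -[0](mul0r (a * expR (kappa * (`|t| + 1)))); apply: cvgM; last exact: cvg_cst.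
  apply: cvg_expr.
    by rewrite ger0_norm // ltW.
  move=> /cvgrPdist_le/(_ _ d3)[n _ /(_ n (leqnn n))]; rewrite /= sub0r normrN => /(le_trans (ler_norm _)) hn.
  have hY s : `|s| <= `|t| + 1 -> `|Y s - picard n s| <= d / 3.
    move=> st; apply: le_trans (Yp n s) (le_trans _ hn).
    by rewrite ler_wpM2l ?exprn_ge0 ?(ltW q0) // ler_wpM2l // ler_expR ler_pM2l.
  have [cpn _] := adm_picard n.
  have near1 : \forall s \near t, `|t - s| <= 1.
    by have := @cvg_id _ (nbhs t) => /(@cvgrPdist_le _ R^o); apply.
  near=> s.
  have st : `|s| <= `|t| + 1.
    have : `|t - s| <= 1 by near: s.
    rewrite distrC -lerBlDl; apply: le_trans; exact: lerB_dist.
  have h2 : `|picard n t - picard n s| <= d / 3.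
    by near: s; have := cpn t => /cvgrPdist_le; apply.
  have -> : Y t - Y s = (Y t - picard n t) + (picard n t - picard n s) - (Y s - picard n s).
    by rewrite addrA subrK opprB addrA subrK.
  apply: le_trans (ler_normB _ _) _; apply: le_trans (lerD (ler_normD _ _) (hY s st)) _.
  have h1 : `|Y t - picard n t| <= d / 3 by apply: hY; rewrite lerDl.
  by lra.
have aY : adm Y.
  split=> //; exists a => // t; have := Yp 0%N t; rewrite subr0 expr0 mul1r; exact.
exists Y => // t; rewrite -lp_map_min.
have -> : Y t = Y (Num.min t 0).
  by rewrite /Y; congr (limn _); apply/funext => n; rewrite picard_min.
set m := Num.min t 0; have m0 : m <= 0 by rewrite ge_min lexx orbT.
have h1 : picard n.+1 m @[n --> \oo] --> Y m.
  by have := cvp m; rewrite -(cvg_shiftS (picard ^~ m)).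
have h2 : picard n.+1 m @[n --> \oo] --> lp_map Y m.
  apply: (@cvg_geometric_dist _ _ q (q * a * expR (- kappa * m))) => // n /=.
  have := @lp_map_lip Y (picard n) (q ^+ n * a) aY (adm_picard n) _ _ m m0.
  rewrite mulr_ge0 ?exprn_ge0 ?(ltW q0) // => /(_ isT) h.
  apply: le_trans (h _) _.
    move=> s s0; apply: le_trans (Yp n s) _.
    by rewrite ler0_norm // mulrN mulNr mulrA.
  by rewrite le_eqVlt; apply/orP; left; apply/eqP; ring.
by rewrite -(cvg_lim _ h1) // -(cvg_lim _ h2).
Unshelve. all: by end_near. Qed.

(** This contains uniqueness on t <= 0. It also lets [fixed_invariant] speak of whichever fixed
    point [vstar] happens to select. *)
Lemma fixed_picard Z : adm Z -> (forall t, t <= 0 -> lp_map Z t = Z t) ->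
  forall t, t <= 0 -> picard n t @[n --> \oo] --> Z t.
Proof.
move=> aZ fZ t t0; have [q0 q1] := andP hq; have [_ [c c0 hc]] := aZ.
have h n s : s <= 0 -> `|Z s - picard n s| <= q ^+ n * c * expR (- kappa * s).
  elim: n s => [|n ih] s s0.
    by rewrite subr0 expr0 mul1r (le_trans (hc s)) // ler0_norm // mulrN mulNr.
  rewrite -fZ //= exprS -(mulrA q); apply: lp_map_lip => //; first exact: adm_picard.
  by rewrite mulr_ge0 // exprn_ge0 // ltW.
apply: (@cvg_geometric_dist _ _ q (c * expR (- kappa * t))) => // n.
by rewrite mulrA h.
Qed.

Lemma fixed_invariant Z (W : R -> R) : adm Z -> (forall t, t <= 0 -> lp_map Z t = Z t) ->
  (forall t, t <= 0 -> 0 <= W t) ->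
  (forall Y, adm Y -> (forall t, t <= 0 -> `|Y t| <= W t) ->
     forall t, t <= 0 -> `|lp_map Y t| <= W t) ->
  forall t, t <= 0 -> `|Z t| <= W t.
Proof.
move=> aZ fZ W0 hW t t0.
have hp n s : s <= 0 -> `|picard n s| <= W s.
  elim: n s => [|n ih] s s0 /=; first by rewrite normr0 W0.
  by apply: hW => //; exact: adm_picard.
have /cvg_norm h := fixed_picard aZ fZ t0.
rewrite -(cvg_lim _ h) //; apply: limr_le; first exact: cvgP h.
by apply: nearW => n; exact: hp.
Qed.

End Operator.

(** * A priori estimate *)

Ltac nonneg := repeat first [ done | exact: sqr_ge0 | exact: expR_ge0 | by apply: ltW
  | apply: addr_ge0 | apply: mulr_ge0 | apply: exprn_ge0 | rewrite invr_ge0 ].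

(** Stated outside the section so that its independence of the path, the radius and xi is visible in
    its arguments. [C1] and [C2] bound the drift below and above the threshold [delta]; [K1] and
    [K2] bound |pZ - xi| and |pZ| + |xi| below it. *)
Definition apriori_const {R : realType} (D delta Jm Lm q : R) : R :=
  let A := 2 * (delta ^+ 2)^-1 / (1 - q) in
  let C1 := 8 * D * (1 + A * delta ^+ 2) ^+ 2 in
  let C2 := 2 * Lm * ((delta ^+ 2)^-1 + A) in
  let K1 := 2 * Jm * (C1 + C2 * delta) in
  let K2 := 5 + 4 * (A * delta ^+ 2) in
  2 * D * K2 * K1 + 2 * D * K2 + D + C2 + D / delta.

Section Apriori.
Context {R : realType} {H : completeNormedModType R} (S : model H).
Hypotheses (hip : inner_product S) (hb : orthonormal_basis S).
Hypotheses (hev : forall k, 0 <= ev S k) (hal : 0 < alpha S < 1).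
Local Notation nn := (neg_norm S).
Context (lambda M Ca : R).
Hypotheses (M0 : 0 <= M) (Ca0 : 0 <= Ca).
Hypothesis hM : forall (t : R) (f : H -> R), 0 < t -> Hneg S f ->
     `|semigroup S t (Ps S f)| <=
       M * expR (- lambda * t) * t `^ (- alpha S) * nn (Ps S f).
Hypothesis hCa : forall f : H -> R, Hneg S f ->
     `|Pc S f| <= Ca * nn (ip S (Pc S f)).
Local Notation J := (lp_const S lambda M Ca).
Local Notation kern := (stable_const S lambda M).

Lemma stable_diff f g cf bf cg bg t c b :
  field S lambda f cf bf -> field S lambda g cg bg -> b < lambda ->
  (forall s, s < t -> nn (f s \- g s) <= c * expR (- b * s)) ->
  `|stable_int S f t - stable_int S g t| <= c * (expR (- b * t) * kern b).
Proof.
move=> hf hg bl hfg; have [cvf _ _ _] := hf; have [cvg _ _ _] := hg.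
have cfg := cvg_fieldB hip hb hev hal cvf cvg.
have [|sfg] := @stable_exists _ _ S hip hb hev hal lambda M M0 hM _ t c b 0 b cfg bl bl.
  by move=> s st; rewrite mul0r addr0; exact: hfg.
rewrite mul0r addr0; congr (`| _ | <= _); apply: (is_bochner_unique hb sfg).
have := is_bochnerB hip hb (measurable_itv _)
  (field_stable hip hb hev hal M0 hM t hf) (field_stable hip hb hev hal M0 hM t hg).
apply: eq_is_bochner; first exact: measurable_itv.
move=> s /=; rewrite in_itv /= andbT => s0.
by rewrite semigroup_PsB //; [case: cvf|case: cvg].
Qed.

Lemma field_cst g c b : Hneg S g -> nn g <= c -> 0 < b < lambda ->
  field S lambda (fun=> g) c b.
Proof.
move=> hg gc hb'; have c0 : 0 <= c by apply: le_trans gc; exact: neg_norm_ge0.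
have [b0 _] := andP hb'; split=> //.
  split=> // t; rewrite (_ : (fun _ => _) = (fun=> 0 : R)); first exact: cvg_cst.
  apply/funext => t'; apply/eqP; rewrite eq_le neg_norm_ge0 // andbT.
  by apply: neg_norm_le => // v _; rewrite /= subrr normr0 mul0r.
move=> t; apply: le_trans gc _; rewrite ler_peMr //.
by rewrite -expR0 ler_expR mulr_ge0 // ltW.
Qed.

Context (r L : R) (L0 : 0 <= L).
Hypothesis BRneg : forall u, Hneg S (BR S r u).
Hypothesis BR0 : forall w, Hpos S w -> BR S r 0 w = 0.
Hypothesis BRlip : forall u v, nn (BR S r u \- BR S r v) <= L * `|u - v|.
Context (p : R -> R) (cp : continuous p) (p0 : forall t, 0 < p t).
Context (xi : H) (kappa q : R).
Hypotheses (hk : 0 < kappa < lambda) (hq : 0 < q < 1) (hJ : L * J kappa <= q).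
Local Notation T := (lp_map S r p xi).
Local Notation adm := (adm kappa).
Local Notation fld := (drift S r p).

Context (D : R) (D0 : 0 <= D) (Bxi : H -> R) (hBxi : Hneg S Bxi).
Hypothesis BRsq : forall u, nn (BR S r u) <= D * `|u| ^+ 2.
Hypothesis BRxi : forall u, nn (BR S r u \- Bxi) <= D * (`|u - xi| * (`|u| + `|xi|)).
Hypothesis nnBxi : nn Bxi <= D * `|xi| ^+ 2.
Context (s rho mu delta Jm Lm : R).
Hypotheses (s01 : 0 <= s <= 1) (mu0 : 0 < mu) (rho0 : 0 < rho) (delta0 : 0 < delta).
Hypothesis hp : forall t, t <= 0 -> `|p t - 1| <= s * expR (- mu * t).
Hypothesis hpV : forall t, t <= 0 -> `|(p t)^-1 - 1| <= s * expR (- mu * t).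
Hypotheses (kE : kappa = 3 * rho + 2 * mu) (kl : kappa + 2 * mu < lambda).
Hypotheses (Jrho : J rho <= Jm) (Jk : J kappa <= Jm) (Jmid : J (2 * rho + mu) <= Jm)
  (kernm : kern (kappa + 2 * mu) <= Jm) (LLm : L <= Lm) (Jm0 : 0 <= Jm).
Let A := 2 * (delta ^+ 2)^-1 / (1 - q).
(** Where a l m <= delta, the bounds p <= 2m and |Y| <= W give D p |Y| <= eps; so the drift, at most
    D p |Y|^2, is at most eps |Y| there. *)
Let eps := 4 * D * (delta + A * delta ^+ 3).
Hypotheses (epsJ : 2 * eps * Jm <= 1 - q).

Local Notation a := `|xi|.
Let l t := expR (- rho * t).
Let m t := expR (- mu * t).
(* The drift is at most [eps |Y|] where the majorant [a l m] is below [delta] and at most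
   [L |Y|] elsewhere; the cubic term of [W] absorbs the second region, so that the ball
   [|Y| <= W] is invariant under the Lyapunov-Perron map. *)
Let W t := 2 * (a * l t + A * (a ^+ 3 * (l t ^+ 3 * m t ^+ 2))).

Let q0 : 0 < q. Proof. by case/andP: hq. Qed.
Let q1 : 0 < 1 - q. Proof. by case/andP: hq => _; rewrite subr_gt0. Qed.
Let s0 : 0 <= s. Proof. by case/andP: s01. Qed.
Let A0 : 0 <= A. Proof. by rewrite /A divr_ge0 ?mulr_ge0 ?invr_ge0 ?sqr_ge0 // ltW. Qed.
Let eps0 : 0 <= eps.
Proof. by have d0 := ltW delta0; rewrite /eps; nonneg. Qed.
Let l1 t : t <= 0 -> 1 <= l t.
Proof. by move=> t0; rewrite -expR0 ler_expR mulNr oppr_ge0 pmulr_rle0. Qed.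
Let m1 t : t <= 0 -> 1 <= m t.
Proof. by move=> t0; rewrite -expR0 ler_expR mulNr oppr_ge0 pmulr_rle0. Qed.
Let l_gt0 t : 0 < l t. Proof. exact: expR_gt0. Qed.
Let m_gt0 t : 0 < m t. Proof. exact: expR_gt0. Qed.

(** The exponents are chosen for this identity: the cubic term of the majorant grows exactly at the
    rate for which the contraction constant [q] is available. *)
Let lm3 t : l t ^+ 3 * m t ^+ 2 = expR (- kappa * t).
Proof. by rewrite /l /m -!expRM_natl -expRD kE; congr expR; ring. Qed.
Let lm2 t : l t ^+ 2 * m t = expR (- (2 * rho + mu) * t).
Proof. by rewrite /l /m -!expRM_natl -expRD; congr expR; ring. Qed.
Let lm4 t : l t ^+ 3 * m t ^+ 4 = expR (- (kappa + 2 * mu) * t).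
Proof. by rewrite /l /m -!expRM_natl -expRD kE; congr expR; ring. Qed.

Let p_le t : t <= 0 -> p t <= 2 * m t.
Proof.
move=> t0; have := hp t0 => /(le_trans (ler_norm _)); rewrite -/(m t) => h.
by have := m1 t0; case/andP: s01 => *; nra.
Qed.

Let pV_le t : t <= 0 -> (p t)^-1 <= 2 * m t.
Proof.
move=> t0; have := hpV t0 => /(le_trans (ler_norm _)); rewrite -/(m t) => h.
by have := m1 t0; case/andP: s01 => *; nra.
Qed.

Let W0 t : 0 <= W t.
Proof.
by rewrite /W; by nonneg.
Qed.

Lemma nn_drift_sq Y t : nn (fld Y t) <= D * (p t * `|Y t|) * `|Y t|.
Proof.
apply: le_trans (neg_normZl hip hb hev hal _ (BRneg _)) _.
have pi : 0 < (p t)^-1 by rewrite invr_gt0.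
rewrite gtr0_norm //; apply: le_trans (ler_wpM2l (ltW pi) (BRsq _)) _.
rewrite normrZ gtr0_norm // le_eqVlt; apply/orP; left; apply/eqP.
by field; rewrite gt_eqF.
Qed.

Let good_W t : a * l t * m t <= delta -> W t <= 2 * (1 + A * delta ^+ 2) * (a * l t).
Proof.
move=> h; have h0 : 0 <= a * l t * m t by nonneg.
have -> : W t = 2 * (1 + A * (a * l t * m t) ^+ 2) * (a * l t) by rewrite /W; ring.
rewrite ler_wpM2r ?mulr_ge0 ?(ltW (l_gt0 t)) // ler_pM2l // lerD2l ler_wpM2l //.
by rewrite ler_sqr ?nnegrE // ltW.
Qed.

(** Here (a l m / delta)^2 >= 1, and this factor turns the linear term of [W] into a cubic one. *)
Let bad_W t : delta < a * l t * m t ->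
  W t <= 2 * ((delta ^+ 2)^-1 + A) * (a ^+ 3 * (l t ^+ 3 * m t ^+ 2)).
Proof.
move=> h; rewrite /W -[leRHS]mulrA ler_pM2l // mulrDl lerD2r.
rewrite [leRHS]mulrC ler_pdivlMr ?exprn_gt0 //.
have -> : a ^+ 3 * (l t ^+ 3 * m t ^+ 2) = a * l t * (a * l t * m t) ^+ 2 by ring.
rewrite ler_wpM2l ?mulr_ge0 ?(ltW (l_gt0 t)) //.
by rewrite ler_sqr ?nnegrE ?(ltW delta0) ?(ltW (le_lt_trans (ltW delta0) h)) // ltW.
Qed.

Let nn_good Y t : t <= 0 -> `|Y t| <= W t -> a * l t * m t <= delta ->
  nn (fld Y t) <= 2 * eps * a * l t + 2 * eps * A * a ^+ 3 * (l t ^+ 3 * m t ^+ 2).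
Proof.
move=> t0 YW h; apply: le_trans (nn_drift_sq _ _) _.
have h0 : 0 <= a * l t * m t by nonneg.
have -> : 2 * eps * a * l t + 2 * eps * A * a ^+ 3 * (l t ^+ 3 * m t ^+ 2) = eps * W t.
  by rewrite /W; ring.
apply: ler_pM => //; first by nonneg.
rewrite /eps [4 * D]mulrC -[leRHS]mulrA ler_wpM2l //.
apply: (@le_trans _ _ (2 * m t * W t)); first by rewrite ler_pM ?p_le // ltW.
have -> : 2 * m t * W t = 4 * (a * l t * m t + A * (a * l t * m t) ^+ 3) by rewrite /W; ring.
by rewrite ler_pM2l // lerD // ler_wpM2l // ler_pXn2r // ?nnegrE // ltW.
Qed.

Let C2 := 2 * Lm * ((delta ^+ 2)^-1 + A).

Let nn_bad Y t : `|Y t| <= W t -> delta < a * l t * m t ->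
  nn (fld Y t) <= 2 * L * ((delta ^+ 2)^-1 + A) * a ^+ 3 * (l t ^+ 3 * m t ^+ 2).
Proof.
move=> YW h; apply: le_trans (nn_drift hip hb hev hal BRneg BR0 BRlip p0 _ _) _.
have -> : 2 * L * ((delta ^+ 2)^-1 + A) * a ^+ 3 * (l t ^+ 3 * m t ^+ 2) =
  L * (2 * ((delta ^+ 2)^-1 + A) * (a ^+ 3 * (l t ^+ 3 * m t ^+ 2))) by ring.
by rewrite ler_wpM2l // (le_trans YW) // bad_W.
Qed.

Let d2 : 0 <= (delta ^+ 2)^-1. Proof. by rewrite invr_ge0 sqr_ge0. Qed.
Let rl : rho < lambda.
Proof. by have h1 := kE; have h2 := mu0; have h3 := rho0; apply: lt_trans kl; rewrite h1; lra. Qed.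

(** Both terms of [W] reproduce themselves. The datum xi takes half of the linear term and the drift
    below the threshold the other half, since 2 eps J(rho) <= 1. The cubic coefficient is reproduced
    by [e2], which combines the smallness of eps with the contraction constant at kappa. *)
Lemma apriori_invariant Y : adm Y -> (forall t, t <= 0 -> `|Y t| <= W t) ->
  forall t, t <= 0 -> `|T Y t| <= W t.
Proof.
move=> aY YW t t0.
have h1 : 0 <= 2 * eps * a by nonneg.
have h2 : 0 <= 2 * (eps * A + L * ((delta ^+ 2)^-1 + A)) * a ^+ 3.
  by nonneg.
have hr : 0 < rho < lambda by rewrite rho0 rl.
have h : forall t, t <= 0 -> nn (fld Y t) <= 2 * eps * a * expR (- rho * t) +
    2 * (eps * A + L * ((delta ^+ 2)^-1 + A)) * a ^+ 3 * expR (- kappa * t).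
  move=> {}t {}t0; rewrite -lm3 -/(l t); have c0 : 0 <= l t ^+ 3 * m t ^+ 2.
    by nonneg.
  case: (lerP (a * l t * m t) delta) => hd.
    apply: le_trans (nn_good t0 (YW t t0) hd) _; rewrite lerD2l ler_wpM2r //.
    rewrite ler_wpM2r ?exprn_ge0 // -mulrA ler_pM2l // lerDl.
    by nonneg.
  apply: le_trans (nn_bad (YW t t0) hd) _; apply: ler_wpDl.
    by nonneg.
  rewrite ler_wpM2r // ler_wpM2r ?exprn_ge0 // -mulrA ler_pM2l // lerDr.
  by nonneg.
have := lp_map_bound hip hb hev hal M0 Ca0 hM hCa L0 BRneg BR0 BRlip cp p0 xi hk aY hr hk h1 h2 h t0.
rewrite -lm3 -/(l t) => hT.
rewrite -[T Y t](subrK xi) addrC; apply: le_trans (ler_normD _ _) _.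
apply: le_trans (lerD (lexx _) hT) _.
have lt1 := l1 t0; have c0 : 0 <= l t ^+ 3 * m t ^+ 2.
  by nonneg.
have e1 : 2 * eps * J rho <= 1.
  apply: (@le_trans _ _ (2 * eps * Jm)); first by rewrite ler_wpM2l // mulr_ge0.
  by rewrite (le_trans epsJ) // gerBl ltW.
have e2 : (eps * A + L * ((delta ^+ 2)^-1 + A)) * J kappa <= A.
  have -> : (eps * A + L * ((delta ^+ 2)^-1 + A)) * J kappa =
     A * (eps * J kappa) + L * J kappa * ((delta ^+ 2)^-1 + A) by ring.
  have e3 : eps * J kappa <= (1 - q) / 2.
    rewrite ler_pdivlMr // mulrC mulrA (le_trans _ epsJ) // ler_wpM2l //.
    by nonneg.
  apply: le_trans (lerD (ler_wpM2l A0 e3) (ler_wpM2r _ hJ)) _; first by rewrite addr_ge0.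
  (* The origin of [A]: with this relation the claim reduces to (1 - q)^2 >= 0. *)
  have E : (delta ^+ 2)^-1 = A * (1 - q) / 2.
    by rewrite /A divfK ?gt_eqF // mulrAC divff // mul1r.
  by rewrite E; have := A0; have := q0; have := q1; nra.
have -> : W t = a * l t + a * l t + 2 * A * a ^+ 3 * (l t ^+ 3 * m t ^+ 2).
  by rewrite /W; ring.
rewrite -[leRHS]addrA; apply: lerD; first by rewrite ler_peMr.
apply: lerD.
  have -> : 2 * eps * a * (l t * J rho) = 2 * eps * J rho * (a * l t) by ring.
  by rewrite ler_piMl // mulr_ge0 // ltW.
have -> : 2 * (eps * A + L * ((delta ^+ 2)^-1 + A)) * a ^+ 3 * (l t ^+ 3 * m t ^+ 2 * J kappa) =
  (2 * a ^+ 3 * (l t ^+ 3 * m t ^+ 2)) * ((eps * A + L * ((delta ^+ 2)^-1 + A)) * J kappa) by ring.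
have -> : 2 * A * a ^+ 3 * (l t ^+ 3 * m t ^+ 2) = 2 * a ^+ 3 * (l t ^+ 3 * m t ^+ 2) * A by ring.
rewrite ler_wpM2l //; by nonneg.
Qed.

Context (Z : R -> H) (aZ : adm Z) (fZ : forall t, t <= 0 -> T Z t = Z t).

Let ZW t : t <= 0 -> `|Z t| <= W t.
Proof.
move=> t0; apply: (fixed_invariant hip hb hev hal M0 Ca0 hM hCa L0 BRneg BR0 BRlip cp p0 hk hq hJ
  aZ fZ) => //.
exact: apriori_invariant.
Qed.

Let C1 := 8 * D * (1 + A * delta ^+ 2) ^+ 2.
Let C10 : 0 <= C1. Proof. by rewrite /C1; nonneg. Qed.
Let Lm0 : 0 <= Lm. Proof. exact: le_trans LLm. Qed.
Let C20 : 0 <= C2. Proof. by rewrite /C2; nonneg. Qed.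

(** The first insertion: once the growth of Z is known, one application of the map makes the
    distance to the constant path xi quadratic in |xi|. *)
Let Z_xi t : t <= 0 ->
  `|Z t - xi| <= Jm * (C1 * a ^+ 2 * (l t ^+ 2 * m t) + C2 * a ^+ 3 * (l t ^+ 3 * m t ^+ 2)).
Proof.
move=> t0.
have h1 : 0 <= C1 * a ^+ 2 by nonneg.
have h2 : 0 <= C2 * a ^+ 3 by nonneg.
have hr : 0 < 2 * rho + mu < lambda.
  apply/andP; split; first by apply: addr_gt0; rewrite // mulr_gt0.
  by have mu0' := mu0; have rho0' := rho0; apply: lt_trans kl; rewrite kE; lra.
have h : forall t, t <= 0 -> nn (fld Z t) <= C1 * a ^+ 2 * expR (- (2 * rho + mu) * t) +
    C2 * a ^+ 3 * expR (- kappa * t).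
  move=> {}t {}t0; rewrite -lm3 -lm2.
  have c0 : 0 <= l t ^+ 3 * m t ^+ 2 by nonneg.
  case: (lerP (a * l t * m t) delta) => hd.
    apply: ler_wpDr; first by nonneg.
    apply: le_trans (nn_drift_sq _ _) _.
    have h0 : 0 <= a * l t by nonneg.
    have ZG := le_trans (ZW t0) (good_W hd).
    apply: (@le_trans _ _ (D * (2 * m t * (2 * (1 + A * delta ^+ 2) * (a * l t))) *
       (2 * (1 + A * delta ^+ 2) * (a * l t)))).
      apply: ler_pM => //; first by nonneg.
      by rewrite ler_wpM2l // ler_pM ?p_le // ltW.
    by rewrite le_eqVlt; apply/orP; left; apply/eqP; rewrite /C1; ring.
  apply: ler_wpDl; first by nonneg.
  apply: le_trans (nn_bad (ZW t0) hd) _.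
  rewrite ler_wpM2r // ler_wpM2r ?exprn_ge0 // /C2 ler_wpM2r ?addr_ge0 //.
  by rewrite ler_pM2l.
have := lp_map_bound hip hb hev hal M0 Ca0 hM hCa L0 BRneg BR0 BRlip cp p0 xi hk aZ hr hk h1 h2 h t0.
rewrite -lm3 -lm2 fZ // => /le_trans; apply.
have -> : Jm * (C1 * a ^+ 2 * (l t ^+ 2 * m t) + C2 * a ^+ 3 * (l t ^+ 3 * m t ^+ 2)) =
  C1 * a ^+ 2 * (l t ^+ 2 * m t * Jm) + C2 * a ^+ 3 * (l t ^+ 3 * m t ^+ 2 * Jm) by ring.
apply: lerD; rewrite ler_wpM2l // ler_wpM2l //; by nonneg.
Qed.

Let K1 := 2 * Jm * (C1 + C2 * delta).
Let K2 := 5 + 4 * (A * delta ^+ 2).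
Let Cf := 2 * D * K2 * K1 + 2 * D * K2 + D + C2 + D / delta.

Let K10 : 0 <= K1. Proof. by rewrite /K1; nonneg. Qed.
Let K20 : 0 <= K2. Proof. by rewrite /K2; nonneg. Qed.

(** The second insertion. The weight l^3 m^4 is what the product of the bounds costs: one m for 1/p,
    l^2 m^2 for pZ - xi and l m for |pZ| + |xi|. *)
Lemma nn_final t : t <= 0 ->
  nn (fld Z t \- Bxi) <= Cf * (a ^+ 3 + s * a ^+ 2) * (l t ^+ 3 * m t ^+ 4).
Proof.
move=> t0; have lt1 := l1 t0; have mt1 := m1 t0.
have lt0 := l_gt0 t; have mt0 := m_gt0 t; have a0 : 0 <= a by [].
have c0 : 0 <= l t ^+ 3 * m t ^+ 4 by nonneg.
have l3 : l t <= l t ^+ 3 by rewrite -[leLHS]expr1 ler_weXn2l.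
have a3 : 0 <= a ^+ 3 by nonneg.
have sa2 : 0 <= s * a ^+ 2 by nonneg.
have Dd : 0 <= D / delta by rewrite divr_ge0 // ltW.
have D1 : 0 <= 2 * D * K2 * K1 by nonneg.
have D2 : 0 <= 2 * D * K2 by nonneg.
case: (lerP (a * l t * m t) delta) => hd.
- have -> : nn (fld Z t \- Bxi) =
    nn (fun w => (p t)^-1 * (BR S r (p t *: Z t) \- Bxi) w + ((p t)^-1 - 1) * Bxi w).
    by apply: eq_neg_norm => v _; rewrite /= /drift; ring.
  have hB := HnegB hip hb hev hal (BRneg (p t *: Z t)) hBxi.
  have hC := HnegZl hip hb hev hal ((p t)^-1 - 1) hBxi.
  apply: le_trans (neg_norm_comb2 hip hb hev hal (p t)^-1 hB hC) _.
  have e2 : nn (fun v => ((p t)^-1 - 1) * Bxi v) <= s * m t * (D * a ^+ 2).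
    apply: le_trans (neg_normZl hip hb hev hal _ hBxi) _.
    apply: ler_pM => //; [exact: neg_norm_ge0|exact: hpV].
  have u1 : `|p t *: Z t - xi| <= K1 * a ^+ 2 * (l t ^+ 2 * m t ^+ 2) + s * m t * a.
    have -> : p t *: Z t - xi = p t *: (Z t - xi) + (p t - 1) *: xi.
      by rewrite scalerBr scalerBl scale1r addrA subrK.
    apply: le_trans (ler_normD _ _) _; rewrite !normrZ gtr0_norm //.
    apply: lerD; last by rewrite ler_wpM2r //; exact: hp.
    apply: (@le_trans _ _ (2 * m t * (Jm * ((C1 + C2 * delta) * a ^+ 2 * (l t ^+ 2 * m t))))).
      apply: ler_pM => //; [exact: ltW|exact: p_le|].
      apply: le_trans (Z_xi t0) _; rewrite ler_wpM2l //.
      have -> : C2 * a ^+ 3 * (l t ^+ 3 * m t ^+ 2) =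
        C2 * a ^+ 2 * (l t ^+ 2 * m t) * (a * l t * m t) by ring.
      have -> : (C1 + C2 * delta) * a ^+ 2 * (l t ^+ 2 * m t) =
        C1 * a ^+ 2 * (l t ^+ 2 * m t) + C2 * a ^+ 2 * (l t ^+ 2 * m t) * delta by ring.
      rewrite lerD2l ler_wpM2l //; by nonneg.
    by rewrite le_eqVlt; apply/orP; left; apply/eqP; rewrite /K1; ring.
  have u2 : `|p t *: Z t| + a <= K2 * (a * l t * m t).
    rewrite normrZ gtr0_norm //.
    have -> : K2 * (a * l t * m t) =
       2 * m t * (2 * (1 + A * delta ^+ 2) * (a * l t)) + a * (l t * m t) by rewrite /K2; ring.
    apply: lerD; last by rewrite ler_peMr // mulr_ege1.
    apply: ler_pM => //; [exact: ltW|exact: p_le|].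
    exact: le_trans (ZW t0) (good_W hd).
  have e1 : `|(p t)^-1| * nn (BR S r (p t *: Z t) \- Bxi) <=
    2 * m t * (D * ((K1 * a ^+ 2 * (l t ^+ 2 * m t ^+ 2) + s * m t * a) * (K2 * (a * l t * m t)))).
    rewrite gtr0_norm ?invr_gt0 //; apply: ler_pM; rewrite ?neg_norm_ge0 ?pV_le //.
      by rewrite invr_ge0 ltW.
    apply: le_trans (BRxi _) _; rewrite ler_wpM2l // ler_pM // addr_ge0 //.
  apply: le_trans (lerD e1 e2) _.
  have -> : 2 * m t * (D * ((K1 * a ^+ 2 * (l t ^+ 2 * m t ^+ 2) + s * m t * a) * (K2 * (a * l t * m t))))
    + s * m t * (D * a ^+ 2) = 2 * D * K2 * K1 * a ^+ 3 * (l t ^+ 3 * m t ^+ 4)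
    + 2 * D * K2 * (s * a ^+ 2) * (l t * m t ^+ 3) + D * (s * a ^+ 2) * (1 * m t) by ring.
  apply: (@le_trans _ _ (2 * D * K2 * K1 * a ^+ 3 * (l t ^+ 3 * m t ^+ 4)
    + 2 * D * K2 * (s * a ^+ 2) * (l t ^+ 3 * m t ^+ 4) + D * (s * a ^+ 2) * (l t ^+ 3 * m t ^+ 4))).
    apply: lerD; [apply: lerD => //|]; rewrite ler_wpM2l ?mulr_ge0 //.
      by rewrite ler_pM // ?(ltW lt0) ?exprn_ge0 ?(ltW mt0) // ler_weXn2l.
    rewrite ler_pM ?(ltW mt0) //; first by rewrite exprn_ege1.
    by rewrite -[leLHS]expr1 ler_weXn2l.
  rewrite -(mulrDl (2 * D * K2 * K1 * a ^+ 3)) -mulrDl ler_wpM2r // /Cf.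
  set X := a ^+ 3 in a3 *; set Y := s * a ^+ 2 in sa2 *.
  set P1 := 2 * D * K2 * K1 in D1 *; set P2 := 2 * D * K2 in D2 *.
  rewrite -subr_ge0.
  rewrite [Q in 0 <= Q](_ : _ =
    P1 * Y + P2 * X + D * X + C2 * X + C2 * Y + D / delta * X + D / delta * Y); last by ring.
  by nonneg.
have e1 := nn_bad (ZW t0) hd.
have h0 : nn (fld Z t \- Bxi) <= nn (fld Z t) + nn Bxi.
  have := neg_norm_comb2 hip hb hev hal (-1) hBxi (Hneg_drift hip hb hev hal BRneg p Z t).
  rewrite normrN1 mul1r [leRHS]addrC; congr (_ <= _); apply: eq_neg_norm => v _ /=.
  by rewrite mulN1r addrC.
apply: le_trans h0 _; apply: le_trans (lerD e1 nnBxi) _.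
apply: (@le_trans _ _ (C2 * a ^+ 3 * (l t ^+ 3 * m t ^+ 4) + D / delta * a ^+ 3 * (l t ^+ 3 * m t ^+ 4))).
  apply: lerD.
    apply: ler_pM.
    - by nonneg.
    - by nonneg.
    - by rewrite ler_wpM2r // /C2 ler_wpM2r ?addr_ge0 // ler_pM2l.
    - by rewrite ler_wpM2l ?exprn_ge0 ?(ltW lt0) // ler_weXn2l.
  have -> : D / delta * a ^+ 3 * (l t ^+ 3 * m t ^+ 4) =
    D * (a ^+ 2 * (a * (l t ^+ 3 * m t ^+ 4) / delta)) by field; rewrite gt_eqF.
  rewrite ler_wpM2l // ler_peMr ?sqr_ge0 // ler_pdivlMr // mul1r.
  apply: le_trans (ltW hd) _; rewrite -mulrA ler_wpM2l // ler_pM ?(ltW lt0) ?(ltW mt0) //.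
  by rewrite -[leLHS]expr1 ler_weXn2l.
rewrite -mulrDl ler_wpM2r // -mulrDl.
apply: ler_pM; rewrite ?addr_ge0 //; last by rewrite lerDl.
rewrite -subr_ge0 [Q in 0 <= Q](_ : _ = 2 * D * K2 * K1 + 2 * D * K2 + D).
  by nonneg.
by rewrite /Cf; ring.
Qed.

(** Only stable integrals at time 0 are compared, so the exponent kappa + 2 mu requires just the
    kernel bound [kernm], and its exponential weight is 1. *)
Lemma apriori : `|stable_int S (fld Z) 0 - stable_int S (fun=> Bxi) 0| <=
  apriori_const D delta Jm Lm q * Jm * (a ^+ 3 + s * a ^+ 2).
Proof.
rewrite -[apriori_const _ _ _ _ _]/Cf.
have [c fZ'] := field_drift hip hb hev hal L0 BRneg BR0 BRlip cp p0 hk aZ.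
have fB : field S lambda (fun=> Bxi) (D * a ^+ 2) kappa by exact: field_cst.
have Cf0 : 0 <= Cf.
  by rewrite /Cf; nonneg.
have := @stable_diff _ _ _ _ _ _ 0 (Cf * (a ^+ 3 + s * a ^+ 2)) (kappa + 2 * mu) fZ' fB kl.
rewrite mulr0 expR0 mul1r => /(_ _)/le_trans; apply.
  by move=> t t0; rewrite -lm4; apply: nn_final; exact: ltW.
have -> : Cf * Jm * (a ^+ 3 + s * a ^+ 2) = Cf * (a ^+ 3 + s * a ^+ 2) * Jm by ring.
by rewrite ler_wpM2l //; nonneg.
Qed.

End Apriori.

(** * Removing the noise *)

Section Exponential.
Context {R : realType}.
Local Notation mu := (@lebesgue_measure R).

Lemma integral_expN (c : R) : 0 < c ->
  mu.-integrable `[0, +oo[ (fun s => (expR (- c * s))%:E) /\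
  \int[mu]_(s in `[0, +oo[) expR (- c * s) = c^-1.
Proof.
move=> c0; have h1 := @integral_exponential_pdf R c c0.
have h2 := @integrable_exponential_pdf R c c0.
have E : (EFin \o exponential_pdf c) =
   ((fun s : R => (c * expR (- c * s))%:E) \_ `[0, +oo[).
  by apply/funext => x; rewrite /= /exponential_pdf !patchE; case: ifP.
have i1 : mu.-integrable `[0, +oo[ (fun s => (c * expR (- c * s))%:E).
  by move: h2; rewrite E -integrable_mkcond.
have i2 : mu.-integrable `[0, +oo[ (fun s => (expR (- c * s))%:E).
  have := integrableZl_EFin (measurable_itv _) c^-1 i1.
  by congr (_.-integrable _ _); apply/funext => s; rewrite mulKf ?gt_eqF.
split=> //.
have : \int[mu]_(s in `[0, +oo[) (c * expR (- c * s)) = 1.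
  move: h1; rewrite /Rintegral.
  rewrite (_ : (\int[mu]_x (exponential_pdf c x)%:E)%E =
    (\int[mu]_(x in `[0%R, +oo[) (c * expR (- c * x))%:E)%E).
    by move=> ->.
  rewrite [RHS]integral_mkcond; apply: eq_integral => x _.
  by have /(congr1 (fun f => f x)) := E.
rewrite RintegralZl //; move=> /(congr1 (fun x => c^-1 * x)).
by rewrite mulKf ?gt_eqF // mulr1.
Qed.

Lemma integral_expN_oo (c : R) : 0 < c ->
  \int[mu]_(s in `]0, +oo[) expR (- c * s) = c^-1.
Proof.
move=> c0; have [i <-] := integral_expN c0.
rewrite Rintegral_itv_obnd_cbnd //.
by apply: integrableS i => //; by apply: subset_itvr; rewrite bnd_simp.
Qed.

Lemma integral_expNy :
  mu.-integrable `]-oo, 0] (fun s : R => (expR s)%:E) /\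
  \int[mu]_(s in `]-oo, 0]) expR s = 1.
Proof.
have [i e] := integral_expN (@ltr01 R).
have a1 : `|-1 : R| = 1 by rewrite normrN1.
have E : affine (-1) 0 @^-1` `[0, +oo[ = `]-oo, (0 : R)]%classic.
  by apply/seteqP; split=> x /=; rewrite !in_itv /= /affine mulN1r addr0 ?andbT oppr_ge0.
have F : (fun s : R => expR (- 1 * s)) \o affine (-1) 0 = expR.
  by apply/funext => x; rewrite /= /affine mulN1r addr0 mulN1r opprK.
split.
  have := integrable_isometry 0 a1 (measurable_itv _) i.
  by rewrite E (_ : _ \o _ = (fun s : R => (expR s)%:E)) // -[in RHS]F.
have mi : measurable_fun `[(0:R), +oo[%classic (fun s : R => expR (- 1 * s)).
  by case/integrableP : i => /measurable_EFinP.
rewrite -[RHS]invr1 -e (Rintegral_isometry 0 a1 (measurable_itv _) mi).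
rewrite E; apply: eq_Rintegral => x _.
by have /(congr1 (fun f => f x)) := F.
Qed.

End Exponential.

(** * The stationary Ornstein-Uhlenbeck process along a single path *)

Section OU.
Context {R : realType} (sigma : R) (w : wpath R).
Local Notation mu := (@lebesgue_measure R).
Hypothesis iw : forall t, mu.-integrable `]-oo, 0] (fun s => (expR s * wshift t w s)%:E).
Local Notation z := (z sigma w).

(** The function y = sigma e^{-t} G(t) is differentiable although the path is not, because [w]
    enters through an integral. The fundamental theorem of calculus then evaluates every integral of
    z path by path. *)
Let G t := \int[mu]_(s in `]-oo, t]) (expR s * w s).

Let cw : continuous (fun s => expR s * w s).
Proof.
by move=> s; apply: cvgM; [exact: continuous_expR|exact: wfun_continuous].
Qed.

Let shiftE t (s : R) : affine 1 t s = s + t. Proof. by rewrite /affine mul1r. Qed.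

Let iG0 t : mu.-integrable `]-oo, 0] (fun s => (expR s * w (s + t))%:E).
Proof.
have [ie _] := @integral_expNy R.
have := integrableD_EFin (measurable_itv _) (iw t) (integrableZl_EFin (measurable_itv _) (w t) ie).
congr (_.-integrable _ _); apply/funext => s /=; congr EFin; ring.
Qed.

Let iG t : mu.-integrable `]-oo, t] (fun s => (expR s * w s)%:E) /\
  G t = expR t * \int[mu]_(s in `]-oo, 0]) (expR s * w (s + t)).
Proof.
have E : affine 1 t @^-1` `]-oo, t] = `]-oo, (0 : R)]%classic.
  by apply/seteqP; split=> x /=; rewrite !in_itv /= shiftE -lerBrDr subrr.
have E' : affine 1 (- t) @^-1` `]-oo, 0] = `]-oo, t]%classic.
  by apply/seteqP; split=> x /=; rewrite !in_itv /= shiftE subr_le0.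
have a1 : `|1 : R| = 1 by rewrite normr1.
have i : mu.-integrable `]-oo, t] (fun s => (expR s * w s)%:E).
  have := integrable_isometry (- t) a1 (measurable_itv _)
    (integrableZl_EFin (measurable_itv _) (expR t) (iG0 t)).
  rewrite E'; congr (_.-integrable _ _); apply/funext => s /=; congr EFin.
  by rewrite shiftE mulrA -expRD subrK addrC subrK.
split=> //.
have mi : measurable_fun `]-oo, t]%classic (fun s => expR s * w s).
  by case/integrableP : i => /measurable_EFinP.
rewrite /G (Rintegral_isometry t a1 (measurable_itv _) mi).
rewrite E -RintegralZl //; last exact: iG0.
by apply: eq_Rintegral => s _; rewrite shiftE expRD; ring.
Qed.

Let zE t : z t = - sigma * (expR (- t) * G t) + sigma * w t.
Proof.
have [_ ->] := iG t; have [ie e1] := @integral_expNy R.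
rewrite mulrA -expRD addNr expR0 mul1r /Defs.z /z0.
rewrite [X in - sigma * X](_ : _ = \int[mu]_(s in `]-oo, 0]) (expR s * w (s + t) - w t * expR s)).
  rewrite RintegralB //; [|exact: iG0|exact: integrableZl_EFin].
  by rewrite RintegralZl // e1; ring.
by apply: eq_Rintegral => s _ /=; ring.
Qed.

Let dG (t : R) : is_derive t (1 : R) G (expR t * w t).
Proof.
have tu : t < t + 1 by rewrite ltrDl.
have [i _] := iG (t + 1).
have [|d e] := @continuous_FTC1 R (fun s => expR s * w s) -oo%O t (t + 1) tu i _ (@cw t).
  by rewrite ?ltNyr ?bnd_simp.
by apply: DeriveDef; [exact: d|rewrite -derive1E e].
Qed.

Let dy (t : R) : is_derive t (1 : R) (fun t => sigma * (expR (- t) * G t)) (z t).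
Proof.
have dGt := dG t. apply: is_derive_eq.  rewrite zE /GRing.scale /=.
have e : expR (- t) * expR t = 1 by rewrite -expRD addNr expR0.
have -> : expR (- t) * (expR t * w t) = w t by rewrite mulrA e mul1r.
ring.
Qed.

Let cyG (t : R) : {for t, continuous (fun t => sigma * (expR (- t) * G t))}.
Proof. by apply: differentiable_continuous; apply/derivable1_diffP; have [] := dy t. Qed.

Let zyE t : z t - sigma * w t = - (sigma * (expR (- t) * G t)).
Proof. by rewrite zE; ring. Qed.

Lemma continuous_z : continuous z.
Proof.
move=> t; rewrite (_ : z = fun t => - (sigma * (expR (- t) * G t)) + sigma * w t); last first.
  by apply/funext => s; rewrite zE mulNr.
apply: (@cvgD _ R^o); first by apply: (@cvgN _ R^o); exact: cyG.
by apply: cvgM; [exact: cvg_cst|exact: wfun_continuous].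
Qed.

Lemma int_ab_z a b : int_ab a b z = (z a - sigma * w a) - (z b - sigma * w b).
Proof.
have h c d : c <= d -> \int[mu]_(s in `[c, d]) z s = (z c - sigma * w c) - (z d - sigma * w d).
  rewrite le_eqVlt => /predU1P[->|cd]; first by rewrite set_itv1 Rintegral_set1 subrr.
  rewrite /Rintegral (@continuous_FTC2 R _ (fun t => sigma * (expR (- t) * G t))) //=.
  - by rewrite !zyE opprK addrC.
  - exact: continuous_subspaceT continuous_z.
  - split.
    + by move=> s _; have [] := dy s.
    + apply: cvg_at_right_filter; exact: cyG.
    + apply: cvg_at_left_filter; exact: cyG.
  - by move=> s _; rewrite derive1E; have [_ ->] := dy s.
rewrite /int_ab; case: ifPn => [/h //|]; rewrite -ltNge => /ltW/h ->; ring.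
Qed.

Lemma z_at0 : z 0 = z0 sigma w.
Proof.
rewrite /Defs.z /z0; congr (_ * _); apply: eq_Rintegral => s _ /=.
by rewrite addr0 wfun0 subr0.
Qed.

End OU.

Lemma within_continuous_min0 {R : realType} {V : topologicalType} (v : R -> V) :
  {within `]-oo, (0 : R)], continuous v} -> continuous (fun t : R => v (Num.min t 0)).
Proof.
move=> /subspace_continuousP cv t.
have m0 : `]-oo, (0 : R)]%classic (Num.min t 0) by rewrite /= in_itv /= ge_min lexx orbT.
apply: cvg_comp (cv _ m0) => P hP.
have h : \forall s \near t, `]-oo, (0 : R)]%classic (Num.min s 0) -> P (Num.min s 0).
  exact: (@continuous_min0 R t _ hP).
suff : \forall s \near t, P (Num.min s 0) by [].
apply: filterS h => s; apply.
by rewrite /= in_itv /= ge_min lexx orbT.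
Qed.

(** * Conjugation of the Lyapunov-Perron equation *)

Section Transform.
Context {R : realType} {H : completeNormedModType R} (S : model H).
Hypotheses (hip : inner_product S) (hb : orthonormal_basis S).
Hypotheses (hev : forall k, 0 <= ev S k) (hal : 0 < alpha S < 1).
Local Notation "<< u , v >>" := (ip S u v) (format "<< u ,  v >>").
Local Notation e := (eb S).
Local Notation N := (dimc S).
Local Notation nn := (neg_norm S).
Local Notation mu := (@lebesgue_measure R).
Context (lambda M Ca : R).
Hypotheses (M0 : 0 <= M) (Ca0 : 0 <= Ca).
Hypothesis hM : forall (t : R) (f : H -> R), 0 < t -> Hneg S f ->
     `|semigroup S t (Ps S f)| <=
       M * expR (- lambda * t) * t `^ (- alpha S) * nn (Ps S f).
Hypothesis hCa : forall f : H -> R, Hneg S f ->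
     `|Pc S f| <= Ca * nn (ip S (Pc S f)).
Context (r L : R) (L0 : 0 <= L).
Hypothesis BRneg : forall u, Hneg S (BR S r u).
Hypothesis BR0 : forall w, Hpos S w -> BR S r 0 w = 0.
Hypothesis BRlip : forall u v, nn (BR S r u \- BR S r v) <= L * `|u - v|.
Context (eta nu sigma : R) (w : wpath R).
Hypothesis iw : forall t, mu.-integrable `]-oo, 0] (fun s => (expR s * wshift t w s)%:E).
Local Notation zz := (z sigma w).
Context (xi : H).
Let kappa := eta + nu.
Hypothesis hk : 0 < kappa < lambda.

Definition scaling (t : R) : R := expR (nu * Num.min t 0 + sigma * w (Num.min t 0)).
Local Notation p := scaling.
(* [c t] is [e^{-z(t)} p(t)]: an equation [v = c Y] with [Y] admissible has no noise left in the
   linear part, and [p(0) = 1] removes the factor [e^{z(0)}] of the conclusion. *)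
Let c (t : R) : R := expR (nu * t + sigma * w t - zz t).

Let T := lp_map S r p xi.
Local Notation fld := (drift S r p).
Local Notation adm := (adm kappa).

Lemma scaling_gt0 t : 0 < p t. Proof. exact: expR_gt0. Qed.

Lemma continuous_scaling : continuous p.
Proof.
move=> t; apply: continuous_comp; last exact: continuous_expR.
apply: (@cvgD _ R^o).
  by apply: cvgM; [exact: cvg_cst|exact: continuous_min0].
apply: cvgM; first exact: cvg_cst.
by apply: (continuous_comp (@continuous_min0 R t)); exact: wfun_continuous.
Qed.

Let c_gt0 t : 0 < c t. Proof. exact: expR_gt0. Qed.

Let continuous_c : continuous c.
Proof.
move=> t; apply: continuous_comp; last exact: continuous_expR.
apply: (@cvgB _ R^o); last exact: continuous_z.
apply: (@cvgD _ R^o).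
  by apply: cvgM; [exact: cvg_cst|exact: cvg_id].
by apply: cvgM; [exact: cvg_cst|exact: wfun_continuous].
Qed.

Let pE t : t <= 0 -> p t = expR (nu * t + sigma * w t).
Proof. by move=> t0; rewrite /p (min_idPl t0). Qed.

Lemma center_int_at0 f b d : field S lambda f b d -> center_int S f 0 = 0.
Proof.
move=> hf; have := field_center hip hb hev hal Ca0 hCa hf (lexx 0).
move=> /(is_bochner_norm hip (measurable_itv _)).
by rewrite set_itv1 Rintegral_set1 normr_le0 => /eqP.
Qed.

(** By [int_ab_z] the noise factors telescope to c(t) / p(tau). The factor c(t) leaves the
    integrals, and 1/p(tau) is the one in [drift]. *)
Lemma LP_transform Y v t : adm Y -> (forall s, s <= 0 -> v s = c s *: Y s) -> t <= 0 ->
  LP S nu sigma r w v (expR (- z0 sigma w) *: xi) t = c t *: T Y t.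
Proof.
move=> aY vE t0.
have [d fY] := field_drift hip hb hev hal L0 BRneg BR0 BRlip continuous_scaling scaling_gt0 hk aY.
have zv s : s <= 0 -> expR (zz s) *: v s = p s *: Y s.
  move=> s0; rewrite vE // scalerA -expRD pE //; congr (expR _ *: _); ring.
have coef s : s <= 0 -> expR (nu * (t - s) + int_ab s t zz) * expR (- zz s) = c t * (p s)^-1.
  move=> s0; rewrite pE // -expRN -!expRD (int_ab_z sigma iw); congr expR; ring.
have i1 : expR (nu * t + int_ab 0 t zz) *: (expR (- z0 sigma w) *: xi) = c t *: xi.
  rewrite scalerA -expRD (int_ab_z sigma iw) z_at0 wfun0; congr (expR _ *: _); ring.
have HfY s : Hneg S (BR S r (p s *: Y s)) by [].
have hc := field_center hip hb hev hal Ca0 hCa fY t0.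
have i2 : bochner S `[t, 0] (fun tau =>
      (expR (nu * (t - tau) + int_ab tau t zz) * expR (- zz tau)) *:
        Pc S (BR S r (expR (zz tau) *: v tau))) = c t *: center_int S (fld Y) t.
  apply: (bochnerE hb); have := is_bochnerZ hip hb (measurable_itv _) (c t) hc.
  apply: eq_is_bochner; first exact: measurable_itv.
  move=> s /=; rewrite in_itv /= => /andP[_ s0].
  by rewrite coef // zv // -scalerA -PcZ.
have i2' : bochner_ab S 0 t (fun tau =>
      (expR (nu * (t - tau) + int_ab tau t zz) * expR (- zz tau)) *:
        Pc S (BR S r (expR (zz tau) *: v tau))) = - (c t *: center_int S (fld Y) t).
  (* [bochner_ab] takes the integral without sign when [0 <= t]; here this happens only at [t = 0],
     where the integral vanishes. *)
  rewrite /bochner_ab; case: ifPn => [t0'|_]; last by rewrite i2.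
  have tE : t = 0 by apply/eqP; rewrite eq_le t0.
  rewrite -[X in bochner S `[X, _]]tE -[X in bochner S `[_, X]](_ : 0 = t) // i2.
  by rewrite tE (center_int_at0 fY) scaler0 oppr0.
have hs := field_stable hip hb hev hal M0 hM t fY.
have i3 : bochner S `]-oo, t[ (fun tau =>
      (expR (nu * (t - tau) + int_ab tau t zz) * expR (- zz tau)) *:
        semigroup S (t - tau) (Ps S (BR S r (expR (zz tau) *: v tau)))) =
   c t *: stable_int S (fld Y) t.
  apply: (bochnerE hb); have a1 : `|-1 : R| = 1 by rewrite normrN1.
  apply: (@is_bochner_isometry _ _ S (-1) t) => //.
  have aE s : affine (-1) t s = t - s by rewrite /affine mulN1r addrC.
  have -> : affine (-1) t @^-1` `]-oo, t[ = `](0 : R), +oo[%classic.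
    by apply/seteqP; split=> s /=; rewrite !in_itv /= aE andbT gtrBl.
  have := is_bochnerZ hip hb (measurable_itv _) (c t) hs.
  apply: eq_is_bochner; first exact: measurable_itv.
  move=> s /=; rewrite in_itv /= andbT aE => s0.
  have ts : t - s <= 0 by rewrite subr_le0 (le_trans t0) // ltW.
  rewrite coef // zv // -scalerA subKr.
  by rewrite -semigroup_PsZ.
rewrite /LP i1 i2' i3 /T /lp_map (min_idPl t0) /Phi.
by rewrite -scalerBr -scalerDr.
Qed.

(** Up to the constant e^{-z(0)}, the weighted norm of [Ceta] for v = c Y is the supremum of
    e^{kappa t} |Y(t)| over t <= 0, so the substitution matches [Ceta] with [adm]. *)
Let cV t : t <= 0 ->
  expR (eta * t - int_ab 0 t zz) = expR (- z0 sigma w) * (expR (kappa * t) * (c t)^-1).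
Proof.
move=> t0; rewrite (int_ab_z sigma iw) z_at0 wfun0 /c -expRN -!expRD /kappa.
congr expR; ring.
Qed.

Lemma LP_fixpoint_transform v :
  LP_fixpoint S eta nu sigma r w v (expR (- z0 sigma w) *: xi) ->
  let Y t := (c (Num.min t 0))^-1 *: v (Num.min t 0) in
  adm Y /\ forall t, t <= 0 -> T Y t = Y t.
Proof.
move=> [[cv [C hC]] fv] Y.
have vE s : s <= 0 -> v s = c s *: Y s.
  by move=> s0; rewrite /Y (min_idPl s0) scalerA divff ?scale1r // gt_eqF.
have C0 : 0 <= C by apply: le_trans (hC 0 (lexx _)); rewrite mulr_ge0 ?expR_ge0.
have aY : adm Y.
  split.
    move=> t; apply: cvgZ; last exact: (within_continuous_min0 cv).
    apply: cvgV; first by rewrite gt_eqF.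
    by apply: (continuous_comp (@continuous_min0 R t)); exact: continuous_c.
  exists (C * expR (z0 sigma w)); first by rewrite mulr_ge0 ?expR_ge0.
  move=> t; rewrite /Y; set m := Num.min t 0.
  have m0 : m <= 0 by rewrite ge_min lexx orbT.
  apply: (@le_trans _ _ (C * expR (z0 sigma w) * expR (- kappa * m))); last first.
    by rewrite ler_wpM2l ?(expR_min_le hk) // mulr_ge0 ?expR_ge0.
  rewrite normrZ gtr0_norm ?invr_gt0 //.
  have := hC m m0; rewrite cV // => h.
  have E : expR (z0 sigma w) * expR (- kappa * m) * (expR (- z0 sigma w) * (expR (kappa * m) * (c m)^-1)) = (c m)^-1.
    rewrite -!mulrA [expR (- kappa * m) * _]mulrCA !mulrA -expRD subrr expR0 mul1r.
    by rewrite -expRD mulNr addNr expR0 mul1r.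
  apply: (@le_trans _ _ (expR (- z0 sigma w) * (expR (kappa * m) * (c m)^-1) * `|v m| *
    (expR (z0 sigma w) * expR (- kappa * m)))).
    by rewrite -[X in X * _ <= _]E le_eqVlt; apply/orP; left; apply/eqP; ring.
  by rewrite -[leRHS]mulrA ler_wpM2r // mulr_ge0 ?expR_ge0.
split=> // t t0.
have cn : c t != 0 by rewrite gt_eqF.
by apply: (scalerI cn); rewrite -(LP_transform aY vE t0) fv // vE.
Qed.

Lemma transform_LP_fixpoint Y : adm Y -> (forall t, T Y t = Y t) ->
  LP_fixpoint S eta nu sigma r w (fun t => c t *: Y t) (expR (- z0 sigma w) *: xi).
Proof.
move=> aY fY; split; last by move=> t t0; rewrite (LP_transform aY) // fY.
have [cY [C C0 hC]] := aY; split.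
  by apply: continuous_subspaceT => t; apply: cvgZ; [exact: continuous_c|exact: cY].
exists (expR (- z0 sigma w) * C) => t t0; rewrite cV // normrZ gtr0_norm // -!mulrA.
rewrite ler_wpM2l ?expR_ge0 // mulKf ?gt_eqF //.
have := hC t; rewrite ler0_norm // mulrN => h.
apply: le_trans (ler_wpM2l (expR_ge0 _) h) _.
by rewrite mulrCA -expRD subrr expR0 mulr1.
Qed.

Hypothesis xiHc : Hc S xi.

Lemma PsH_fixed Z : adm Z -> (forall t, t <= 0 -> T Z t = Z t) ->
  PsH S (Z 0) = stable_int S (fld Z) 0.
Proof.
move=> aZ fZ.
have [d hf] := field_drift hip hb hev hal L0 BRneg BR0 BRlip continuous_scaling scaling_gt0 hk aZ.
have -> : Z 0 = xi + stable_int S (fld Z) 0.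
  rewrite -(fZ 0 (lexx 0)) /T /lp_map (min_idPl (lexx 0)) /Phi.
  by rewrite (center_int_at0 hf) subr0.
have [_ _ hx] := field_stable hip hb hev hal M0 hM 0 hf.
apply: (ip_ext hb) => k; rewrite /PsH ipBl // ip_Pc // ipDl //.
have xik : (k < N)%N = false -> <<xi, e k>> = 0.
  have [cc ->] := xiHc => kN; rewrite ip_suml // big1 // => i _.
  rewrite ipZl // ebE // (_ : (i == k :> nat) = false) ?mulr0 //.
  by apply/eqP => ik; move: kN; rewrite -ik ltn_ord.
case: ifPn => kN; last by rewrite subr0 xik ?add0r //; exact: negbTE.
rewrite subrr hx (@eq_Rintegral _ _ _ _ _ (fun=> 0)) ?Rintegral_cst ?mul0r //.
move=> s; rewrite inE /= in_itv /= andbT => s0.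
by rewrite ip_semigroup_Ps // ?kN //; exact: Hneg_drift.
Qed.

(** [vstar] is chosen by [get], so it is a fixed point only once one is known to exist; the
    existential Z is the transform of the one selected. At time 0 the factor 1/c(0) = e^{z(0)} is
    the prefactor of the conclusion. *)
Lemma h_transform : (exists2 Y, adm Y & forall t, T Y t = Y t) ->
  exists Z, [/\ adm Z, forall t, t <= 0 -> T Z t = Z t &
    expR (z0 sigma w) *: h S eta nu sigma r w (expR (- z0 sigma w) *: xi) =
    stable_int S (fld Z) 0].
Proof.
case=> Y aY fY; have hv : LP_fixpoint S eta nu sigma r w
    (vstar S eta nu sigma r w (expR (- z0 sigma w) *: xi)) (expR (- z0 sigma w) *: xi).
  rewrite /vstar; case: xgetP => [y _ //|/(_ (fun t => c t *: Y t))]; case.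
  exact: transform_LP_fixpoint.
have [aZ fZ] := LP_fixpoint_transform hv.
exists (fun t => (c (Num.min t 0))^-1 *: vstar S eta nu sigma r w (expR (- z0 sigma w) *: xi) (Num.min t 0)).
split=> //; rewrite -(PsH_fixed aZ fZ) /h /= min_l //.
set V := vstar _ _ _ _ _ _ _ _.
have -> : (c 0)^-1 = expR (z0 sigma w).
  by rewrite /c -expRN mulr0 wfun0 mulr0 z_at0 addr0 add0r opprK.
apply: (ip_ext hb) => k; rewrite ipZl // /PsH !ipBl // !ip_Pc // ipZl //.
by case: ifP; rewrite ?subrr ?mulr0 ?subr0.
Qed.

(** Mode by mode the integral of e^{-lambda_k s} over s > 0 is 1/lambda_k, and [Ps] removes the
    modes of the kernel. *)
Lemma stable_int_cst B b d : (0 < N)%N -> (forall k, (N <= k)%N -> 0 < ev S k) ->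
  field S lambda (fun=> B) b d -> stable_int S (fun=> B) 0 = Ls_inv S (Ps S B).
Proof.
move=> N0 evN hf; have [_ _ hx] := field_stable hip hb hev hal M0 hM 0 hf.
have [[/(_ 0) hB _] _ _ _] := hf.
rewrite /Ls_inv; apply/esym/cvg_lim => //.
rewrite (_ : (fun k => _) = fun k => <<stable_int S (fun=> B) 0, e k>> *: e k).
  exact: basis_cvg.
apply/esym/funext => k.
rewrite Ps_eb // hx; case: ifPn => kN.
  rewrite (@eq_Rintegral _ _ _ _ _ (fun=> 0)) ?Rintegral_cst ?mul0r ?scale0r //.
  move=> s; rewrite inE /= in_itv /= andbT => s0.
  by rewrite ip_semigroup_Ps // kN.
have evk : 0 < ev S k by apply: evN; rewrite leqNgt.
rewrite [X in X *: _](_ : _ = \int[mu]_(s in `]0, +oo[) (B (e k) * expR (- ev S k * s))); last first.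
  apply: eq_Rintegral => s; rewrite inE /= in_itv /= andbT => s0.
  by rewrite ip_semigroup_Ps // (negPf kN) mulrC.
rewrite RintegralZl //; last first.
  have [i _] := integral_expN evk.
  by apply: integrableS i => //; apply: subset_itvr; rewrite bnd_simp.
by rewrite integral_expN_oo // (negPf kN) mulrC.
Qed.

End Transform.

(** * Growth of Wiener paths *)

Section Chaining.
Context {R : realType}.

(** Refining the grid by 4 costs at most three steps of size b (3/4)^m, and the geometric sum of 3 b
    (3/4)^m is 12 b. A Brownian increment over 4^{-m} has deviation 2^{-m}, so the allowance exceeds
    it by the growing factor (3/2)^m. *)
Lemma chaining_grid (f : R -> R) (b : R) : 0 <= b ->
  (forall m j : nat, (j < 4 ^ m)%N ->
     `|f (j%:R / 4 ^+ m) - f (j.+1%:R / 4 ^+ m)| <= b * (3 / 4) ^+ m) ->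
  forall m j : nat, (j <= 4 ^ m)%N ->
  `|f 0 - f (j%:R / 4 ^+ m)| <= 12 * b * (1 - (3 / 4) ^+ m.+1).
Proof.
move=> b0 hf; elim=> [|m ih] j jm.
  case: j jm => [|[|//]] _; first by rewrite mul0r subrr normr0; lra.
  by have := hf 0%N 0%N isT; rewrite !expr0 !divr1 mulr1 mulr0n expr1; lra.
set i := (j %/ 4)%N; set d := (3 / 4 : R) ^+ m.+1.
have d0 : 0 <= b * d by rewrite mulr_ge0 // exprn_ge0 // divr_ge0.
have im : (i <= 4 ^ m)%N by rewrite -(@leq_pmul2r 4) // -expnSr (leq_trans _ jm) // leq_trunc_div.
have step k : (i * 4 + k <= 4 ^ m.+1)%N ->
  `|f (i%:R / 4 ^+ m) - f ((i * 4 + k)%:R / 4 ^+ m.+1)| <= k%:R * (b * d).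
  elim: k => [|k ihk] hk.
    have -> : (i * 4 + 0)%:R / 4 ^+ m.+1 = i%:R / 4 ^+ m :> R.
      by rewrite addn0 natrM exprSr; field; rewrite expf_neq0.
    by rewrite subrr normr0 mul0r.
  rewrite addnS in hk *; have h1 := ihk (ltnW hk); have h2 := hf m.+1 _ hk.
  rewrite -(subrKA (f ((i * 4 + k)%:R / 4 ^+ m.+1))).
  have -> : k.+1%:R * (b * d) = k%:R * (b * d) + b * d by rewrite -[k.+1%:R]natr1 mulrDl mul1r.
  apply: le_trans (ler_normD _ _) _.
  by rewrite lerD.
have jE : (i * 4 + j %% 4)%N = j by rewrite -divn_eq.
have := step (j %% 4)%N; rewrite jE => /(_ jm) h.
have k3 : (j %% 4)%:R * (b * d) <= 3 * (b * d).
  by rewrite ler_wpM2r // ler_nat -ltnS ltn_mod.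
have h0 := ih i im.
rewrite -(subrKA (f (i%:R / 4 ^+ m))).
apply: le_trans (ler_normD _ _) _.
apply: le_trans (lerD h0 (le_trans h k3)) _.
rewrite -/d [(3 / 4) ^+ m.+2]exprS -/d; lra.
Qed.

Lemma chaining_unit (f : R -> R) (b x : R) : 0 <= b -> continuous f ->
  (forall m j : nat, (j < 4 ^ m)%N ->
     `|f (j%:R / 4 ^+ m) - f (j.+1%:R / 4 ^+ m)| <= b * (3 / 4) ^+ m) ->
  0 <= x <= 1 -> `|f 0 - f x| <= 12 * b.
Proof.
move=> b0 cf hf /andP[x0 x1]; apply/ler_addgt0Pr => d d0.
have /nbhs_ballP[e /= e0 he] : \forall y \near x, `|f x - f y| < d.
  by have := cf x => /(@cvgrPdist_lt _ R^o); apply.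
have : (1 / 4 : R) ^+ n @[n --> \oo] --> (0 : R).
  by apply: cvg_expr; rewrite ger0_norm ?divr_ge0 // ltr_pdivrMr // mul1r ltr1n.
move=> /cvgrPdist_lt/(_ _ e0)[m _ /(_ m (leqnn m))]; rewrite /= sub0r normrN.
rewrite ger0_norm ?exprn_ge0 ?divr_ge0 // => hm.
pose j := Num.truncn (x * 4 ^+ m); have p4 : 0 < 4 ^+ m :> R by rewrite exprn_gt0.
have /andP[j1 j2] : j%:R <= x * 4 ^+ m < j.+1%:R.
  by apply: truncn_itv; rewrite mulr_ge0 // ltW.
have jm : (j <= 4 ^ m)%N.
  by rewrite -(ler_nat R) natrX (le_trans j1) // ler_piMl // ltW.
have h1 := chaining_grid b0 hf jm.
have h2 : `|f x - f (j%:R / 4 ^+ m)| < d.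
  apply: he; rewrite /ball /=.
  have j1' : j%:R / 4 ^+ m <= x by rewrite ler_pdivrMr.
  rewrite ger0_norm ?subr_ge0 //; apply: le_lt_trans hm.
  rewrite expr_div_n expr1n ler_pdivlMr // mulrBl divfK ?gt_eqF // ltW //.
  by rewrite ltrBlDl natr1.
rewrite -(subrKA (f (j%:R / 4 ^+ m))); apply: le_trans (ler_normD _ _) _.
rewrite lerD //; last by rewrite distrC ltW.
apply: le_trans h1 _; rewrite ler_piMr ?mulr_ge0 // gerBl exprn_ge0 // divr_ge0 //.
Qed.

(** The factor is 13 = 1 + 12: one unit for the jump from 0 to the nearest integer time above [t],
    twelve for chaining inside the unit interval. *)
Lemma path_growth (w : R -> R) (a : R) : 0 <= a -> continuous w -> w 0 = 0 ->
  (forall n : nat, `|w (- n.+1%:R) - w 0| <= a * (1 + n.+1%:R)) ->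
  (forall n m j : nat, (j < 4 ^ m)%N ->
     `|w (- (n%:R + j%:R / 4 ^+ m)) - w (- (n%:R + j.+1%:R / 4 ^+ m))|
        <= a * (1 + n%:R) * (3 / 4) ^+ m) ->
  forall t, t <= 0 -> `|w t| <= 13 * a * (1 + `|t|).
Proof.
move=> a0 cw w0 hI hL t t0; rewrite [`|t|]ler0_norm //.
set n := Num.truncn (- t).
have /andP[n1 n2] : n%:R <= - t < n.+1%:R by apply: truncn_itv; rewrite oppr_ge0.
pose f x := w (- (n%:R + x)).
have cf : continuous f.
  move=> x; apply: (@cvg_comp _ _ _ (fun x => - (n%:R + x)) w _ (nbhs (- (n%:R + x)))); last exact: cw.
  by apply: (@cvgN _ R^o); apply: (@cvgD _ R^o); [exact: cvg_cst|exact: cvg_id].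
have b0 : 0 <= a * (1 + n%:R) by rewrite mulr_ge0 // addr_ge0.
have x01 : 0 <= - t - n%:R <= 1.
  by rewrite subr_ge0 n1 lerBlDr addrC natr1 ltW.
have := chaining_unit b0 cf (hL n) x01.
rewrite /f addr0 (addrC n%:R) subrK opprK => h.
have wn : `|w (- n%:R)| <= a * (1 + n%:R).
  move: {n2 h x01 f cf n1} n b0 => [|k] b0; first by rewrite oppr0 w0 normr0.
  by have := hI k; rewrite w0 subr0.
have -> : w t = w (- n%:R) - (w (- n%:R) - w t) by rewrite opprB addrC subrK.
apply: le_trans (ler_normB _ _) _; apply: le_trans (lerD wn h) _.
have -> : a * (1 + n%:R) + 12 * (a * (1 + n%:R)) = 13 * a * (1 + n%:R) by ring.
by rewrite ler_wpM2l ?mulr_ge0 // lerD2l.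
Qed.

End Chaining.

(** * Gaussian tails *)

Section Gauss.
Context {R : realType}.
Local Notation mu := (@lebesgue_measure R).

(** Exponential tilting: on [D] the centred density is at most e^{-b^2 / (2 s^2)} times the density
    with mean [m], whose total mass is 1. The means b and -b give the two tails. *)
Lemma normal_shift_le (m s b : R) (D : set R) : s != 0 -> measurable D ->
  (forall x, D x -> b ^+ 2 + (x - m) ^+ 2 <= x ^+ 2) ->
  (normal_prob 0 s D <= (expR (- (b ^+ 2 / (s ^+ 2 *+ 2))))%:E)%E.
Proof.
move=> s0 mD hD.
have s2 : 0 < s ^+ 2 *+ 2 by rewrite pmulrn_lgt0 // exprn_even_gt0.
apply: (@le_trans _ _ (\int[mu]_(x in D) ((expR (- (b ^+ 2 / (s ^+ 2 *+ 2))))%:E * (normal_pdf m s x)%:E))%E).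
  apply: ge0_le_integral => //.
  - by move=> x _; rewrite lee_fin normal_pdf_ge0.
  - by apply/measurable_EFinP; exact: measurable_funTS (measurable_normal_pdf _ _).
  - apply/measurable_EFinP; apply: measurable_funM; first exact: measurable_cst.
    exact: measurable_funTS (measurable_normal_pdf _ _).
  - move=> x Dx; rewrite -EFinM lee_fin !normal_pdfE // mulrCA.
    rewrite ler_wpM2l ?normal_peak_ge0 // /normal_fun -expRD ler_expR subr0.
    rewrite -(mulNr (b ^+ 2)) -mulrDl ler_pM2r ?invr_gt0 // -opprD lerN2.
    exact: hD.
have mp : measurable_fun D (fun x => (normal_pdf m s x)%:E).
  by apply/measurable_EFinP; exact: measurable_funTS (measurable_normal_pdf _ _).
have p0 x : D x -> (0 <= (normal_pdf m s x)%:E)%E by rewrite lee_fin normal_pdf_ge0.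
rewrite ge0_integralZl //.
rewrite -[leRHS]mule1; apply: lee_wpmul2l; first by rewrite lee_fin expR_ge0.
rewrite -(integral_normal_pdf m s); apply: ge0_subset_integral => //.
  by apply/measurable_EFinP; exact: measurable_normal_pdf.
by move=> x _; rewrite lee_fin normal_pdf_ge0.
Qed.

Lemma tail_setE (b : R) : [set x : R | b < `|x|] = `]b, +oo[ `|` `]-oo, - b[.
Proof.
apply/seteqP; split=> x /=; rewrite !in_itv /= andbT ltrNr.
  by rewrite lter_normr => /orP.
by rewrite lter_normr => H; apply/orP.
Qed.

Lemma normal_tail (s b : R) : s != 0 -> 0 <= b ->
  (normal_prob 0 s [set x | (b < `|x|)%R] <= (2 * expR (- (b ^+ 2 / (s ^+ 2 *+ 2))))%:E)%E.
Proof.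
move=> s0 b0.
rewrite tail_setE.
apply: le_trans (measureU2 (normal_prob 0 s) (measurable_itv _) (measurable_itv _)) _.
rewrite mulr_natl mulr2n EFinD; apply: leeD.
  apply: (@normal_shift_le b) => // x /=; rewrite in_itv /= andbT => bx; nra.
apply: (@normal_shift_le (- b)) => // x /=; rewrite in_itv /= => bx; nra.
Qed.

End Gauss.

(** * Linear growth of Wiener paths with high probability *)

Section Wiener.
Context {R : realType} (P : probability (@wiener_space R) R).
Hypothesis hP : wiener_measure P.

Lemma measurable_coord (t : R) :
  measurable_fun [set: @wiener_space R] (fun w : @wiener_space R => (w : wpath R) t).
Proof.
move=> _ Y mY; rewrite setTI; apply: sub_sigma_algebra.
by exists t, Y.
Qed.

Definition jump_set (t u b : R) : set (@wiener_space R) :=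
  [set w : wpath R | b < `|w u - w t|].

Lemma measurable_jump_set t u b : measurable (jump_set t u b).
Proof.
have m : measurable_fun [set: @wiener_space R] (fun w : @wiener_space R => (w : wpath R) u - (w : wpath R) t).
  by apply: measurable_funB; exact: measurable_coord.
have mB : measurable [set x : R | b < `|x|].
  by rewrite tail_setE; apply: measurableU; exact: measurable_itv.
have := m measurableT _ mB; rewrite setTI; exact.
Qed.

Lemma jump_set_le (t u b : R) : t < u -> 0 <= b ->
  (P (jump_set t u b) <= (2 * expR (- (b ^+ 2 / ((u - t) *+ 2))))%:E)%E.
Proof.
move=> tu b0; have d0 : 0 < u - t by rewrite subr_gt0.
have mB : measurable [set x : R | b < `|x|].
  by rewrite tail_setE; apply: measurableU; exact: measurable_itv.
have := hP (n := 1%N) (t := fun i => if i is 0%N then t else u) (B := fun=> [set x : R | b < `|x|]).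
rewrite big_ord1 /= => e.
have -> : jump_set t u b = [set w : wpath R | forall i, (i < 1)%N ->
   [set x : R | b < `|x|] (w u - w (if i is 0%N then t else u))].
  apply/seteqP; split=> w /=; first by move=> h [|//].
  by move=> /(_ 0%N isT).
rewrite e //; last by case.
apply: le_trans (normal_tail _ b0) _; first by rewrite gt_eqF // sqrtr_gt0.
by rewrite sqr_sqrtr // ltW.
Qed.

(* With [a^2 = 2 X], an increment over an interval of length [4^-m] inside [[-n - 1, -n]] exceeds
   [a (1 + n) (3/4)^m] with probability at most [2 exp(- X (1 + n)^2 (9/4)^m)], which is at most
   [2 exp(- X (1 + l))] for [l = n + m]; there are at most [(l + 1) 4^l] such events for each [l]. *)
Lemma growth_event (Om : set (@wiener_space R)) (X : R) :
  measurable Om -> P Om = 1%E -> 4 <= X ->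
  exists A : set (@wiener_space R), [/\ measurable A, A `<=` Om,
    ((1 - 9 * expR (- X))%:E < P A)%E &
    forall w : wpath R, A w -> forall t, t <= 0 ->
      `|w t| <= 13 * Num.sqrt (2 * X) * (1 + `|t|)].
Proof.
move=> mOm POm X4; set a := Num.sqrt (2 * X).
have X0 : 0 < X by lra.
have a0 : 0 <= a by exact: sqrtr_ge0.
have a2 : a ^+ 2 = 2 * X by rewrite sqr_sqrtr // mulr_ge0 // ltW.
pose I l := jump_set (- l.+1%:R) 0 (a * (1 + l.+1%:R)).
pose L n m j := jump_set (- (n%:R + j.+1%:R / 4 ^+ m)) (- (n%:R + j%:R / 4 ^+ m))
  (a * (1 + n%:R) * (3 / 4) ^+ m).
(* Index 0 is the jump from 0; the successor of m 4^l + j encodes the increment number j at level m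
   of the unit interval n = l - m. Values of j from 4^m up to 4^l also occur; they only add events
   obeying the same bound. *)
pose E l k := if k is k'.+1 then L (l - k' %/ 4 ^ l)%N (k' %/ 4 ^ l)%N (k' %% 4 ^ l)%N else I l.
have mE l k : measurable (E l k) by case: k => [|k]; exact: measurable_jump_set.
pose c := 2 * expR (- X).
have PE l k : (k < (l.+1 * 4 ^ l).+1)%N -> (P (E l k) <= (c * expR (- X * l%:R))%:E)%E.
  have cE : c * expR (- X * l%:R) = 2 * expR (- (X * (1 + l%:R))).
    by rewrite /c -mulrA -expRD; congr (_ * expR _); ring.
  have l0 : 0 <= l%:R :> R by [].
  rewrite cE; case: k => [_|k kl] /=.
    have t0 : - l.+1%:R < 0 :> R by rewrite oppr_lt0.
    apply: le_trans (jump_set_le t0 _) _; first by rewrite mulr_ge0 // addr_ge0.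
    rewrite lee_fin ler_pM2l // ler_expR lerN2 exprMn a2 sub0r opprK.
    rewrite ler_pdivlMr ?pmulrn_lgt0 // -natr1 -mulr_natr; nra.
  set m := (k %/ 4 ^ l)%N; set j := (k %% 4 ^ l)%N; set n := (l - m)%N.
  have ml : (m <= l)%N by rewrite -ltnS /m ltn_divLR ?expn_gt0.
  have nm : l%:R = n%:R + m%:R :> R by rewrite -natrD subnK.
  have p4 : 0 < 4 ^+ m :> R by rewrite exprn_gt0.
  have tu : - (n%:R + j.+1%:R / 4 ^+ m) < - (n%:R + j%:R / 4 ^+ m) :> R.
    by rewrite ltrN2 ltrD2l ltr_pM2r ?invr_gt0 // ltr_nat.
  have n0 : 0 <= n%:R :> R by []. have m0 : 0 <= m%:R :> R by [].
  apply: le_trans (jump_set_le tu _) _.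
    by rewrite !mulr_ge0 ?exprn_ge0 ?divr_ge0 // addr_ge0.
  rewrite lee_fin ler_pM2l // ler_expR lerN2.
  have -> : - (n%:R + j%:R / 4 ^+ m) - - (n%:R + j.+1%:R / 4 ^+ m) = (4 ^+ m)^-1 :> R.
    by rewrite -[j.+1%:R]natr1; ring.
  rewrite ler_pdivlMr ?pmulrn_lgt0 ?invr_gt0 // -[_ *+ 2]mulr_natr mulrA.
  rewrite -[leLHS]mulrAC ler_pdivrMr // [(_ * (3 / 4) ^+ m) ^+ 2]exprMn [(a * _) ^+ 2]exprMn a2.
  have b1 : 1 + m%:R <= (9 / 4) ^+ m :> R.
    elim: (m) => [|i ih]; first by rewrite expr0 addr0.
    have i0 : 0 <= i%:R :> R by [].
    by rewrite exprS -natr1; lra.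
  have q94 : ((3 / 4) ^+ m) ^+ 2 * 4 ^+ m = (9 / 4) ^+ m :> R.
    by rewrite -exprM mulnC exprM -exprMn; congr (_ ^+ _); field.
  rewrite [leRHS](_ : _ = 2 * X * ((1 + n%:R) ^+ 2 * (9 / 4) ^+ m)); last by rewrite -q94; ring.
  rewrite nm.
  rewrite [leLHS](_ : _ = 2 * X * (1 + (n%:R + m%:R))); last by ring.
  rewrite ler_pM2l ?mulr_gt0 //.
  apply: (@le_trans _ _ ((1 + n%:R) ^+ 2 * (1 + m%:R))); first by nra.
  by rewrite ler_wpM2l ?sqr_ge0.
pose K l := (l.+1 * 4 ^ l).+1.
pose bad l := \big[setU/set0]_(k < K l) E l k.
have mbad l : measurable (bad l) by apply: bigsetU_measurable => k _.
(* There are at most 2 * 8^l events for each [l], so 8 e^{-X} <= 1/2 makes the union bound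
   geometric; this is the use of X >= 4. *)
have e16 : expR (- X) <= 1 / 16.
  have e2 : 2 <= expR 1 :> R by have := @expR_ge1Dx R 1; lra.
  have e4 : 16 <= expR X.
    apply: (@le_trans _ _ (expR 4)); last by rewrite ler_expR.
    have -> : (4 : R) = 4%:R * 1 by rewrite mulr1.
    rewrite expRM_natl; apply: (@le_trans _ _ (2 ^+ 4)); first by lra.
    by rewrite lerXn2r // nnegrE ?expR_ge0.
  by rewrite expRN div1r lef_pV2 // ?posrE ?expR_gt0.
have c0 : 0 <= c by rewrite mulr_ge0 // expR_ge0.
have Pbad l : (P (bad l) <= (2 * c * (1 / 2) ^+ l)%:E)%E.
  apply: le_trans (Boole_inequality P (fun k _ => mE l k)) _.
  apply: (@le_trans _ _ (\sum_(k < K l) (c * expR (- X * l%:R))%:E)%E).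
    by apply: lee_sum => k _; apply: PE.
  rewrite sumEFin lee_fin sumr_const card_ord -[leLHS]mulr_natr.
  have Kl : (K l)%:R <= 2 * 8 ^+ l :> R.
    have h1 : (l.+1 <= 2 ^ l)%N by exact: ltn_expl.
    have h2 : (l.+1 * 4 ^ l <= 8 ^ l)%N by rewrite -[8%N]/(2 * 4)%N expnMn leq_mul2r h1 orbT.
    have h3 : ((l.+1 * 4 ^ l).+1 <= 2 * 8 ^ l)%N.
      by rewrite mul2n -addnn -addn1 leq_add // expn_gt0.
    by rewrite -natrX -natrM ler_nat.
  have h : 8 ^+ l * expR (- X * l%:R) <= (1 / 2) ^+ l.
    rewrite [- X * _]mulrC expRM_natl -exprMn lerXn2r // ?nnegrE ?mulr_ge0 ?expR_ge0 ?divr_ge0 //.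
    lra.
  apply: (@le_trans _ _ (c * expR (- X * l%:R) * (2 * 8 ^+ l))).
    by rewrite ler_wpM2l // mulr_ge0 // expR_ge0.
  have -> : c * expR (- X * l%:R) * (2 * 8 ^+ l) = 2 * c * (8 ^+ l * expR (- X * l%:R)) by ring.
  by rewrite ler_wpM2l // mulr_ge0.
pose B := \bigcup_l bad l.
have mB : measurable B by apply: bigcup_measurable.
have PB : (P B <= (4 * c)%:E)%E.
  apply: le_trans (generalized_Boole_inequality P mbad mB) _.
  apply: lime_le; first by apply: is_cvg_nneseries => n _ _; exact: measure_ge0.
  apply: nearW => n.
  apply: (@le_trans _ _ (\sum_(0 <= l < n) (2 * c * (1 / 2) ^+ l)%:E)%E).
    by apply: lee_sum => l _; exact: Pbad.
  rewrite sumEFin lee_fin.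
  suff -> : \sum_(0 <= l < n) 2 * c * (1 / 2) ^+ l = 4 * c * (1 - (1 / 2) ^+ n).
    by rewrite ler_piMr ?mulr_ge0 // gerBl exprn_ge0 // divr_ge0.
  elim: n => [|n ih]; first by rewrite big_geq // expr0 subrr mulr0.
  by rewrite big_nat_recr //= ih exprS; field.
exists (Om `\` B); split.
- exact: measurableD.
- by move=> w [].
- have -> : P (Om `\` B) = (P Om - P (Om `&` B))%E.
    by apply: measureD => //; apply: (le_lt_trans (probability_le1 P mOm)); exact: ltry.
  rewrite POm; have h : (P (Om `&` B) <= (4 * c)%:E)%E.
    apply: le_trans PB; apply: le_measure; rewrite ?inE //; first exact: measurableI.
  (* The bad set has measure at most 4c = 8 e^{-X}; the constant 9 leaves a strict inequality. *)
  apply: (@lt_le_trans _ _ (1 - (4 * c)%:E)%E); last exact: leeB.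
  rewrite -EFinB lte_fin /c; have := expR_gt0 (- X); lra.
- move=> w [_ nB].
  have nbad l k : (k < K l)%N -> ~ E l k w.
    move=> kl Ew; apply: nB; exists l => //.
    by rewrite /bad -(bigcup_mkord _ (E l)); exists k.
  apply: path_growth => //; [exact: wfun_continuous|exact: wfun0| |].
    move=> n; rewrite distrC leNgt; apply/negP => h.
    by apply: (@nbad n 0%N).
  move=> n m j jm; rewrite leNgt; apply/negP => h.
  pose l := (n + m)%N.
  have jl : (j < 4 ^ l)%N by rewrite (leq_trans jm) // leq_exp2l // leq_addl.
  apply: (@nbad l (m * 4 ^ l + j).+1).
    rewrite /K ltnS -addn1; apply: (@leq_trans (m * 4 ^ l + 4 ^ l)).
      by rewrite -addnA leq_add2l addn1.
    by rewrite -mulSnr leq_mul2r ltnS leq_addl orbT.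
  rewrite /E /= divnMDl ?expn_gt0 // divn_small // addn0 modnMDl modn_small //.
  by rewrite /l addnK.
Qed.

End Wiener.

(** * The estimate for the manifold *)

Section Nonlinearity.
Context {R : realType} {H : completeNormedModType R} (S : model H).
Hypotheses (hip : inner_product S) (hb : orthonormal_basis S).
Hypotheses (hev : forall k, 0 <= ev S k) (hal : 0 < alpha S < 1).
Hypotheses (hA3 : A3 S) (hchi : cutoff S).
Local Notation nn := (neg_norm S).

Lemma Hneg_bil u v : Hneg S (bil S u v).
Proof. by have [_ /(_ u v) [] ] := hA3. Qed.

Lemma nn_bil u v : nn (bil S u v) <= CB S * `|u| * `|v|.
Proof. by have [_ /(_ u v) [] ] := hA3. Qed.

Lemma CB_ge0 : 0 <= CB S.
Proof.
have := nn_bil (eb S 0%N) (eb S 0%N); rewrite norm_eb // !mulr1.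
by apply: le_trans; exact: neg_norm_ge0.
Qed.

Lemma Hneg_BR r u : Hneg S (BR S r u).
Proof. by apply: HnegZl => //; exact: Hneg_bil. Qed.

Lemma BR_at0 r w : Hpos S w -> BR S r 0 w = 0.
Proof.
move=> hw; have [_ _ lin _ _] := hA3.
have := lin (-1) 0 0 0 w hw; rewrite scaler0 addr0 mulN1r addNr => e.
by rewrite /BR e mulr0.
Qed.

Lemma nn_BR_lip (r : R) u v : 0 < r -> nn (BR S r u \- BR S r v) <= L_R S r * `|u - v|.
Proof. by move=> r0; have [_ _ _ _] := hchi; exact. Qed.

Lemma nn_BR_sq (K r : R) u : (forall u, `|chi S u| <= K) ->
  nn (BR S r u) <= K * CB S * `|u| ^+ 2.
Proof.
move=> hK; apply: le_trans (neg_normZl hip hb hev hal _ (Hneg_bil u u)) _.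
rewrite -mulrA; apply: ler_pM => //; first exact: neg_norm_ge0.
by apply: le_trans (nn_bil _ _) _; rewrite -mulrA -expr2.
Qed.

(** For |u| <= r the cut-off is 1 and the difference is B(u - xi, u + xi). For |u| > r the bound
    |xi| <= r/2 forces |u - xi| >= |u|/2, so the sizes of the two terms suffice. This is where the
    restriction on xi enters. *)
Lemma nn_BR_diff (K r : R) u xi : (forall u, `|chi S u| <= K) -> 0 < r ->
  `|xi| <= r / 2 ->
  nn (BR S r u \- bil S xi xi) <= 2 * K * CB S * (`|u - xi| * (`|u| + `|xi|)).
Proof.
move=> hK r0 xir; have [_ _ lin sym _] := hA3; have [_ _ chi1 _ _] := hchi.
have CB0 := CB_ge0.
have K1 : 1 <= K by have := hK 0; rewrite chi1 ?normr0 ?normr1.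
have [ur|ur] := lerP `|u| r.
  have -> : nn (BR S r u \- bil S xi xi) = nn (bil S (u - xi) (u + xi)).
    apply: eq_neg_norm => w hw; rewrite /= /BR chi1.
      have e1 : bil S (u - xi) (u + xi) w = bil S u (u + xi) w - bil S xi (u + xi) w.
        by rewrite [u - xi]addrC -scaleN1r lin // mulN1r addrC.
      have e2 v : bil S v (u + xi) w = bil S v u w + bil S v xi w.
        by rewrite sym // -{1}[u]scale1r lin // mul1r !(sym v).
      by rewrite mul1r e1 !e2 (sym xi u) //; ring.
    by rewrite normrZ gtr0_norm ?invr_gt0 // mulrC ler_pdivrMr // mul1r.
  apply: le_trans (nn_bil _ _) _; rewrite -mulrA.
  have h := ler_normD u xi.
  apply: (@le_trans _ _ (CB S * (`|u - xi| * (`|u| + `|xi|)))).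
    by rewrite ler_wpM2l // ler_wpM2l.
  rewrite ler_wpM2r ?mulr_ge0 ?addr_ge0 // -[leLHS]mul1r ler_wpM2r //; lra.
have h0 : nn (BR S r u \- bil S xi xi) <= nn (BR S r u) + nn (bil S xi xi).
  have := neg_norm_comb2 hip hb hev hal (-1) (Hneg_bil xi xi) (Hneg_BR r u).
  rewrite normrN1 mul1r [leRHS]addrC; congr (_ <= _); apply: eq_neg_norm => v _ /=.
  by rewrite mulN1r addrC.
apply: le_trans h0 _.
have h1 := nn_BR_sq r u hK; have h2 := nn_bil xi xi.
have h3 : `|u| - `|xi| <= `|u - xi| by exact: lerB_dist.
apply: le_trans (lerD h1 h2) _.
have n0 : 0 <= `|xi| by []; set a := `|xi| in h3 xir n0 *; set x := `|u| in h3 ur *.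
have ux : x / 2 <= `|u - xi| by lra.
apply: (@le_trans _ _ (2 * K * CB S * (x / 2 * (x + a)))); last first.
  have K0 : 0 <= K by lra.
  have x0 : 0 <= x by exact: normr_ge0.
  apply: ler_wpM2l; first by nonneg.
  by apply: ler_wpM2r => //; nonneg.
have -> : 2 * K * CB S * (x / 2 * (x + a)) = K * CB S * x ^+ 2 + K * CB S * (x * a) by field.
rewrite lerD2l -mulrA [K * _]mulrC -mulrA ler_wpM2l //.
apply: (@le_trans _ _ (x * a)); first by rewrite ler_wpM2r //; lra.
by rewrite ler_peMl // mulr_ge0 //; exact: normr_ge0.
Qed.

End Nonlinearity.

(** * Signs, monotonicity and sizes of the constants *)

Section Constants.
Context {R : realType} {H : completeNormedModType R} (S : model H).
Hypotheses (hip : inner_product S) (hb : orthonormal_basis S).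
Hypotheses (hev : forall k, 0 <= ev S k) (hal : 0 < alpha S < 1).
Local Notation nn := (neg_norm S).
Local Notation N := (dimc S).
Context (lambda M Ca : R).
Hypothesis hM : forall (t : R) (f : H -> R), 0 < t -> Hneg S f ->
     `|semigroup S t (Ps S f)| <=
       M * expR (- lambda * t) * t `^ (- alpha S) * nn (Ps S f).
Hypothesis hCa : forall f : H -> R, Hneg S f ->
     `|Pc S f| <= Ca * nn (ip S (Pc S f)).

Lemma Hneg_ip u : Hneg S (ip S u).
Proof.
split; first by move=> a v v' _ _; rewrite ipDr // ipZr.
exists `|u| => v hv; apply: le_trans (cauchy_schwarz hip _ _) _.
by rewrite ler_wpM2l // norm_le_pos_norm.
Qed.

(** The constants are given without sign. A negative one would make the semigroup annihilate the
    first stable mode, whose coordinate at time 1 is positive; [center_const_ge0] tests the first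
    mode of the kernel. *)
Lemma semigroup_const_ge0 : 0 <= M.
Proof.
rewrite leNgt; apply/negP => M0.
have := hM ltr01 (Hneg_ip (eb S N)).
have n0 := neg_norm_ge0 hip hb hev hal (Ps S (ip S (eb S N))).
rewrite powR1 mulr1 => h.
have : `|semigroup S 1 (Ps S (ip S (eb S N)))| = 0.
  apply/eqP; rewrite eq_le normr_ge0 andbT; apply: le_trans h _.
  by rewrite mulr_le0_ge0 // mulr_le0_ge0 ?expR_ge0 // ltW.
move/normr0_eq0 => e.
have := ip_semigroup_Ps hip hb hev hal N (@ltr01 R) (Hneg_ip (eb S N)).
rewrite e ip0l // ltnn ebE // eqxx mulr1 => /esym/eqP.
by rewrite gt_eqF // expR_gt0.
Qed.

Lemma center_const_ge0 : (0 < N)%N -> 0 <= Ca.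
Proof.
move=> N0; rewrite leNgt; apply/negP => C0.
have := hCa (Hneg_ip (eb S 0%N)).
have -> : Pc S (ip S (eb S 0%N)) = eb S 0%N.
  apply: (ip_ext hb) => k; rewrite ip_Pc //; case: ifP => // kN.
  by rewrite ebE //; case: eqP kN => // <-; rewrite N0.
rewrite norm_eb // => h.
have n0 := neg_norm_ge0 hip hb hev hal (ip S (eb S 0%N)).
by have := le_trans h (mulr_le0_ge0 (ltW C0) n0); rewrite ler10.
Qed.

End Constants.

Lemma expR_sub1_le {R : realType} (x : R) : `|expR x - 1| <= `|x| * expR `|x|.
Proof.
have h1 := @expR_ge1Dx R x; have h2 := @expR_ge1Dx R (- x).
have [x0|x0] := lerP 0 x.
  have e1 : 1 <= expR x by lra.
  rewrite ger0_norm ?subr_ge0 // ger0_norm //.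
  have e : expR x * expR (- x) = 1 by rewrite -expRD subrr expR0.
  have := expR_gt0 x; nra.
have e1 : expR x <= 1 by rewrite -expR0 ler_expR ltW.
have e2 : 1 <= expR (- x) by rewrite -expR0 ler_expR oppr_ge0 ltW.
rewrite ler0_norm ?subr_le0 // [`|x|]ltr0_norm //.
apply: (@le_trans _ _ (- x)); first by lra.
by rewrite ler_peMr // oppr_ge0 ltW.
Qed.

(** Half of the rate [mu] absorbs e^{theta |t|}, the other half the linear factor 1 + |t|. *)
Lemma expR_sub1_growth {R : realType} (theta mu x t : R) :
  0 < mu -> 0 <= theta <= 1 -> theta <= mu / 2 -> t <= 0 ->
  `|x| <= theta * (1 + `|t|) ->
  `|expR x - 1| <= theta * expR 1 * (1 + 2 / mu) * expR (- mu * t).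
Proof.
move=> mu0 /andP[th0 th1] thm t0; rewrite [`|t|]ler0_norm // => hx.
set s := - t in hx *; have s0 : 0 <= s by rewrite oppr_ge0.
have -> : - mu * t = mu / 2 * s + mu / 2 * s by rewrite /s; field.
apply: le_trans (expR_sub1_le x) _.
apply: (@le_trans _ _ (theta * (1 + s) * expR (1 + mu / 2 * s))).
  apply: ler_pM => //; rewrite ?expR_ge0 //.
  rewrite ler_expR (le_trans hx) // mulrDr mulr1 lerD // ler_wpM2r //.
rewrite !expRD.
have h : 1 + s <= (1 + 2 / mu) * expR (mu / 2 * s).
  apply: (@le_trans _ _ ((1 + 2 / mu) * (1 + mu / 2 * s))).
    have -> : (1 + 2 / mu) * (1 + mu / 2 * s) = 1 + s + (2 / mu + mu / 2 * s).
      by field; rewrite gt_eqF.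
    by rewrite lerDl addr_ge0 ?divr_ge0 ?mulr_ge0 // ?ltW // divr_ge0 // ltW.
  by rewrite ler_wpM2l ?expR_ge1Dx // addr_ge0 // divr_ge0 // ltW.
have -> : theta * expR 1 * (1 + 2 / mu) * (expR (mu / 2 * s) * expR (mu / 2 * s)) =
  theta * (expR 1 * expR (mu / 2 * s)) * ((1 + 2 / mu) * expR (mu / 2 * s)) by ring.
rewrite mulrAC ler_wpM2l // !mulr_ge0 ?expR_ge0 //.
Qed.

Lemma stable_const_le {R : realType} {H : completeNormedModType R} (S : model H)
  (lambda M b b1 : R) : alpha S < 1 -> 0 <= M -> b <= b1 -> b1 < lambda ->
  stable_const S lambda M b <= stable_const S lambda M b1.
Proof.
move=> al1 M0 bb1 b1l.
rewrite /stable_const ler_wpM2l // ler_wpM2l ?Gamma_ge0 //.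
have h1 : 0 < lambda - b1 by rewrite subr_gt0.
have h : 0 < lambda - b by rewrite subr_gt0 (le_lt_trans bb1).
by rewrite lef_pV2 ?posrE ?powR_gt0 // ge0_ler_powR ?nnegrE ?(ltW h) ?(ltW h1) ?subr_ge0 ?(ltW al1) //; lra.
Qed.

(** The centre part decreases in the exponent and the stable part increases, so each is taken at its
    own end of the range. *)
Lemma lp_const_le {R : realType} {H : completeNormedModType R} (S : model H)
  (lambda M Ca b b0 b1 : R) : 0 < alpha S < 1 -> 0 <= M -> 0 <= Ca ->
  0 < b0 <= b -> b <= b1 -> b1 < lambda ->
  lp_const S lambda M Ca b <= Ca / b0 + stable_const S lambda M b1.
Proof.
move=> /andP[_ al1] M0 Ca0 /andP[b00 b0b] bb1 b1l.
have bp := lt_le_trans b00 b0b.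
apply: lerD; last exact: stable_const_le.
by rewrite ler_wpM2l // lef_pV2 ?posrE.
Qed.

(** The factor is 27 = 1 + 26. The drift contributes |nu| < sigma <= sqrt sigma. In the path term,
    sqrt sigma times the root is sqrt(2 sqrt sigma) <= 2, which leaves 26 sqrt sigma. *)
Lemma log_scaling_le {R : realType} (sigma nu t x : R) : 0 < sigma ->
  Num.sqrt sigma < 1 / 4 -> `|nu| < sigma ->
  `|x| <= 13 * Num.sqrt (2 * (1 / Num.sqrt sigma)) * (1 + `|t|) ->
  `|nu * t + sigma * x| <= 27 * Num.sqrt sigma * (1 + `|t|).
Proof.
set ss := Num.sqrt sigma => sig0 ss4 nus xt.
have ss0 : 0 < ss by rewrite sqrtr_gt0.
have ss2 : sigma = ss ^+ 2 by rewrite sqr_sqrtr // ltW.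
have t1 : 0 <= `|t| by [].
apply: le_trans (ler_normD _ _) _; rewrite !normrM (gtr0_norm sig0).
have q2 : ss * Num.sqrt (2 * (1 / ss)) <= 2.
  have e : ss * Num.sqrt (2 * (1 / ss)) = Num.sqrt (2 * ss).
    rewrite -{1}(ger0_norm (ltW ss0)) -sqrtr_sqr -sqrtrM ?sqr_ge0 //.
    by congr Num.sqrt; field; rewrite gt_eqF.
  rewrite e -[leRHS](ger0_norm (ler0n R 2)) -sqrtr_sqr ler_wsqrtr //; lra.
have h1 : `|nu| * `|t| <= ss * `|t|.
  by rewrite ler_wpM2r // (le_trans (ltW nus)) // ss2 expr2 ler_piMl //; lra.
have h2 : sigma * `|x| <= 26 * ss * (1 + `|t|).
  apply: le_trans (ler_wpM2l (ltW sig0) xt) _; rewrite ss2.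
  rewrite [leLHS](_ : _ = 13 * ss * (ss * Num.sqrt (2 * (1 / ss))) * (1 + `|t|)); last by ring.
  rewrite ler_wpM2r ?addr_ge0 //.
  apply: le_trans (ler_wpM2l _ q2) _; first by rewrite mulr_ge0 // ltW.
  by rewrite le_eqVlt; apply/orP; left; apply/eqP; ring.
apply: le_trans (lerD h1 h2) _.
by have := mulr_ge0 (ltW ss0) t1; nra.
Qed.

(** Uniformity in nu: the exponents rho and 2 rho + mu stay between eta/12 and kappa, and kappa + 2
    mu keeps half of the gap to lambda. *)
Lemma exponents_le {R : realType} (eta lambda mu nu : R) (kappa := eta + nu)
  (rho := (kappa - 2 * mu) / 3) : 0 < eta < lambda -> 0 < mu ->
  mu <= eta / 8 -> mu <= (lambda - eta) / 8 ->
  `|nu| < eta / 2 -> `|nu| < (lambda - eta) / 4 ->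
  [/\ kappa = 3 * rho + 2 * mu, eta / 12 <= rho, rho <= kappa,
     eta / 12 <= 2 * rho + mu <= kappa & kappa + 2 * mu <= lambda - (lambda - eta) / 2].
Proof.
rewrite /rho /kappa => /andP[e0 el] m0 me ml /ltr_normlP[n1 n2] /ltr_normlP[n3 n4].
by split; rewrite ?ler_pdivlMr //; [field|lra..].
Qed.

Lemma small_factor {R : realType} (c x : R) : 0 <= c -> 0 <= x -> x < 1 / (c + 27) ->
  0 <= 27 * x <= 1 /\ 0 <= c * x <= 1.
Proof.
move=> c0 x0; rewrite ltr_pdivlMr ?ltr_wpDl // => h.
by have := mulr_ge0 c0 x0; split; nra.
Qed.

Theorem theorem3 (R : realType) (H : completeNormedModType R) (S : model H)
  (P : probability (@wiener_space R) R) (Om : set (@wiener_space R))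
  (eta lambda q M Calpha : R)
  (hA1 : A1 S) (hA2 : A2 S) (hA3 : A3 S) (hchi : cutoff S)
  (hP : wiener_measure P) (hOm : good_paths P Om)
  (heta : 0 < eta < ev S (dimc S))
  (hlambda : eta < lambda < ev S (dimc S))
  (hq : 0 < q < 1)
  (hM : forall (t : R) (f : H -> R), 0 < t -> Hneg S f ->
     `|semigroup S t (Ps S f)| <=
       M * expR (- lambda * t) * t `^ (- alpha S) * neg_norm S (Ps S f))
  (hCalpha : forall f : H -> R, Hneg S f ->
     `|Pc S f| <= Calpha * neg_norm S (ip S (Pc S f))) :
  exists C sigma0 : R, [/\ 0 < C, 0 < sigma0 &
    forall sigma nu r : R,
      0 < sigma < sigma0 -> `|nu| < sigma -> 0 < r <= 1 ->
      0 < eta + nu < lambda ->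
      L_R S r * (Calpha / (eta + nu)
        + M * (Gamma (1 - alpha S) / (lambda - eta - nu) `^ (1 - alpha S)))
        <= q ->
      exists A : set (@wiener_space R),
        [/\ measurable A, A `<=` Om,
            ((1 - C * expR (- (1 / Num.sqrt sigma)))%:E < P A)%E &
            forall (w : wpath R) (xi : H), A w -> Hc S xi ->
              `|xi| <= r / 2 ->
              `|expR (z0 sigma w) *:
                  h S eta nu sigma r w (expR (- z0 sigma w) *: xi)
                - Ls_inv S (Ps S (bil S xi xi))|
                <= C * (`|xi| + r ^+ 2 + Num.sqrt sigma) * `|xi| ^+ 2]].
Proof.
have [[hip _ _ _] _ hb _ ev_nd] := hA1.
have [N0 _ ev0 evN0] := hA2.
have hal : 0 < alpha S < 1 by case: hA3.
have ev_homo : {homo ev S : i j / (i <= j)%N >-> i <= j} by exact/nondecreasing_seqP.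
have hev k : 0 <= ev S k by rewrite -(ev0 0%N N0); exact: ev_homo.
have evN k : (dimc S <= k)%N -> 0 < ev S k.
  by move=> kN; apply: lt_le_trans evN0 _; exact: ev_homo.
have M0 : 0 <= M by exact: (semigroup_const_ge0 hip hb hev hal hM).
have Ca0 : 0 <= Calpha by exact: (center_const_ge0 hip hb hev hal hCalpha).
have CB0 : 0 <= CB S by exact: CB_ge0.
have [_ [K hK] chi1 _ _] := hchi.
have K1 : 1 <= K by have := hK 0; rewrite chi1 ?normr0 ?normr1.
have K0 : 0 <= K by exact: le_trans K1.
have K2 : 1 <= 2 * K by lra.
have [eta0 _] := andP heta; have [el _] := andP hlambda.
have [q0 q1] := andP hq; have [al0 al1] := andP hal.
pose g := lambda - eta; have g0 : 0 < g by rewrite subr_gt0.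
pose mu := Num.min (eta / 8) (g / 8).
have mu0 : 0 < mu by rewrite lt_min !divr_gt0.
have mue : mu <= eta / 8 by rewrite ge_min lexx.
have mug : mu <= g / 8 by rewrite ge_min lexx orbT.
(* One bound, independent of nu, for the constants at all the exponents in use. *)
pose Jm := Calpha / (eta / 12) + stable_const S lambda M (lambda - g / 2).
have kern0 : 0 <= stable_const S lambda M (lambda - g / 2) by exact: stable_const_ge0.
have Jm0 : 0 <= Jm by rewrite addr_ge0 // divr_ge0 // ltW // divr_gt0.
pose D : R := 2 * K * CB S; have D0 : 0 <= D by rewrite !mulr_ge0.
(* [k2] is 1 + A delta^2, which does not depend on delta. Hence eps = 4 D k2 delta, and 2 eps Jm <=
   1 - q fixes delta; the added 1 keeps its denominator positive. *)
pose k2 : R := 1 + 2 / (1 - q).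
have k20 : 0 < k2 by rewrite ltr_wpDr ?divr_ge0 // subr_ge0 ltW.
pose delta : R := (1 - q) / (8 * D * k2 * Jm + 1).
have dd : 0 < 8 * D * k2 * Jm + 1.
  by have k2' := ltW k20; rewrite ltr_wpDl // !mulr_ge0.
have delta0 : 0 < delta by rewrite divr_gt0 // subr_gt0.
pose Lm := 2 * CB S.
pose c1 := 27 * expR 1 * (1 + 2 / mu) : R.
have c10 : 0 < c1 by rewrite !mulr_gt0 ?expR_gt0 // addr_gt0 // divr_gt0.
(* The three bounds on sqrt sigma give X = 1/sqrt sigma >= 4 for the growth event, theta = 27 sqrt
   sigma <= mu/2, and theta <= 1 together with s = c1 sqrt sigma <= 1. *)
pose b := Num.min (1 / 4) (Num.min (mu / 54) (1 / (c1 + 27))) : R.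
have b0 : 0 < b by rewrite !lt_min !divr_gt0 // addr_gt0.
pose Cf := `|apriori_const D delta Jm Lm q * Jm| * (1 + c1).
have Cf0 : 0 <= Cf by rewrite mulr_ge0 // addr_ge0 // ltW.
(* The summand 9 serves the probability. The last two bounds on sigma pass to |nu| < sigma and feed
   [exponents_le]. *)
exists (Cf + 9), (Num.min (b ^+ 2) (Num.min (eta / 2) (g / 4))).
split; first by rewrite ltr_wpDl.
  by rewrite !lt_min exprn_gt0 // !divr_gt0.
move=> sigma nu r /andP[sig0]; rewrite !lt_min => /and3P[sigb sige sigg] nus /andP[r0 r1] hk hJ0.
set ss := Num.sqrt sigma.
have ss0 : 0 < ss by rewrite sqrtr_gt0.
have ss2 : ss ^+ 2 = sigma by rewrite sqr_sqrtr // ltW.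
have ssb : ss < b by rewrite -(@ltr_pXn2r _ 2) ?nnegrE ?(ltW ss0) ?(ltW b0) // ss2.
have [ss4 ssm ssc] : [/\ ss < 1 / 4, ss < mu / 54 & ss < 1 / (c1 + 27)].
  by move: ssb; rewrite !lt_min => /and3P.
have [mOm POm shOm intOm _] := hOm.
have X4 : 4 <= 1 / ss by move: ss4; rewrite ler_pdivlMr //; clear; lra.
have [A [mA AOm PA hA]] := growth_event hP mOm POm X4.
exists A; split=> //.
  apply: le_lt_trans PA; rewrite lee_fin lerD2l lerN2 ler_wpM2r ?expR_ge0 //.
  by rewrite lerDr.
move=> w xi Aw xiHc xir.
have iw t : (@lebesgue_measure R).-integrable `]-oo, 0] (fun s => (expR s * wshift t w s)%:E).
  by apply: intOm; apply: shOm; exact: AOm.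
pose L := L_R S r; pose kappa := eta + nu.
have L0 : 0 <= L by rewrite /L /L_R !mulr_ge0 // ltW.
have LLm : L <= Lm by rewrite /L /L_R /Lm ler_wpM2r // ler_piMr.
have hJ : L * lp_const S lambda M Calpha kappa <= q by rewrite /lp_const /stable_const /kappa opprD addrA.
have BRn := Hneg_BR hip hb hev hal hA3 r.
have BR0 := BR_at0 hA3 r.
have BRl u v : neg_norm S (BR S r u \- BR S r v) <= L * `|u - v| by exact: nn_BR_lip.
pose p := scaling nu sigma w.
have cp : continuous p by exact: continuous_scaling.
have p0 t : 0 < p t by exact: scaling_gt0.
have [Z [aZ fZ ->]] := h_transform hip hb hev hal M0 Ca0 hM hCalpha L0 BRn BR0 BRl iw hk xiHc
  (fixed_exists hip hb hev hal M0 Ca0 hM hCalpha L0 BRn BR0 BRl cp p0 xi hk hq hJ).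
have nue : `|nu| < eta / 2 by exact: lt_trans sige.
have nug : `|nu| < g / 4 by exact: lt_trans sigg.
pose rho := (kappa - 2 * mu) / 3.
have [|kE rho12 rhok /andP[mid1 mid2] kup] := exponents_le _ mu0 mue mug nue nug; rewrite ?eta0 //.
have rho0 : 0 < rho by apply: lt_le_trans rho12; rewrite divr_gt0.
have gl : lambda - g / 2 < lambda by rewrite gtrBl divr_gt0.
have e12 : 0 < eta / 12 by rewrite divr_gt0.
have Jle x : eta / 12 <= x -> x <= kappa -> lp_const S lambda M Calpha x <= Jm.
  move=> x1 x2; apply: lp_const_le => //; first by rewrite e12.
  by apply: le_trans kup; rewrite (le_trans x2) // lerDl mulr_ge0 // ltW.
have Jrho : lp_const S lambda M Calpha rho <= Jm by exact: Jle.
have Jk : lp_const S lambda M Calpha kappa <= Jm by exact: Jle (le_trans rho12 rhok) _.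
have Jmid : lp_const S lambda M Calpha (2 * rho + mu) <= Jm by exact: Jle.
have kernm : stable_const S lambda M (kappa + 2 * mu) <= Jm.
  apply: le_trans (stable_const_le al1 M0 kup gl) _.
  by rewrite /Jm lerDr divr_ge0 // ltW.
have kl : kappa + 2 * mu < lambda by exact: le_lt_trans gl.
pose theta := 27 * ss; pose s := c1 * ss.
have [th01 s01] := small_factor (ltW c10) (ltW ss0) ssc.
have thm : theta <= mu / 2.
  by move: ssm; rewrite /theta; clear; lra.
have sE : s = theta * expR 1 * (1 + 2 / mu) by rewrite /s /theta /c1; ring.
have logp t : t <= 0 -> `|nu * t + sigma * w t| <= theta * (1 + `|t|).
  by move=> t0; apply: log_scaling_le => //; exact: hA.
have hp t : t <= 0 -> `|p t - 1| <= s * expR (- mu * t).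
  move=> t0; rewrite sE /p /scaling (min_idPl t0).
  exact: expR_sub1_growth (logp t t0).
have hpV t : t <= 0 -> `|(p t)^-1 - 1| <= s * expR (- mu * t).
  move=> t0; rewrite sE /p /scaling (min_idPl t0) -expRN.
  by apply: expR_sub1_growth => //; rewrite normrN; exact: logp.
have BRsq u : neg_norm S (BR S r u) <= D * `|u| ^+ 2.
  apply: le_trans (nn_BR_sq hip hb hev hal hA3 r u hK) _.
  by rewrite ler_wpM2r ?sqr_ge0 // /D -mulrA ler_peMl ?ler1n // mulr_ge0.
have BRxi u : neg_norm S (BR S r u \- bil S xi xi) <= D * (`|u - xi| * (`|u| + `|xi|)).
  exact: nn_BR_diff.
have nnB : neg_norm S (bil S xi xi) <= D * `|xi| ^+ 2.
  apply: le_trans (nn_bil hA3 xi xi) _; rewrite -mulrA -expr2 ler_wpM2r ?sqr_ge0 //.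
  by rewrite /D ler_peMl.
have hB := Hneg_bil hA3 xi xi.
have epsJ : 2 * (4 * D * (delta + 2 * (delta ^+ 2)^-1 / (1 - q) * delta ^+ 3)) * Jm <= 1 - q.
  have -> : 2 * (4 * D * (delta + 2 * (delta ^+ 2)^-1 / (1 - q) * delta ^+ 3)) * Jm =
     8 * D * k2 * Jm * delta.
    by rewrite /k2; field; rewrite subr_eq0 (gt_eqF q1) (gt_eqF delta0).
  rewrite /delta mulrA ler_pdivrMr // mulrC ler_wpM2l ?subr_ge0 ?(ltW q1) //.
  by rewrite lerDl.
have := apriori hip hb hev hal M0 Ca0 hM hCalpha L0 BRn BR0 BRl cp p0 hk hq hJ D0 hB BRsq BRxi nnB
  s01 mu0 rho0 delta0 hp hpV kE kl Jrho Jk Jmid kernm LLm Jm0 epsJ aZ fZ.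
have fB : field S lambda (fun=> bil S xi xi) (D * `|xi| ^+ 2) kappa.
  exact: field_cst.
rewrite (stable_int_cst hip hb hev hal M0 hM N0 evN fB) => /le_trans; apply.
have x0 : 0 <= `|xi| by [].
have -> : `|xi| ^+ 3 + s * `|xi| ^+ 2 = (`|xi| + c1 * ss) * `|xi| ^+ 2 by rewrite /s; ring.
rewrite mulrA ler_wpM2r ?sqr_ge0 //.
apply: (@le_trans _ _ (Cf * (`|xi| + ss))).
  apply: (@le_trans _ _ (`|apriori_const D delta Jm Lm q * Jm| * (`|xi| + c1 * ss))).
    by rewrite ler_wpM2r ?ler_norm // addr_ge0 // mulr_ge0 // ltW.
  rewrite /Cf -mulrA ler_wpM2l //.
  by move: (mulr_ge0 (ltW c10) x0) ss0; clear; nra.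
apply: ler_pM => //; first by rewrite addr_ge0 // ltW.
  by rewrite lerDl.
by rewrite lerD2r lerDl sqr_ge0.
Qed.
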